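(* Let $k$ be a constant. Assume that for some $\epsilon<1$ there is a Boolean function $f\in\mathrm{E}$ such that for each sufficiently large $n$, no circuit of size $2^{\epsilon n}$ computes $f_n$ on a $(1/2+1/2^{\epsilon n})$ fraction of inputs. Let $P_\epsilon$ be the propositional proof system described in the context. If there are circuits of size $n^k$ solving the discrete logarithm problem for $\mathbb{Z}_q^\times$ with respect to a generator $g$, where $q\in(2^{n-1},2^n]$ is prime, then there are polynomial-size circuits $D$ such that $P_\epsilon$ has polynomial-size proofs of tautologies encoding the statement ''for all $b\in\mathbb{Z}_q^\times$, $g^{D(b)}=b$''.
   Context: The discrete logarithm problem for $G=\mathbb{Z}_q^\times$ with generator $g$: given $b\in G$, find $a$ with $g^a=b$. For an $n^k$-size circuit $C$, let $C'(b,r)$ (for $r\in[|G|]$) be the randomized circuit computing $C(b g^r)-r$; let $D_1$ be a $\mathrm{poly}(n)$-size circuit with input $b\in\{0,1\}^n$ computing the predicate $g^{C(b)}=b$ and $D_2$ a $\mathrm{poly}(n)$-size circuit with input $r\in\{0,1\}^n$ computing $g^{C'(b,r)}=b$, both rejecting inputs outside $G$. For constants $c',c''$ depending on $\epsilon$, $NW_f:\{0,1\}^{c'\lceil\log n\rceil}\to\{0,1\}^n$ is a polynomial-time Nisan–Wigderson generator based on $f$ restricted to $c''\lceil\log n\rceil$ inputs. $\mathrm{self}_n(p,b,C)$ is a $\mathrm{poly}(n)$-size propositional tautology, with free variables for an $n^k$-size circuit $C$, an $n$-bit string $b$ and an $n$-bit parameter $p$ (plus extension variables), encoding $$\Pr_{z\in\{0,1\}^{c'\lceil\log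 n\rceil}}[D_1(NW_f(z))=1]\ge p\ \rightarrow\ \forall b\in G,\ \Pr_{z\in\{0,1\}^{c'\lceil\log n\rceil}}[D_2(NW_f(z))=1]\ge \tfrac{p}{2}-\tfrac{3}{2n}$$ (with $q$ prime and $g$ a generator of $G$). $P_\epsilon$ is Extended Frege ($\mathrm{EF}$) with additional axioms allowing it to derive in one step any substitution instance of $\mathrm{self}_n(p,b,C)$ and of $\mathrm{tt}(f_n,2^{\epsilon n},1/2-1/2^{\epsilon n})$ for each sufficiently large $n$, where $\mathrm{tt}(f_n,s,t)$ is a propositional formula, with the truth table of $f_n$ hardwired and free variables encoding a circuit of size $s$, expressing that the circuit fails to compute $f_n$ on at least a $t$-fraction of inputs. *)

(* Defs.v *)
From HB Require Import structures.
From mathcomp Require Import all_boot all_order all_algebra.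
From mathcomp Require Import reals exp.

Set Implicit Arguments.
Unset Strict Implicit.
Unset Printing Implicit Defensive.

Import Order.TTheory GRing.Theory Num.Theory.

Local Open Scope nat_scope.

(** * Bit strings. Numbers are written in binary, least significant bit first. *)

Fixpoint bits_val (x : seq bool) : nat :=
  if x is b :: x' then b + (bits_val x').*2 else 0.

Definition bits (w x : nat) : seq bool := mkseq (fun i => odd (x %/ 2 ^ i)) w.

Fixpoint all_bits (n : nat) : seq (seq bool) :=
  if n is n'.+1 then
    [seq false :: x | x <- all_bits n'] ++ [seq true :: x | x <- all_bits n']
  else [:: [::]].

Definition clog (n : nat) : nat := up_log 2 n.

(** * Boolean circuits of fan-in two *)

(* In a circuit with n inputs the wires are numbered 0, 1, ...: wire i is the
   i-th input for i < n, and wire n + j is the output of the j-th gate. *)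
Inductive gate :=
  | GFalse
  | GNot of nat
  | GAnd of nat & nat
  | GOr of nat & nat.

Record circuit := Circuit { gates : seq gate; outs : seq nat }.

Definition csize (C : circuit) : nat := size (gates C).

Definition gate_below (m : nat) (g : gate) : bool :=
  match g with
  | GFalse => true
  | GNot a => a < m
  | GAnd a b | GOr a b => (a < m) && (b < m)
  end.

Definition is_circuit (n m : nat) (C : circuit) : bool :=
  [&& all (fun jg => gate_below (n + jg.1) jg.2)
        (zip (iota 0 (csize C)) (gates C)),
      all (fun w => w < n + csize C) (outs C) &
      size (outs C) == m].

Definition gate_eval (w : seq bool) (g : gate) : bool :=
  match g with
  | GFalse => false
  | GNot a => ~~ nth false w a
  | GAnd a b => nth false w a && nth false w b
  | GOr a b => nth false w a || nth false w b
  end.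

Definition gates_eval (w : seq bool) (gs : seq gate) : seq bool :=
  foldl (fun w g => rcons w (gate_eval w g)) w gs.

Definition ceval (C : circuit) (x : seq bool) : seq bool :=
  let w := gates_eval x (gates C) in [seq nth false w o | o <- outs C].

(** * The class E and average-case hardness *)

(* Deterministic one-tape Turing machines with a two-way infinite tape over
   {blank, 0, 1}; [None] is the blank. *)
Record tm := TM {
  tm_state : finType;
  tm_init : tm_state;
  tm_verdict : tm_state -> option bool;  (* [Some b]: halted with answer b *)
  tm_delta : tm_state -> option bool -> tm_state * option bool * bool
    (* new state, symbol written, move right? *)
}.

(* state, cells left of the head (nearest first), scanned cell and cells to
   its right *)
Definition tm_config (M : tm) : Type :=
  tm_state M * seq (option bool) * seq (option bool).

Definition tm_step (M : tm) (c : tm_config M) : tm_config M :=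
  let: (s, l, r) := c in
  if tm_verdict s is Some _ then c else
  let: (s', a, mr) := tm_delta s (head None r) in
  if mr then (s', a :: l, behead r)
  else (s', behead l, head None l :: a :: behead r).

Definition tm_answers (M : tm) (x : seq bool) (t : nat) (b : bool) : Prop :=
  let c := iter t (@tm_step M) (tm_init M, [::], [seq Some a | a <- x]) in
  tm_verdict c.1.1 = Some b.

Definition in_E (f : seq bool -> bool) : Prop :=
  exists (M : tm) (c : nat), forall x : seq bool,
    tm_answers M x (2 ^ (c * (size x).+1)) (f x).

Definition hard_on_average (R : realType) (eps : R) (f : seq bool -> bool) :
    Prop :=
  exists n1 : nat, forall n : nat, n1 <= n ->
  forall C : circuit, is_circuit n 1 C ->
    ((csize C)%:R <= 2 `^ (eps * n%:R) :> R)%R ->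
    ((count (fun x => ceval C x == [:: f x]) (all_bits n))%:R
       < (1 / 2 + 1 / 2 `^ (eps * n%:R)) * 2 ^+ n :> R)%R.

(** * Nisan-Wigderson generators *)

(* S i lists the coordinates of the seed that are fed to the i-th copy of f. *)
Definition is_design (n l m a : nat) (S : nat -> seq nat) : Prop :=
  (forall i, i < n ->
     [/\ size (S i) = m, uniq (S i) & all (fun j => j < l) (S i)]) /\
  (forall i j, i < n -> j < n -> i != j ->
     count (fun x => x \in S j) (S i) <= a).

Definition NW (f : seq bool -> bool) (S : nat -> nat -> seq nat) (n : nat)
    (z : seq bool) : seq bool :=
  mkseq (fun i => f [seq nth false z j | j <- S n i]) n.

(* The parameters of the generator: seeds of length c' * ceil(log n), and f
   restricted to c'' * ceil(log n) inputs. *)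
Definition NW_designs (c' c'' : nat) (S : nat -> nat -> seq nat) : Prop :=
  exists n1 : nat, forall n : nat, n1 <= n ->
    is_design n (c' * clog n) (c'' * clog n) (clog n) (S n).

Definition NW_polytime (f : seq bool -> bool) (c' : nat)
    (S : nat -> nat -> seq nat) : Prop :=
  exists (M : tm) (c : nat), forall (n i : nat) (z : seq bool),
    i < n -> size z = c' * clog n ->
    tm_answers M (nseq n true ++ false :: nseq i true ++ false :: z)
      (c * n ^ c + c) (nth false (NW f S n z) i).

(** * Propositional formulas and Extended Frege *)

Inductive pform :=
  | FVar of nat
  | FBot
  | FNot of pform
  | FAnd of pform & pform
  | FOr of pform & pform
  | FImp of pform & pform.

Lemma form_eq_dec : comparable pform.
Proof. by move=> A B; rewrite /decidable; do 2 decide equality. Qed.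

HB.instance Definition _ := hasDecEq.Build pform (compareP form_eq_dec).

Definition FIff (A B : pform) : pform := FAnd (FImp A B) (FImp B A).

Fixpoint fsize (A : pform) : nat :=
  match A with
  | FVar _ | FBot => 1
  | FNot A => (fsize A).+1
  | FAnd A B | FOr A B | FImp A B => (fsize A + fsize B).+1
  end.

Fixpoint fvar_in (x : nat) (A : pform) : bool :=
  match A with
  | FVar y => x == y
  | FBot => false
  | FNot A => fvar_in x A
  | FAnd A B | FOr A B | FImp A B => fvar_in x A || fvar_in x B
  end.

Fixpoint fsubst (s : nat -> pform) (A : pform) : pform :=
  match A with
  | FVar x => s x
  | FBot => FBot
  | FNot A => FNot (fsubst s A)
  | FAnd A B => FAnd (fsubst s A) (fsubst s B)
  | FOr A B => FOr (fsubst s A) (fsubst s B)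
  | FImp A B => FImp (fsubst s A) (fsubst s B)
  end.

Fixpoint feval (v : nat -> bool) (A : pform) : bool :=
  match A with
  | FVar x => v x
  | FBot => false
  | FNot A => ~~ feval v A
  | FAnd A B => feval v A && feval v B
  | FOr A B => feval v A || feval v B
  | FImp A B => feval v A ==> feval v B
  end.

Definition tautology (A : pform) : Prop := forall v, feval v A.

(* Kleene's axiom schemes; modus ponens is the only other Frege rule. *)
Inductive frege_axiom : pform -> Prop :=
  | Ax_K A B : frege_axiom (FImp A (FImp B A))
  | Ax_S A B C : frege_axiom
      (FImp (FImp A (FImp B C)) (FImp (FImp A B) (FImp A C)))
  | Ax_andL A B : frege_axiom (FImp (FAnd A B) A)
  | Ax_andR A B : frege_axiom (FImp (FAnd A B) B)
  | Ax_and A B : frege_axiom (FImp A (FImp B (FAnd A B)))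
  | Ax_orL A B : frege_axiom (FImp A (FOr A B))
  | Ax_orR A B : frege_axiom (FImp B (FOr A B))
  | Ax_or A B C : frege_axiom
      (FImp (FImp A C) (FImp (FImp B C) (FImp (FOr A B) C)))
  | Ax_not A B : frege_axiom (FImp (FImp A B) (FImp (FImp A (FNot B)) (FNot A)))
  | Ax_nn A : frege_axiom (FImp (FNot (FNot A)) A)
  | Ax_bot A : frege_axiom (FImp FBot A).

Section ExtendedFrege.
Variables (Ax : pform -> Prop) (goal : pform).

Definition EF_step (prev : seq pform) (A : pform) : Prop :=
  [\/ frege_axiom A,
      (exists B, B \in prev /\ FImp B A \in prev),
      (exists (x : nat) (B : pform),
         [/\ A = FIff (FVar x) B, ~~ fvar_in x B,
             all (fun P => ~~ fvar_in x P) prev & ~~ fvar_in x goal])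
    | Ax A].

(* The lines are listed from the last one to the first one. *)
Inductive EF_lines : seq pform -> Prop :=
  | EF_nil : EF_lines [::]
  | EF_cons prev A : EF_lines prev -> EF_step prev A -> EF_lines (A :: prev).

(* pi is a proof of goal in EF with the additional axioms Ax. *)
Definition EF_proof (pi : seq pform) : Prop :=
  EF_lines pi /\ ohead pi = Some goal.

End ExtendedFrege.

Definition proof_size (pi : seq pform) : nat := sumn (map fsize pi).

(** * Building circuits *)

(* A construction is given the number of the next free wire; it returns the
   gates it appends, whose outputs are the wires from that number on, and a
   result. *)
Definition build (A : Type) : Type := nat -> seq gate * A.

Definition ret A (a : A) : build A := fun=> ([::], a).

Definition bind A B (m : build A) (k : A -> build B) : build B := fun i =>
  let r := m i in
  let r' := k r.2 (i + size r.1) in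
  (r.1 ++ r'.1, r'.2).

Notation "'let*' x ':=' m 'in' k" := (bind m (fun x => k))
  (at level 200, x name, m at level 100, k at level 200,
   format "'[v' 'let*'  x  ':='  m  'in' '/' k ']'").

Fixpoint mapb A B (h : A -> build B) (s : seq A) : build (seq B) :=
  if s is x :: s' then
    let* y := h x in
    let* ys := mapb h s' in
    ret (y :: ys)
  else ret [::].

Definition emit (g : gate) : build nat := fun i => ([:: g], i).

Definition bfalse : build nat := emit GFalse.
Definition bnot (a : nat) : build nat := emit (GNot a).
Definition band (a b : nat) : build nat := emit (GAnd a b).
Definition bor (a b : nat) : build nat := emit (GOr a b).
Definition btrue : build nat := let* z := bfalse in bnot z.
Definition bconst (b : bool) : build nat := if b then btrue else bfalse.
Definition bconsts : seq bool -> build (seq nat) := mapb bconst.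

Definition bimp (a b : nat) : build nat := let* na := bnot a in bor na b.

Definition bxor (a b : nat) : build nat :=
  let* o := bor a b in
  let* c := band a b in
  let* nc := bnot c in
  band o nc.

(* if c then a else b *)
Definition bmux (c a b : nat) : build nat :=
  let* nc := bnot c in
  let* l := band c a in
  let* r := band nc b in
  bor l r.

Fixpoint ball (s : seq nat) : build nat :=
  if s is x :: s' then let* y := ball s' in band x y else btrue.

Fixpoint bany (s : seq nat) : build nat :=
  if s is x :: s' then let* y := bany s' in bor x y else bfalse.

(* The value of a hardwired circuit with n inputs on the wires xs. *)
Definition binline (n : nat) (C : circuit) (xs : seq nat) : build (seq nat) :=
  fun i =>
  let r w := if w < n then nth 0 xs w else i + (w - n) in
  let rg g := match g with
    | GFalse => GFalse
    | GNot a => GNot (r a)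
    | GAnd a b => GAnd (r a) (r b)
    | GOr a b => GOr (r a) (r b)
    end in
  ([seq rg g | g <- gates C], [seq r o | o <- outs C]).

(** ** Binary arithmetic *)

Definition bpad (m : nat) (xs : seq nat) : build (seq nat) :=
  let* z := bfalse in ret (xs ++ nseq (m - size xs) z).

Definition bshift (m : nat) (xs : seq nat) : build (seq nat) :=
  let* z := bfalse in ret (nseq m z ++ xs).

(* Ripple-carry addition of two numbers of the same length; the last wire
   returned is the outgoing carry. *)
Fixpoint badd_carry (xs ys : seq nat) (c : nat) : build (seq nat) :=
  match xs, ys with
  | x :: xs', y :: ys' =>
      let* xy := bxor x y in
      let* s := bxor xy c in
      let* a := band x y in
      let* a' := band xy c in
      let* c' := bor a a' in
      let* ss := badd_carry xs' ys' c' in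
      ret (s :: ss)
  | _, _ => ret [:: c]
  end.

Definition badd (xs ys : seq nat) : build (seq nat) :=
  let m := maxn (size xs) (size ys) in
  let* xs' := bpad m xs in
  let* ys' := bpad m ys in
  let* c := bfalse in
  badd_carry xs' ys' c.

(* The difference xs - ys modulo a power of two (by two's complement), and the
   bit xs >= ys. *)
Definition bsub (xs ys : seq nat) : build (seq nat * nat) :=
  let m := maxn (size xs) (size ys) in
  let* xs' := bpad m xs in
  let* ys' := bpad m ys in
  let* nys := mapb bnot ys' in
  let* c := btrue in
  let* d := badd_carry xs' nys c in
  ret (take m d, nth 0 d m).

Definition bge (xs ys : seq nat) : build nat :=
  let* d := bsub xs ys in ret d.2.

Definition beq (xs ys : seq nat) : build nat :=
  let m := maxn (size xs) (size ys) in
  let* xs' := bpad m xs in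
  let* ys' := bpad m ys in
  let* es := mapb (fun xy => let* d := bxor xy.1 xy.2 in bnot d)
               (zip xs' ys') in
  ball es.

(* The number of true wires among s. *)
Fixpoint bcount (s : seq nat) : build (seq nat) :=
  if s is x :: s' then let* acc := bcount s' in badd acc [:: x] else ret [::].

(* The product of xs by the number with bits c. *)
Fixpoint bmul_const (c : seq bool) (xs : seq nat) : build (seq nat) :=
  if c is b :: c' then
    let* acc := bmul_const c' xs in
    let* acc2 := bshift 1 acc in
    if b then badd acc2 xs else ret acc2
  else ret [::].

(** ** Arithmetic on n-bit numbers modulo a constant m <= 2 ^ n *)

Section Modular.
Variables n m : nat.

(* xs modulo m, for xs < 2 m *)
Definition breduce (xs : seq nat) : build (seq nat) :=
  let* ms := bconsts (bits n.+1 m) in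
  let* d := bsub xs ms in
  let* xs' := bpad (size d.1) xs in
  let* r := mapb (fun ab => bmux d.2 ab.1 ab.2) (zip d.1 xs') in
  ret (take n r).

Fixpoint bmod (xs : seq nat) : build (seq nat) :=
  if xs is x :: xs' then let* acc := bmod xs' in breduce (x :: acc)
  else bconsts (nseq n false).

Definition baddm (xs ys : seq nat) : build (seq nat) :=
  let* s := badd xs ys in breduce s.

(* for xs < m *)
Fixpoint bmulm (xs ys : seq nat) : build (seq nat) :=
  if ys is y :: ys' then
    let* acc := bmulm xs ys' in
    let* acc2 := bshift 1 acc in
    let* dbl := breduce acc2 in
    let* t := mapb (band y) xs in
    baddm dbl t
  else bconsts (nseq n false).

Fixpoint bpowm (g : nat) (es : seq nat) : build (seq nat) :=
  if es is e :: es' then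
    let* acc := bpowm g es' in
    let* sq := bmulm acc acc in
    let* gs := bconsts (bits n g) in
    let* t := bmulm gs sq in
    mapb (fun ab => bmux e ab.1 ab.2) (zip t sq)
  else bconsts (bits n (1 %% m)).

End Modular.

(** ** Evaluation of encoded circuits *)

(* A circuit with n inputs, m outputs and s gates is encoded by
   s * (2 + 2 L) + m * L bits, L being the length of the address of a wire:
   for each gate, two bits for its kind (00: false, 01: not, 10: and, 11: or)
   and the addresses of its two arguments, followed by the addresses of the
   outputs. Every bit string of that length encodes a circuit, a reference to a
   wire that is not yet defined being read as false. *)
Definition addr_len (n s : nat) : nat := up_log 2 (n + s).

Definition code_len (n m s : nat) : nat :=
  s * (2 + 2 * addr_len n s) + m * addr_len n s.

Definition beq_const (xs : seq nat) (c : seq bool) : build nat :=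
  let* ls := mapb (fun xb => if xb.2 then ret xb.1 else bnot xb.1) (zip xs c) in
  ball ls.

(* The wire of ws with the given address. *)
Definition bselect (addr ws : seq nat) : build nat :=
  let* ts := mapb (fun jw =>
      let* e := beq_const addr (bits (size addr) jw.1) in band e jw.2)
    (zip (iota 0 (size ws)) ws) in
  bany ts.

Definition bcode_gate (L : nat) (code ws : seq nat) : build nat :=
  let t1 := nth 0 code 0 in
  let t0 := nth 0 code 1 in
  let* a := bselect (take L (drop 2 code)) ws in
  let* b := bselect (take L (drop (2 + L) code)) ws in
  let* na := bnot a in
  let* lo := band t0 na in
  let* con := band a b in
  let* dis := bor a b in
  let* hi := bmux t0 dis con in
  bmux t1 hi lo.

Fixpoint bcode_gates (L s : nat) (code ws : seq nat) : build (seq nat) :=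
  if s is s'.+1 then
    let* w := bcode_gate L (take (2 + 2 * L) code) ws in
    bcode_gates L s' (drop (2 + 2 * L) code) (rcons ws w)
  else ret ws.

(* The value on xs of the circuit encoded by the wires code. *)
Definition bcode_eval (n m s : nat) (code xs : seq nat) : build (seq nat) :=
  let L := addr_len n s in
  let oc := drop (s * (2 + 2 * L)) code in
  let* ws := bcode_gates L s code xs in
  mapb (fun j => bselect (take L (drop (j * L) oc)) ws) (iota 0 m).

(** * From circuits to tautologies *)

Definition gate_form (g : gate) : pform :=
  match g with
  | GFalse => FBot
  | GNot a => FNot (FVar a)
  | GAnd a b => FAnd (FVar a) (FVar b)
  | GOr a b => FOr (FVar a) (FVar b)
  end.

(* "The circuit with N inputs constructed by m outputs true on every input":
   the variables below N are the inputs, and each later variable is an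
   extension variable standing for a gate. *)
Definition circuit_form (N : nat) (m : build nat) : pform :=
  let r := m N in
  let defs := [seq FIff (FVar jg.1) (gate_form jg.2)
                | jg <- zip (iota N (size r.1)) r.1] in
  FImp (foldr FAnd (FNot FBot) defs) (FVar r.2).

(* The encoded circuit with n inputs and s gates, whose code is the tuple of
   free variables, errs on f for at least t inputs. *)
Definition tt_form (f : seq bool -> bool) (n s t : nat) : pform :=
  let N := code_len n 1 s in
  let code := iota 0 N in
  circuit_form N (
    let* es := mapb (fun x =>
        let* xs := bconsts x in
        let* ys := bcode_eval n 1 s code xs in
        let y := nth 0 ys 0 in
        if f x then bnot y else ret y) (all_bits n) in
    let* c := bcount es in
    let* ts := bconsts (bits n.+1 t) in
    bge c ts).

(* tt(f_n, 2^(eps n), 1/2 - 1/2^(eps n)) *)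
Definition tt_eps (R : realType) (eps : R) (f : seq bool -> bool) (n : nat) :
    pform :=
  let e := (2 `^ (eps * n%:R) : R)%R in
  tt_form f n (Num.truncn e)
    `|Order.max 0%R (Num.ceil ((1 / 2 - 1 / e) * 2 ^+ n)%R)|%N.

(** * Discrete logarithms in the multiplicative group modulo q *)

Definition is_generator (q g : nat) : Prop :=
  0 < g < q /\ forall b, 0 < b < q -> exists a, g ^ a %% q = b.

Definition solves_dlog (n q g : nat) (C : circuit) : Prop :=
  forall x : seq bool, size x = n -> 0 < bits_val x < q ->
    g ^ bits_val (ceval C x) %% q = bits_val x.

Section DiscreteLog.
Variables n q g : nat.

Definition bin_group (xs : seq nat) : build nat :=
  let* nz := bany xs in
  let* qs := bconsts (bits n.+1 q) in
  let* ge := bge xs qs in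
  let* lt := bnot ge in
  band nz lt.

(* g ^ es = bs in the group *)
Definition bis_log (es bs : seq nat) : build nat :=
  let* ps := bpowm n q g es in beq ps bs.

(* "for all b in the group, g ^ D(b) = b" *)
Definition dlog_form (D : circuit) : pform :=
  let b := iota 0 n in
  circuit_form n (
    let* d := binline n D b in
    let* h := bin_group b in
    let* e := bis_log d b in
    bimp h e).

Variable s : nat.

Definition bD1 (code xs : seq nat) : build nat :=
  let* a := bcode_eval n n s code xs in
  let* e := bis_log a xs in
  let* h := bin_group xs in
  band h e.

(* C(b g^r) - r modulo the order q - 1 of the group, for 1 <= r <= q - 1 *)
Definition bCprime (code b r : seq nat) : build (seq nat) :=
  let* gr := bpowm n q g r in
  let* y := bmulm n q b gr in
  let* a := bcode_eval n n s code y in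
  let* a' := bmod n q.-1 a in
  let* o := bconsts (bits n q.-1) in
  let* nr := bsub o r in
  baddm n q.-1 a' nr.1.

Definition bD2 (code b r : seq nat) : build nat :=
  let* c := bCprime code b r in
  let* e := bis_log c b in
  let* h := bin_group r in
  band h e.

End DiscreteLog.

(* A number P of n bits stands for the real p = P / 2^n, and c is the number of
   accepted seeds out of 2^l. The inequalities c / 2^l >= p and
   c / 2^l >= p / 2 - 3 / (2 n) are stated after clearing denominators:
     2^n c >= 2^l P   and   2 n 2^n c + 3 * 2^(l + n) >= n 2^l P. *)
Definition bprob_ge (n l : nat) (c P : seq nat) : build nat :=
  let* lhs := bshift n c in
  let* rhs := bshift l P in
  bge lhs rhs.

Definition bprob_ge_half (n l : nat) (c P : seq nat) : build nat :=
  let* nc := bmul_const (bits n.+1 n) c in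
  let* nc2 := bshift n.+1 nc in
  let* three := bconsts (nseq (l + n) false ++ [:: true; true]) in
  let* lhs := badd nc2 three in
  let* nP := bmul_const (bits n.+1 n) P in
  let* rhs := bshift l nP in
  bge lhs rhs.

(* The free variables are, in this order, the n bits of P, the n bits of b and
   the code of a circuit C with n^k gates. *)
Definition self_form (k c' : nat) (f : seq bool -> bool)
    (S : nat -> nat -> seq nat) (n q g : nat) : pform :=
  let l := c' * clog n in
  let s := n ^ k in
  let P := iota 0 n in
  let b := iota n n in
  let code := iota (n + n) (code_len n n s) in
  let images := [seq NW f S n z | z <- all_bits l] in
  circuit_form (n + n + code_len n n s) (
    let* d1 := mapb (fun x =>
        let* xs := bconsts x in bD1 n q g s code xs) images in
    let* d2 := mapb (fun x =>
        let* xs := bconsts x in bD2 n q g s code b xs) images in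
    let* c1 := bcount d1 in
    let* c2 := bcount d2 in
    let* prem := bprob_ge n l c1 P in
    let* inG := bin_group n q b in
    let* concl := bprob_ge_half n l c2 P in
    let* hyp := band prem inG in
    bimp hyp concl).

(** * The proof system P_eps *)

(* n0 is the bound from which on the additional axioms are available. *)
Definition P_eps_axiom (R : realType) (eps : R) (k c' : nat)
    (f : seq bool -> bool) (S : nat -> nat -> seq nat) (q g : nat -> nat)
    (n0 : nat) (A : pform) : Prop :=
  exists (n : nat) (sigma : nat -> pform), n0 <= n /\
    (A = fsubst sigma (self_form k c' f S n (q n) (g n)) \/
     A = fsubst sigma (tt_eps eps f n)).

Definition P_eps_proof (R : realType) (eps : R) (k c' : nat)
    (f : seq bool -> bool) (S : nat -> nat -> seq nat) (q g : nat -> nat)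
    (n0 : nat) (A : pform) (pi : seq pform) : Prop :=
  EF_proof (P_eps_axiom eps k c' f S q g n0) A pi.

(* Main.v *)
Require Import Defs.
From mathcomp Require Import all_boot all_order all_algebra.
From mathcomp Require Import reals exp.
From mathcomp Require Import zify ring.
From Stdlib Require List Classical_Prop.

(** Let C solve the discrete logarithm problem. The circuit D tries, for every
    seed z of the generator, the candidate C'(b, NW_f(z)) and selects one that
    passes the test g ^ c = b (with C(b) as a default, so that D is correct
    whether or not a candidate passes).

    The proof system derives that D is correct as follows. In the axiom self_n
    substitute the code of C for the circuit and p = 1/8. The premise is then a
    constant circuit, which the proof evaluates gate by gate. It evaluates to
    true because at least 1/8 of the strings NW_f(z) lie in the group: it
    suffices that the first bit of NW_f(z) is 1 and the last one is 0, and if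
    this were rare then the first bit, which depends on few of the inputs of
    the last one, would predict the last one too well for the hardness of f.
    If all candidates fail, then the conclusion of self_n is a constant circuit
    as well, and it evaluates to false; hence b is not in the group. If some
    candidate passes, then the test on the output of D is a copy of the test on
    that candidate with equivalent inputs, so by induction on the gates their
    outputs are equivalent.

    No extension axiom is needed, since the wires of D in the formula to be
    proved serve as the extension variables of self_n. The number of lines is
    controlled by completeness of Frege systems: an instance of a tautology of
    bounded size has a proof with a bounded number of lines. *)

Set Implicit Arguments.
Unset Strict Implicit.
Unset Printing Implicit Defensive.

Local Open Scope nat_scope.

(** * Values of circuit constructions *)

(** The proof system never reasons about discrete logarithms. That C is correct enters self_n only
    as a fact about constants: with the code of C substituted, D1 accepts exactly those NW_f(z) that
    lie in the group, and a Frege proof can compute this count. The only parts of self_n that depend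
    on b are the D2 tests and the membership test. D is built so that these parts occur in it gate
    for gate; the substitution then merely renames their gates into wires of D. This is why D keeps
    the code of C as constant wires and runs the universal evaluator on it.

    The value p = 1/8 has to meet two demands. It must lie below the probability of hitting the
    group, for which the argument gives 5/32. It must also exceed 3/n, so that with no accepted seed
    the conclusion 0 >= p/2 - 3/(2n) fails, which happens for n > 24.

    Circuits and derivations are treated alike, by triples with a budget of gates or of lines. What
    the derivations need about the shape of circuits (that a segment is a copy of another, or reads
    only given wires) is obtained uniformly by parametricity. *)

Notation Forall2 := List.Forall2.

Lemma bits_val_lt x : bits_val x < 2 ^ size x.
Proof. by elim: x => [|[] x IH] //=; rewrite expnS; lia. Qed.

Lemma size_bits k v : size (bits k v) = k.
Proof. by rewrite size_mkseq. Qed.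

Lemma bitsS k v : bits k.+1 v = odd v :: bits k v./2.
Proof.
rewrite /bits /mkseq /= expn0 divn1; congr (_ :: _).
rewrite -[1]/(1 + 0) iotaDl -map_comp; apply: eq_map => i /=.
by rewrite expnD expn1 divnMA divn2.
Qed.

Lemma bits_valK k v : v < 2 ^ k -> bits_val (bits k v) = v.
Proof.
elim: k v => [|k IH] v; first by rewrite expn0; case: v.
rewrite bitsS /= expnS => lt; rewrite IH ?odd_double_half //.
by have := odd_double_half v; lia.
Qed.

Lemma bits_bits_val x : bits (size x) (bits_val x) = x.
Proof.
elim: x => //= b x IH; rewrite bitsS oddD odd_double oddb addbF.
by rewrite half_bit_double IH.
Qed.

Lemma bits_val_cat x y : bits_val (x ++ y) = bits_val x + 2 ^ size x * bits_val y.
Proof. by elim: x => [|b x IH] /=; rewrite ?expn0 ?mul1n ?add0n // IH expnS; lia. Qed.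

Lemma bits_val_nseq0 k : bits_val (nseq k false) = 0.
Proof. by elim: k => //= k ->. Qed.

Lemma bits_val_inj x y : size x = size y -> bits_val x = bits_val y -> x = y.
Proof. by move=> es ev; rewrite -(bits_bits_val x) es ev bits_bits_val. Qed.

Lemma bits_val_take k x : k <= size x ->
  bits_val (take k x) = bits_val x %% 2 ^ k.
Proof.
move=> le; rewrite -{2}(cat_take_drop k x) bits_val_cat size_takel //.
rewrite addnC mulnC modnMDl modn_small //.
by have := bits_val_lt (take k x); rewrite size_takel.
Qed.

(** * Segments of gates and the values of their wires *)

Definition gwf (i : nat) (gs : seq gate) : Prop :=
  forall t, t < size gs -> gate_below (i + t) (nth GFalse gs t).

Lemma gwf_cat i a b : gwf i a -> gwf (i + size a) b -> gwf i (a ++ b).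
Proof.
move=> Ha Hb t; rewrite size_cat nth_cat => lt.
case: ltnP => h; first exact: Ha.
by have := Hb (t - size a); rewrite -addnA subnKC //; apply; lia.
Qed.

(** Appending gates never changes existing wires, so facts about wires are carried along this
    order. *)
Definition wext (w w' : seq bool) : Prop := exists e, w' = w ++ e.

Lemma wext_refl w : wext w w.
Proof. by exists [::]; rewrite cats0. Qed.

Lemma wext_trans w1 w2 w3 : wext w1 w2 -> wext w2 w3 -> wext w1 w3.
Proof. by move=> [e ->] [e' ->]; exists (e ++ e'); rewrite catA. Qed.

Lemma gates_eval_cat w a b :
  gates_eval w (a ++ b) = gates_eval (gates_eval w a) b.
Proof. by rewrite /gates_eval foldl_cat. Qed.

Lemma size_gates_eval w gs : size (gates_eval w gs) = size w + size gs.
Proof.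
elim: gs w => [|g gs IH] w /=; first by rewrite addn0.
by rewrite IH size_rcons addnS.
Qed.

Lemma wext_gates_eval w gs : wext w (gates_eval w gs).
Proof.
elim: gs w => [|g gs IH] w /=; first exact: wext_refl.
apply: wext_trans (IH _); exists [:: gate_eval w g]; by rewrite cats1.
Qed.

(** The range condition matters: beyond the end of w the default of [nth] is false, and such a
    reading would not survive the gate that is appended there later. *)
Definition wval (w : seq bool) (x : nat) (b : bool) : bool :=
  (x < size w) && (nth false w x == b).

Definition vals (w : seq bool) : seq nat -> seq bool -> bool := all2 (wval w).

Lemma wval_ext w w' x b : wext w w' -> wval w x b -> wval w' x b.
Proof.
move=> [e ->] /andP[lt /eqP <-]; rewrite /wval size_cat nth_cat lt eqxx.
by rewrite ltn_addr.
Qed.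

Lemma vals_ext w w' xs bs : wext w w' -> vals w xs bs -> vals w' xs bs.
Proof.
move=> we; elim: xs bs => [|x xs IH] [|b bs] //= /andP[h1 h2].
by rewrite (wval_ext we h1) (IH _ h2).
Qed.

Lemma size_vals w xs bs : vals w xs bs -> size xs = size bs.
Proof. by elim: xs bs => [|x xs IH] [|b bs] //= /andP[_ /IH ->]. Qed.

Lemma vals_cat w xs ys bs cs :
  vals w xs bs -> vals w ys cs -> vals w (xs ++ ys) (bs ++ cs).
Proof. by elim: xs bs => [|x xs IH] [|b bs] //= /andP[-> h] h'; apply: IH. Qed.

Lemma vals_nseq w k x b : wval w x b -> vals w (nseq k x) (nseq k b).
Proof. by move=> h; elim: k => //= k ->; rewrite h. Qed.

Lemma vals_take w k xs bs : vals w xs bs -> vals w (take k xs) (take k bs).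
Proof.
elim: xs bs k => [|x xs IH] [|b bs] [|k] //= /andP[h1 h2].
by rewrite h1; apply: IH.
Qed.

Lemma vals_drop w k xs bs : vals w xs bs -> vals w (drop k xs) (drop k bs).
Proof.
by elim: k xs bs => [|k IH] [|x xs] [|b bs] //= /andP[_]; apply: IH.
Qed.

Lemma vals_nth w xs bs k : vals w xs bs -> k < size bs ->
  wval w (nth 0 xs k) (nth false bs k).
Proof. by elim: xs bs k => [|x xs IH] [|b bs] [|k] //= /andP[h1 h2] //; apply: IH. Qed.

Lemma vals_iota w a bs : a + size bs <= size w ->
  (forall t, t < size bs -> nth false w (a + t) = nth false bs t) ->
  vals w (iota a (size bs)) bs.
Proof.
elim: bs a => //= b bs IH a le h; apply/andP; split.
  by rewrite /wval; have := h 0 isT; rewrite addn0 /= => ->; rewrite eqxx andbT; lia.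
by apply: IH => [|t lt]; [lia | rewrite addSnnS (h t.+1)].
Qed.

(** Hides the individual bits and keeps width and value, which are what the arithmetic
    specifications compose on. *)
Definition num (w : seq bool) (xs : seq nat) (k v : nat) : Prop :=
  exists bs, [/\ vals w xs bs, size bs = k & bits_val bs = v].

Lemma num_ext w w' xs k v : wext w w' -> num w xs k v -> num w' xs k v.
Proof. by move=> we [bs [h1 h2 h3]]; exists bs; split=> //; apply: vals_ext h1. Qed.

Lemma num_size w xs k v : num w xs k v -> size xs = k.
Proof. by move=> [bs [/size_vals -> ]]. Qed.

Lemma num_lt w xs k v : num w xs k v -> v < 2 ^ k.
Proof. by move=> [bs [_ <- <-]]; apply: bits_val_lt. Qed.

Lemma vals_num w xs bs : vals w xs bs -> num w xs (size bs) (bits_val bs).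
Proof. by exists bs. Qed.

Lemma num_cat w xs ys k v k' v' : num w xs k v -> num w ys k' v' ->
  num w (xs ++ ys) (k + k') (v + 2 ^ k * v').
Proof.
move=> [bs [h1 <- <-]] [cs [h2 <- <-]]; exists (bs ++ cs).
by rewrite size_cat bits_val_cat; split=> //; apply: vals_cat.
Qed.

Lemma num_take w xs k v k' : num w xs k v -> k' <= k ->
  num w (take k' xs) k' (v %% 2 ^ k').
Proof.
move=> [bs [h1 <- <-]] le; exists (take k' bs).
by rewrite size_takel // bits_val_take //; split=> //; apply: vals_take.
Qed.

(** One triple certifies three things at once: the new gates refer to earlier wires only, at most s
    of them are emitted, and the result satisfies Q on the extended wires. *)
Definition hoare A (w : seq bool) (m : build A) (s : nat)
    (Q : seq bool -> A -> Prop) : Prop :=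
  let r := m (size w) in
  [/\ gwf (size w) r.1, size r.1 <= s & Q (gates_eval w r.1) r.2].

Lemma hoare_ret A w (a : A) s (Q : seq bool -> A -> Prop) :
  Q w a -> hoare w (ret a) s Q.
Proof. by []. Qed.

Lemma hoare_cons A w (m : build A) s s' (Q Q' : seq bool -> A -> Prop) :
  hoare w m s Q -> s <= s' ->
  (forall w' a, wext w w' -> Q w' a -> Q' w' a) -> hoare w m s' Q'.
Proof.
move=> [h1 h2 h3] le QQ'; split=> //; first exact: leq_trans le.
by apply: QQ' h3; apply: wext_gates_eval.
Qed.

(* The size bound is a budget: the continuation gets what the first part
   leaves. *)
Lemma hoare_bind A B w (m : build A) (k : A -> build B) s1 s Q1 Q2 :
  hoare w m s1 Q1 -> s1 <= s ->
  (forall w' a, wext w w' -> Q1 w' a -> hoare w' (k a) (s - s1) Q2) ->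
  hoare w (bind m k) s Q2.
Proof.
move=> [h1 h2 h3] le hk.
have := hk _ _ (wext_gates_eval w _) h3.
rewrite /hoare size_gates_eval => -[k1 k2 k3]; split=> /=.
- exact: gwf_cat.
- by rewrite size_cat; lia.
- by rewrite gates_eval_cat.
Qed.

Lemma hoare_emit w g : gate_below (size w) g ->
  hoare w (emit g) 1 (fun w' x => wval w' x (gate_eval w g)).
Proof.
move=> h; split=> //=; first by case=> // _; rewrite addn0.
by rewrite /wval size_rcons ltnSn nth_rcons ltnn eqxx /=.
Qed.

Lemma hoare_false w : hoare w bfalse 1 (fun w' x => wval w' x false).
Proof. exact: hoare_emit. Qed.

Lemma hoare_not w a u : wval w a u ->
  hoare w (bnot a) 1 (fun w' x => wval w' x (~~ u)).
Proof. by move=> /andP[lt /eqP <-]; apply: (@hoare_emit w (GNot a)). Qed.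

Lemma hoare_and w a b u v : wval w a u -> wval w b v ->
  hoare w (band a b) 1 (fun w' x => wval w' x (u && v)).
Proof.
move=> /andP[lt /eqP <-] /andP[lt' /eqP <-].
by apply: (@hoare_emit w (GAnd a b)); rewrite /= lt.
Qed.

Lemma hoare_or w a b u v : wval w a u -> wval w b v ->
  hoare w (bor a b) 1 (fun w' x => wval w' x (u || v)).
Proof.
move=> /andP[lt /eqP <-] /andP[lt' /eqP <-].
by apply: (@hoare_emit w (GOr a b)); rewrite /= lt.
Qed.

Lemma hoare_const w b : hoare w (bconst b) 2 (fun w' x => wval w' x b).
Proof.
case: b; last exact: hoare_cons (hoare_false w) _ _.
apply: hoare_bind (hoare_false w) _ _ => // w1 z e1 h1.
exact: hoare_not h1.
Qed.

Lemma hoare_xor w a b u v : wval w a u -> wval w b v ->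
  hoare w (bxor a b) 4 (fun w' x => wval w' x (u (+) v)).
Proof.
move=> ha hb; apply: hoare_bind (hoare_or ha hb) _ _ => // w1 o e1 h1.
apply: hoare_bind (hoare_and (wval_ext e1 ha) (wval_ext e1 hb)) _ _ => //.
move=> w2 c e2 h2; apply: hoare_bind (hoare_not h2) _ _ => // w3 nc e3 h3.
apply: hoare_cons (hoare_and (wval_ext (wext_trans e2 e3) h1) h3) _ _ => //.
by move=> w4 x _; case: (u); case: (v).
Qed.

Lemma hoare_mux w c a b t u v : wval w c t -> wval w a u -> wval w b v ->
  hoare w (bmux c a b) 4 (fun w' x => wval w' x (if t then u else v)).
Proof.
move=> hc ha hb; apply: hoare_bind (hoare_not hc) _ _ => // w1 nc e1 h1.
apply: hoare_bind (hoare_and (wval_ext e1 hc) (wval_ext e1 ha)) _ _ => //.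
move=> w2 l e2 h2.
have e12 := wext_trans e1 e2.
apply: hoare_bind (hoare_and (wval_ext e2 h1) (wval_ext e12 hb)) _ _ => //.
move=> w3 r e3 h3.
apply: hoare_cons (hoare_or (wval_ext e3 h2) h3) _ _ => //.
by move=> w4 x _; case: (t); case: (u); case: (v).
Qed.

Lemma hoare_imp w a b u v : wval w a u -> wval w b v ->
  hoare w (bimp a b) 2 (fun w' x => wval w' x (u ==> v)).
Proof.
move=> ha hb; apply: hoare_bind (hoare_not ha) _ _ => // w1 na e1 h1.
apply: hoare_cons (hoare_or h1 (wval_ext e1 hb)) _ _ => //.
by move=> w2 x _; rewrite implybE.
Qed.

Lemma hoare_mapb (A : eqType) B w (h : A -> build B) (s : seq A) c
    (Q : seq bool -> A -> B -> Prop) :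
  (forall w w' a b, wext w w' -> Q w a b -> Q w' a b) ->
  (forall w' a, wext w w' -> a \in s ->
     hoare w' (h a) c (fun w'' b => Q w'' a b)) ->
  hoare w (mapb h s) (c * size s) (fun w' bs => Forall2 (Q w') s bs).
Proof.
move=> mono; elim: s w => [|a s IH] w hh /=; first by rewrite muln0; apply: hoare_ret.
apply: hoare_bind (hh w a (wext_refl w) _) _ _; rewrite ?mem_head ?mulnS ?leq_addr //.
move=> w1 y e1 q1; rewrite addKn -(addn0 (c * _)).
apply: hoare_bind (IH w1 _) _ _; rewrite ?addn0 //.
  move=> w' a' e' in_s; apply: hh; first exact: wext_trans e'.
  by rewrite inE in_s orbT.
move=> w2 ys e2 q2; apply: hoare_ret; constructor=> //; exact: mono q1.
Qed.

Lemma hoare_map1 w xs bs (h : nat -> build nat) (g : bool -> bool) c :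
  vals w xs bs ->
  (forall w' x b, wext w w' -> wval w' x b ->
     hoare w' (h x) c (fun w'' y => wval w'' y (g b))) ->
  hoare w (mapb h xs) (c * size bs)
    (fun w' ys => vals w' ys [seq g b | b <- bs]).
Proof.
elim: xs bs w => [|x xs IH] [|b bs] w //=.
move=> /andP[hx hxs] hh.
apply: hoare_bind (hh w x b (wext_refl w) hx) _ _; rewrite ?mulnS ?leq_addr //.
move=> w1 y e1 q1; rewrite addKn -(addn0 (c * _)).
apply: hoare_bind (IH bs w1 (vals_ext e1 hxs) _) _ _; rewrite ?addn0 //.
  by move=> w' a' b' e' q'; apply: hh => //; apply: wext_trans e'.
move=> w2 ys e2 q2; apply: hoare_ret; rewrite /vals /= -/(vals w2) q2 andbT.
exact: wval_ext q1.
Qed.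

Lemma hoare_mapzip w xs ys bs cs (h : nat * nat -> build nat)
    (g : bool -> bool -> bool) c :
  vals w xs bs -> vals w ys cs -> size bs = size cs ->
  (forall w' x y b d, wext w w' -> wval w' x b -> wval w' y d ->
     hoare w' (h (x, y)) c (fun w'' z => wval w'' z (g b d))) ->
  hoare w (mapb h (zip xs ys)) (c * size bs)
    (fun w' zs => vals w' zs [seq g p.1 p.2 | p <- zip bs cs]).
Proof.
elim: xs ys bs cs w => [|x xs IH] [|y ys] [|b bs] [|d cs] w //=.
move=> /andP[hx hxs] /andP[hy hys] [sz] hh.
apply: hoare_bind (hh w x y b d (wext_refl w) hx hy) _ _.
  by rewrite ?mulnS ?leq_addr.
move=> w1 z e1 q1; rewrite mulnS addKn -(addn0 (c * _)).
apply: hoare_bind (IH ys bs cs w1 (vals_ext e1 hxs) (vals_ext e1 hys) sz _) _ _.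
- by move=> w' ? ? ? ? e' q' q''; apply: hh => //; apply: wext_trans e'.
- by rewrite addn0.
move=> w2 zs e2 q2; apply: hoare_ret; rewrite /vals /= -/(vals w2) q2 andbT.
exact: wval_ext q1.
Qed.

Lemma hoare_consts w bs :
  hoare w (bconsts bs) (2 * size bs) (fun w' xs => vals w' xs bs).
Proof.
apply: hoare_cons (@hoare_mapb _ _ w bconst bs 2
  (fun w' b x => is_true (wval w' x b)) _ _) _ _ => //.
- by move=> ? ? ? ?; apply: wval_ext.
- by move=> w' a _ _; apply: hoare_const.
by move=> w' xs _; elim=> //= b x {}bs {}xs -> _ ->.
Qed.

Lemma hoare_bits w k v : v < 2 ^ k ->
  hoare w (bconsts (bits k v)) (2 * k) (fun w' xs => num w' xs k v).
Proof.
move=> lt; apply: hoare_cons (hoare_consts _ _) _ _; rewrite ?size_bits //.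
by move=> w' xs _ /vals_num; rewrite size_bits bits_valK.
Qed.

Lemma hoare_ball w xs bs : vals w xs bs ->
  hoare w (ball xs) (size bs + 2) (fun w' x => wval w' x (all id bs)).
Proof.
elim: xs bs w => [|x xs IH] [|b bs] w //= => [_|/andP[hx hxs]].
  exact: (@hoare_const w true).
apply: hoare_bind (IH _ _ hxs) _ _; first by lia.
move=> w1 y e1 h1.
by apply: hoare_cons (hoare_and (wval_ext e1 hx) h1) _ _; first by lia.
Qed.

Lemma hoare_bany w xs bs : vals w xs bs ->
  hoare w (bany xs) (size bs + 1) (fun w' x => wval w' x (has id bs)).
Proof.
elim: xs bs w => [|x xs IH] [|b bs] w //= => [_|/andP[hx hxs]].
  exact: hoare_false.
apply: hoare_bind (IH _ _ hxs) _ _; first by lia.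
move=> w1 y e1 h1.
by apply: hoare_cons (hoare_or (wval_ext e1 hx) h1) _ _; first by lia.
Qed.

(** * Binary arithmetic on wires *)

Lemma hoare_pad w m xs k v : num w xs k v -> k <= m ->
  hoare w (bpad m xs) 1 (fun w' ys => num w' ys m v).
Proof.
move=> hx le; apply: hoare_bind (hoare_false w) _ _ => // w1 z e1 h1.
apply: hoare_ret; rewrite (num_size hx).
have := num_cat (num_ext e1 hx) (vals_num (vals_nseq (m - k) h1)).
by rewrite size_nseq bits_val_nseq0 muln0 addn0 subnKC.
Qed.

Lemma hoare_shift w m xs k v : num w xs k v ->
  hoare w (bshift m xs) 1 (fun w' ys => num w' ys (m + k) (2 ^ m * v)).
Proof.
move=> hx; apply: hoare_bind (hoare_false w) _ _ => // w1 z e1 h1.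
apply: hoare_ret.
have := num_cat (vals_num (vals_nseq m h1)) (num_ext e1 hx).
by rewrite size_nseq bits_val_nseq0.
Qed.

Lemma num_nil w : num w [::] 0 0.
Proof. by exists [::]. Qed.

Lemma num_cons w x xs b k v : wval w x b -> num w xs k v ->
  num w (x :: xs) k.+1 (b + v.*2).
Proof. by move=> h [bs [h1 <- <-]]; exists (b :: bs); split=> //=; rewrite /vals /= h. Qed.

Lemma num_consI w x xs k v : num w (x :: xs) k v ->
  exists b k' v', [/\ wval w x b, num w xs k' v', k = k'.+1 & v = b + v'.*2].
Proof.
case=> -[|b bs] [] //= /andP[h1 h2] <- <-.
by exists b, (size bs), (bits_val bs); split=> //; exists bs.
Qed.

Lemma num_nilI w k v : num w [::] k v -> k = 0 /\ v = 0.
Proof. by case=> -[|b bs] [] //= _ <- <-. Qed.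

Lemma full_adderE (b d u : bool) v v' :
  b (+) d (+) u + (v + v' + (b && d || (b (+) d) && u)).*2 =
  b + v.*2 + (d + v'.*2) + u.
Proof. by case: b; case: d; case: u => /=; lia. Qed.

Lemma hoare_add_carry w xs ys c k v v' u :
  num w xs k v -> num w ys k v' -> wval w c u ->
  hoare w (badd_carry xs ys c) (11 * k)
    (fun w' zs => num w' zs k.+1 (v + v' + u)).
Proof.
elim: xs ys w c k v v' u => [|x xs IH] [|y ys] w c k v v' u hx hy hc /=.
- have [-> ->] := num_nilI hx; have [_ ->] := num_nilI hy.
  apply: hoare_ret; have := num_cons hc (num_nil w).
  by rewrite double0 addn0 !add0n.
- have [ek _] := num_nilI hx; have [? [? [? [_ _]]]] := num_consI hy.
  by rewrite ek.
- have [ek _] := num_nilI hy; have [? [? [? [_ _]]]] := num_consI hx.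
  by rewrite ek.
have [b [k1 [v1 [hb hxs ek ->]]]] := num_consI hx; rewrite {}ek in hx hy *.
have [d [k2 [v2 [hd hys [ek] ->]]]] := num_consI hy; rewrite -{}ek in hys.
apply: hoare_bind (hoare_xor hb hd) _ _ => [|w1 xy e1 h1]; first by lia.
apply: hoare_bind (hoare_xor h1 (wval_ext e1 hc)) _ _ => [|w2 s e2 h2]; first by lia.
have e12 := wext_trans e1 e2.
apply: hoare_bind (hoare_and (wval_ext e12 hb) (wval_ext e12 hd)) _ _
  => [|w3 a e3 h3]; first by lia.
have e23 := wext_trans e2 e3; have e13 := wext_trans e12 e3.
apply: hoare_bind (hoare_and (wval_ext e23 h1) (wval_ext e13 hc)) _ _
  => [|w4 a' e4 h4]; first by lia.
apply: hoare_bind (hoare_or (wval_ext e4 h3) h4) _ _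
  => [|w5 c' e5 h5]; first by lia.
have e05 : wext w w5 by apply: wext_trans e13 (wext_trans e4 e5).
apply: hoare_bind (IH _ _ _ _ _ _ _ (num_ext e05 hxs) (num_ext e05 hys) h5) _ _
  => [|w6 ss e6 h6]; first by lia.
apply: hoare_ret.
have e26 : wext w2 w6 by apply: wext_trans (wext_trans e3 e4) (wext_trans e5 e6).
have := num_cons (wval_ext e26 h2) h6.
by rewrite full_adderE.
Qed.

Lemma hoare_add w xs ys k k' v v' : num w xs k v -> num w ys k' v' ->
  hoare w (badd xs ys) (11 * maxn k k' + 3)
    (fun w' zs => num w' zs (maxn k k').+1 (v + v')).
Proof.
move=> hx hy; rewrite /badd (num_size hx) (num_size hy).
apply: hoare_bind (hoare_pad hx (leq_maxl k k')) _ _ => [|w1 xs' e1 h1]; first by lia.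
apply: hoare_bind (hoare_pad (num_ext e1 hy) (leq_maxr k k')) _ _
  => [|w2 ys' e2 h2]; first by lia.
apply: hoare_bind (hoare_false _) _ _ => [|w3 c e3 h3]; first by lia.
apply: hoare_cons (hoare_add_carry (num_ext (wext_trans e2 e3) h1)
  (num_ext e3 h2) h3) _ _ => [|w4 zs _]; first by lia.
by rewrite addn0.
Qed.

(** Two's complement: complementing the bits of a k-bit number v gives 2^k - 1 - v, stated without
    subtraction. *)
Lemma bits_val_not bs :
  (bits_val [seq ~~ b | b <- bs] + bits_val bs).+1 = 2 ^ size bs.
Proof. by elim: bs => //= b bs; rewrite expnS => <-; case: b => /=; lia. Qed.

(** The carry out of v + (2^m - 1 - v') + 1 is exactly the bit v' <= v. When it is not set, only the
    width of the difference is asserted. *)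
Lemma hoare_sub w xs ys k k' v v' : num w xs k v -> num w ys k' v' ->
  hoare w (bsub xs ys) (12 * maxn k k' + 4)
    (fun w' r => exists u, [/\ num w' r.1 (maxn k k') u, wval w' r.2 (v' <= v) &
       v' <= v -> u = v - v']).
Proof.
move=> hx hy; rewrite /bsub (num_size hx) (num_size hy).
move: (leq_maxl k k') (leq_maxr k k'); move: (maxn k k') => m lk lk'.
apply: hoare_bind (hoare_pad hx lk) _ _ => [|w1 xs' e1 h1]; first by lia.
apply: hoare_bind (hoare_pad (num_ext e1 hy) lk') _ _
  => [|w2 ys' e2 h2]; first by lia.
have lx := num_lt h1; have ly := num_lt h2.
have [bs [h2v sbs ebs]] := h2.
apply: hoare_bind (hoare_map1 (c := 1) (g := negb) h2v _) _ _.
- by move=> ? ? ? _; apply: hoare_not.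
- by lia.
move=> w3 nys e3 h3.
apply: hoare_bind (@hoare_const w3 true) _ _ => [|w4 c e4 h4]; first by lia.
have := vals_num (vals_ext e4 h3); rewrite size_map sbs => h3'.
apply: hoare_bind (hoare_add_carry
  (num_ext (wext_trans e2 (wext_trans e3 e4)) h1) h3' h4) _ _ => [|w5 d e5 h5].
  by lia.
apply: hoare_ret; have := bits_val_not bs; rewrite ebs sbs => en.
exists ((v + bits_val [seq ~~ b | b <- bs] + true) %% 2 ^ m); split=> /=.
- by apply: num_take h5 _.
- have [ds [hd sd ed]] := h5.
  have := @vals_nth _ _ _ m hd; rewrite sd ltnSn => /(_ isT).
  rewrite -(cat_take_drop m ds) bits_val_cat size_takel in ed; last by lia.
  have := bits_val_lt (take m ds); rewrite size_takel; last by lia.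
  (* The sum has m + 1 bits, so behind the low m bits there is only the carry, of weight 2^m. *)
  move: ed; rewrite (drop_nth false) ?sd // drop_oversize ?sd //= double0 addn0.
  case: (nth false ds m) => /= ed lt hw.
    by have -> : v' <= v by lia.
  by have -> : (v' <= v) = false by lia.
move=> le; have -> : v + bits_val [seq ~~ b | b <- bs] + true = 1 * 2 ^ m + (v - v').
  by rewrite mul1n; lia.
by rewrite modnMDl modn_small //; lia.
Qed.

Lemma hoare_ge w xs ys k k' v v' : num w xs k v -> num w ys k' v' ->
  hoare w (bge xs ys) (12 * maxn k k' + 4) (fun w' x => wval w' x (v' <= v)).
Proof.
move=> hx hy; apply: hoare_bind (hoare_sub hx hy) _ _ => // w1 r e1 [u [_ h _]].
exact: hoare_ret.
Qed.

Lemma hoare_eq w xs ys k v v' : num w xs k v -> num w ys k v' ->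
  hoare w (beq xs ys) (6 * k + 4) (fun w' x => wval w' x (v == v')).
Proof.
move=> hx hy; rewrite /beq (num_size hx) (num_size hy) maxnn.
apply: hoare_bind (hoare_pad hx (leqnn k)) _ _ => [|w1 xs' e1 h1]; first by lia.
apply: hoare_bind (hoare_pad (num_ext e1 hy) (leqnn k)) _ _
  => [|w2 ys' e2 h2]; first by lia.
have [bs [hb sb eb]] := num_ext e2 h1; have [cs [hc sc ec]] := h2.
apply: hoare_bind (hoare_mapzip (c := 5) (g := eqb) hb hc _ _) _ _.
- by rewrite sb sc.
- move=> w' x y b d _ hx' hy'.
  apply: hoare_bind (hoare_xor hx' hy') _ _ => // w3 z e3 h3.
  apply: hoare_cons (hoare_not h3) _ _ => // w4 t _.
  by case: (b); case: (d).
- by lia.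
move=> w3 es e3 h3.
apply: hoare_cons (hoare_ball h3) _ _.
  by rewrite size_map size_zip; lia.
move=> w4 x _; suff -> : (v == v') = all id [seq eqb p.1 p.2 | p <- zip bs cs] by [].
rewrite -eb -ec; apply: esym.
have {sb} sz : size bs = size cs by rewrite sb sc.
transitivity (bs == cs).
  elim: (bs) (cs) sz => [|b ? IH] [|c ?] //= [/IH ->]; rewrite eqseq_cons.
  by case: b; case: c.
by apply/eqP/eqP => [->//|]; apply: bits_val_inj.
Qed.

(** Each addition lengthens the accumulator by a wire, so its width is bounded linearly in the
    number of summands; this still keeps the gate count polynomial. *)
Lemma hoare_count w xs bs : vals w xs bs ->
  hoare w (bcount xs) (size bs * (11 * size bs + 25))
    (fun w' ys => exists k, num w' ys k (count id bs) /\ k <= (size bs).+1).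
Proof.
elim: xs bs w => [|x xs IH] [|b bs] w //= => [_|/andP[hx hxs]].
  by apply: hoare_ret; exists 0; split=> //; apply: num_nil.
apply: hoare_bind (IH _ _ hxs) _ _; first by lia.
move=> w1 ys e1 [k [h1 lek]].
apply: hoare_cons (hoare_add h1 (num_cons (wval_ext e1 hx) (num_nil w1))) _ _.
  by nia.
by move=> w2 zs _; rewrite double0 addn0 addnC => h; exists (maxn k 1).+1; split=> //; lia.
Qed.

Lemma hoare_mul_const w cs xs k v : num w xs k v ->
  hoare w (bmul_const cs xs) (size cs * (22 * size cs + 11 * k + 40))
    (fun w' ys => exists k', num w' ys k' (bits_val cs * v) /\
       k' <= 2 * size cs + k).
Proof.
move=> hx; elim: cs => [|c cs IH] /=.
  by apply: hoare_ret; exists 0; split=> //; apply: num_nil.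
apply: hoare_bind IH _ _; first by nia.
move=> w1 acc e1 [k1 [h1 le1]].
apply: hoare_bind (hoare_shift 1 h1) _ _ => [|w2 acc2 e2 h2]; first by nia.
case: c.
  apply: hoare_cons (hoare_add h2 (num_ext (wext_trans e1 e2) hx)) _ _; first by nia.
  move=> w3 ys _ h3; exists (maxn (1 + k1) k).+1; split; last by lia.
  by move: h3; congr num; rewrite expn1; nia.
apply: hoare_ret; exists (1 + k1); split; last by lia.
by move: h2; congr num; rewrite expn1; nia.
Qed.

(** * Arithmetic modulo a constant *)

Section Modular.
Variables n m : nat.
Hypotheses (m_gt0 : 0 < m) (m_le : m <= 2 ^ n).

Lemma hoare_zeros w :
  hoare w (bconsts (nseq n false)) (2 * n) (fun w' zs => num w' zs n 0).
Proof.
apply: hoare_cons (hoare_consts _ _) _ _; rewrite ?size_nseq //.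
by move=> w' xs _ /vals_num; rewrite size_nseq bits_val_nseq0.
Qed.

(** One conditional subtraction of m, which is a full reduction as long as v < 2 m; the width n is
    guaranteed in any case. *)
Lemma hoare_reduce w xs v : num w xs n.+1 v ->
  hoare w (breduce n m xs) (18 * n + 30)
    (fun w' zs => exists2 v', num w' zs n v' & v < 2 * m -> v' = v %% m).
Proof.
move=> hx; have lt : m < 2 ^ n.+1 by rewrite expnS; have := expn_gt0 2 n; lia.
apply: hoare_bind (hoare_bits w lt) _ _ => [|w1 ms e1 h1]; first by lia.
apply: hoare_bind (hoare_sub (num_ext e1 hx) h1) _ _ => [|w2 d e2 [u []]].
  by rewrite maxnn; lia.
rewrite maxnn => hd hb eu; rewrite (num_size hd).
have e02 := wext_trans e1 e2.
apply: hoare_bind (hoare_pad (num_ext e02 hx) (leqnn _)) _ _ => [|w3 xs' e3 h3].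
  by lia.
have [ds [hds sds eds]] := num_ext e3 hd; have [bs [hbs sbs ebs]] := h3.
apply: hoare_bind (hoare_mapzip (c := 4)
  (g := fun a b => if m <= v then a else b) hds hbs _ _) _ _.
- by rewrite sds sbs.
- move=> w' x y b d' e' hx' hy'.
  exact: hoare_mux (wval_ext (wext_trans e3 e') hb) hx' hy'.
- by lia.
move=> w4 r e4 h4; apply: hoare_ret.
have {}h4 : num w4 r n.+1 (if m <= v then u else v).
  move: h4; have -> : [seq (if m <= v then p.1 else p.2) | p <- zip ds bs] =
      if m <= v then ds else bs.
    case: ifP => _; first by rewrite [LHS]unzip1_zip // sds sbs.
    by rewrite [LHS]unzip2_zip // sds sbs.
  by move=> h4; case: ifP h4 => _ h4; [exists ds | exists bs].
exists ((if m <= v then u else v) %% 2 ^ n); first exact: num_take h4 _.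
move=> lt2; case: leqP eu => [le /(_ isT) ->|ltv _]; last first.
  by rewrite !modn_small //; lia.
rewrite modn_small; last by lia.
by rewrite -{2}(subnK le) modnDr modn_small //; lia.
Qed.

Lemma hoare_addm w xs ys v v' : num w xs n v -> num w ys n v' ->
  hoare w (baddm n m xs ys) (29 * n + 33)
    (fun w' zs => exists2 u, num w' zs n u &
       v < m -> v' < m -> u = (v + v') %% m).
Proof.
move=> hx hy; apply: hoare_bind (hoare_add hx hy) _ _; rewrite maxnn; first by lia.
move=> w1 s e1 h1; apply: hoare_cons (hoare_reduce h1) _ _; first by lia.
by move=> w2 zs _ [u hu eu]; exists u => // lt lt'; apply: eu; lia.
Qed.

(** Double-and-add from the most significant bit. The accumulator stays below m, so the doubled
    value and the sum with xs are below 2 m and one conditional subtraction reduces each of them. *)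
Lemma hoare_mulm w xs ys k v v' : num w xs n v -> num w ys k v' ->
  hoare w (bmulm n m xs ys) (k * (48 * n + 80) + 2 * n)
    (fun w' zs => exists2 u, num w' zs n u & v < m -> u = (v * v') %% m).
Proof.
move=> hx; elim: ys k v' => [|y ys IH] k v' hy /=.
  have [-> ->] := num_nilI hy.
  apply: hoare_cons (hoare_zeros w) _ _ => // w' zs _ h.
  by exists 0; rewrite // muln0 mod0n.
have [b [k' [v1 [hb hys -> ->]]]] := num_consI hy.
apply: hoare_bind (IH _ _ hys) _ _ => [|w1 acc e1 [u1 h1 eq1]]; first by lia.
apply: hoare_bind (hoare_shift 1 h1) _ _ => [|w2 acc2 e2]; first by lia.
rewrite expn1 => h2.
apply: hoare_bind (hoare_reduce h2) _ _ => [|w3 dbl e3 [u3 h3 eq3]]; first by lia.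
have e13 : wext w1 w3 := wext_trans e2 e3.
have e03 : wext w w3 := wext_trans e1 e13.
have [bs [hbs sbs ebs]] := num_ext e03 hx.
apply: hoare_bind (hoare_map1 (c := 1) (g := andb b) hbs _) _ _.
- by move=> w' x d e' hx'; apply: hoare_and hx'; apply: wval_ext (wext_trans e03 e') hb.
- by lia.
move=> w4 t e4 h4.
have {}h4 : num w4 t n (b * v).
  case: (b) h4 => h4.
    by exists bs; rewrite mul1n; split=> //; move: h4; rewrite map_id.
  have := vals_num h4; rewrite size_map sbs mul0n.
  suff -> : [seq false && b0 | b0 <- bs] = nseq (size bs) false.
    by rewrite bits_val_nseq0.
  by elim: (bs) => //= ? ? ->.
apply: hoare_cons (hoare_addm (num_ext e4 h3) h4) _ _; first by lia.
move=> w5 zs _ [u5 h5 eq5]; exists u5 => // ltv.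
have := eq1 ltv => e; have lt1 : u1 < m by rewrite e ltn_mod.
have lt1' : 2 * u1 < 2 * m by lia.
rewrite eq5 ?eq3 // ?ltn_mod //; last by case: (b); lia.
rewrite modnDml e -modnDml modnMmr modnDml; congr (_ %% _).
by case: (b) => /=; nia.
Qed.

(** Only the width is asserted: the result enters a candidate logarithm, and candidates are judged
    by the test g ^ c = b, whatever way they were computed. *)
Lemma hoare_mod w xs k v : num w xs k v ->
  hoare w (bmod n m xs) (k * (18 * n + 30) + 2 * n)
    (fun w' zs => exists u, num w' zs n u).
Proof.
elim: xs k v => [|x xs IH] k v hx /=.
  by apply: hoare_cons (hoare_zeros w) _ _; [lia | move=> w' zs _ h; exists 0].
have [b [k' [v1 [hb hxs -> _]]]] := num_consI hx.
apply: hoare_bind (IH _ _ hxs) _ _ => [|w1 acc e1 [u1 h1]]; first by lia.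
apply: hoare_cons (hoare_reduce (num_cons (wval_ext e1 hb) h1)) _ _; first by lia.
by move=> w2 zs _ [u hu _]; exists u.
Qed.

(** Square-and-multiply from the most significant bit; the product with g is always computed and the
    exponent bit chooses. The accumulator is a residue, hence below m, as the multiplication
    requires. *)
Lemma hoare_powm w g es k v : g < m -> num w es k v ->
  hoare w (bpowm n m g es) (k * (96 * n * n + 170 * n) + 2 * n)
    (fun w' zs => num w' zs n (g ^ v %% m)).
Proof.
move=> ltg; elim: es k v => [|e es IH] k v he /=.
  have [-> ->] := num_nilI he; rewrite expn0.
  by apply: hoare_bits; apply: leq_trans m_le; rewrite ltn_mod.
have [b [k' [v1 [hb hes -> ->]]]] := num_consI he.
apply: hoare_bind (IH _ _ hes) _ _ => [|w1 acc e1 h1]; first by lia.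
apply: hoare_bind (hoare_mulm h1 h1) _ _ => [|w2 sq e2 [u2 h2 eq2]]; first by nia.
have ltg' : g < 2 ^ n by apply: leq_trans m_le.
apply: hoare_bind (hoare_bits w2 ltg') _ _ => [|w3 gs e3 h3]; first by nia.
have h23 := num_ext e3 h2.
apply: hoare_bind (hoare_mulm h3 h23) _ _ => [|w4 t e4 [u4 h4 eq4]]; first by nia.
have [ts [hts sts ets]] := h4; have [ss [hss sss ess]] := num_ext e4 h23.
apply: hoare_cons (hoare_mapzip (c := 4) (g := fun x y => if b then x else y)
  hts hss _ _) _ _.
- by rewrite sts sss.
- move=> w' x y b' d' e' hx' hy'; apply: hoare_mux hx' hy'; apply: wval_ext hb.
  exact: wext_trans e1 (wext_trans e2 (wext_trans e3 (wext_trans e4 e'))).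
- by rewrite sts; nia.
move=> w5 zs _; have -> : [seq (if b then p.1 else p.2) | p <- zip ts ss] =
    if b then ts else ss.
  case: (b); first by rewrite [LHS]unzip1_zip // sts sss.
  by rewrite [LHS]unzip2_zip // sts sss.
have lt : g ^ v1 %% m < m by rewrite ltn_mod.
have {}eq2 : u2 = g ^ v1.*2 %% m by rewrite eq2 // modnMm -expnD addnn.
have {}eq4 : u4 = g ^ v1.*2.+1 %% m by rewrite eq4 // eq2 modnMmr -expnS.
case: (b) => h5; [exists ts | exists ss]; split=> //.
- by rewrite ets eq4.
- by rewrite ess eq2.
Qed.

End Modular.

(** Boolean reading of the decoding circuits, for arbitrary codes. An address that matches no wire
    makes every disjunct false and so reads as false. *)
Definition code_sel (adr us : seq bool) : bool :=
  has id [seq (adr == bits (size adr) j) && nth false us j | j <- iota 0 (size us)].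

Definition code_gate (L : nat) (cs us : seq bool) : bool :=
  let a := code_sel (take L (drop 2 cs)) us in
  let b := code_sel (take L (drop (2 + L) cs)) us in
  if nth false cs 0 then if nth false cs 1 then a || b else a && b
  else nth false cs 1 && ~~ a.

Fixpoint code_gates (L s : nat) (cs us : seq bool) : seq bool :=
  if s is s'.+1 then
    code_gates L s' (drop (2 + 2 * L) cs)
      (rcons us (code_gate L (take (2 + 2 * L) cs) us))
  else us.

Definition code_eval (n m s : nat) (cs us : seq bool) : seq bool :=
  let L := addr_len n s in
  let oc := drop (s * (2 + 2 * L)) cs in
  let ws := code_gates L s cs us in
  [seq code_sel (take L (drop (j * L) oc)) ws | j <- iota 0 m].

Lemma hoare_eq_const w xs bs cs : vals w xs bs -> size bs = size cs ->
  hoare w (beq_const xs cs) (2 * size bs + 2)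
    (fun w' x => wval w' x (bs == cs)).
Proof.
move=> hx sz.
suff hm : hoare w (mapb (fun xb => if xb.2 then ret xb.1 else bnot xb.1) (zip xs cs))
    (size bs) (fun w' ys => vals w' ys [seq p.1 == p.2 | p <- zip bs cs]).
  apply: hoare_bind hm _ _; first by lia.
  move=> w1 ls e1 h1; apply: hoare_cons (hoare_ball h1) _ _.
    by rewrite size_map size_zip -sz minnn mul2n -addnn -addnA addKn.
  move=> w2 x _; suff -> : (bs == cs) = all id [seq p.1 == p.2 | p <- zip bs cs] by [].
  elim: (bs) (cs) sz => [|b ? IH] [|c ?] //= [/IH <-]; exact: eqseq_cons.
elim: xs bs cs w hx sz => [|x xs IH] [|b bs] [|c cs] w //= /andP[hb hbs] [sz].
have h1 : hoare w (if c then ret x else bnot x) 1 (fun w' y => wval w' y (b == c)).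
  case: c; first by apply: hoare_ret; rewrite eqb_id.
  by apply: hoare_cons (hoare_not hb) _ _ => // w' y _; case: (b).
apply: hoare_bind h1 _ _ => // w1 y e1 h1.
apply: hoare_bind (IH _ _ _ (vals_ext e1 hbs) sz) _ _; first by lia.
move=> w2 ys e2 h2; apply: hoare_ret.
by rewrite /vals /= -/(vals w2) h2 (wval_ext e2 h1).
Qed.

Lemma hoare_select w adr ws bs us : vals w adr bs -> vals w ws us ->
  hoare w (bselect adr ws) ((2 * size bs + 4) * size us + 1)
    (fun w' x => wval w' x (code_sel bs us)).
Proof.
move=> ha hw; have sw := size_vals hw; have sa := size_vals ha.
pose g (j : nat) := (bs == bits (size bs) j) && nth false us j.
suff hm : hoare w (mapb (fun jw : nat * nat =>
     let* e := beq_const adr (bits (size adr) jw.1) in band e jw.2)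
    (zip (iota 0 (size ws)) ws)) ((2 * size bs + 3) * size us)
    (fun w' ts => vals w' ts [seq g j | j <- iota 0 (size us)]).
  apply: hoare_bind hm _ _; first by lia.
  move=> w1 ts e1 h1; apply: hoare_cons (hoare_bany h1) _ _ => //.
  by rewrite size_map size_iota; lia.
apply: hoare_cons (@hoare_mapb _ _ w _ (zip (iota 0 (size ws)) ws)
  (2 * size bs + 3) (fun w' jw x => is_true (wval w' x (g jw.1))) _ _) _ _.
- by move=> ? ? ? ?; apply: wval_ext.
- move=> w' [j x] e' /(nthP (0, 0)) [t].
  rewrite size_zip size_iota minnn => lt; rewrite nth_zip ?size_iota //.
  rewrite nth_iota // add0n => -[<- <-] /=.
  have lt' : t < size us by rewrite -sw.
  apply: hoare_bind (hoare_eq_const (vals_ext e' ha) _) _ _ => [|//|w1 e e1 h1].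
  + by rewrite size_bits.
  + by lia.
  rewrite sa in h1.
  apply: hoare_cons (hoare_and h1 (wval_ext (wext_trans e' e1) (vals_nth hw lt'))) _ _ => //.
  by lia.
- by rewrite size_zip size_iota sw minnn.
move=> w' ts _; rewrite -sw.
have := size_iota 0 (size ws); move: (iota 0 _) => l; move: (ws) => vs.
elim: l vs ts => [|j l IH] [|x vs] ts //= sz H; inversion H as [|? ? ? ? h1 h2] => //=.
by rewrite /vals /= h1 //=; apply: IH h2; case: sz.
Qed.

Lemma hoare_code_gate w L code ws cs us :
  vals w code cs -> vals w ws us -> 2 <= size cs ->
  hoare w (bcode_gate L code ws) ((4 * L + 8) * size us + 14)
    (fun w' x => wval w' x (code_gate L cs us)).
Proof.
move=> hc hw le.
have ht1 := vals_nth hc (leq_trans (isT : 0 < 2) le).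
have ht0 := vals_nth hc (le : 1 < size cs).
have -> : (4 * L + 8) * size us + 14 = 2 * ((2 * L + 4) * size us + 1) + 12 by lia.
have bd k : (2 * size (take L (drop k cs)) + 4) * size us + 1 <=
    (2 * L + 4) * size us + 1.
  by rewrite leq_add2r leq_mul2r size_take_min; apply/orP; right; lia.
move: (_ + 1) bd => T bd; rewrite /bcode_gate /code_gate.
apply: hoare_bind (hoare_cons (hoare_select (vals_take L (vals_drop 2 hc)) hw)
  (bd 2) (fun _ _ _ => id)) _ _ => [|w1 a e1 h1]; first by lia.
apply: hoare_bind (hoare_cons (hoare_select (vals_ext e1 (vals_take L
  (vals_drop (2 + L) hc))) (vals_ext e1 hw)) (bd (2 + L)) (fun _ _ _ => id)) _ _
  => [|w2 b e2 h2]; first by lia.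
have -> : 2 * T + 12 - T - T = 12 by lia.
have {}h1 := wval_ext e2 h1.
have e02 := wext_trans e1 e2.
apply: hoare_bind (hoare_not h1) _ _ => // w3 na e3 h3.
have e03 := wext_trans e02 e3.
apply: hoare_bind (hoare_and (wval_ext e03 ht0) h3) _ _ => // w4 lo e4 h4.
have e24 := wext_trans e3 e4.
apply: hoare_bind (hoare_and (wval_ext e24 h1) (wval_ext e24 h2)) _ _ => //.
move=> w5 con e5 h5.
have e25 := wext_trans e24 e5.
apply: hoare_bind (hoare_or (wval_ext e25 h1) (wval_ext e25 h2)) _ _ => //.
move=> w6 dis e6 h6.
have e06 := wext_trans e02 (wext_trans e25 e6).
apply: hoare_bind (hoare_mux (wval_ext e06 ht0) h6 (wval_ext e6 h5)) _ _ => //.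
move=> w7 hi e7 h7.
have e47 := wext_trans e5 (wext_trans e6 e7).
exact: hoare_cons (hoare_mux (wval_ext (wext_trans e06 e7) ht1) h7
  (wval_ext e47 h4)) _ _.
Qed.

Lemma hoare_code_gates w L s code ws cs us :
  vals w code cs -> vals w ws us -> s * (2 + 2 * L) <= size cs ->
  hoare w (bcode_gates L s code ws) (s * ((4 * L + 8) * (size us + s) + 14))
    (fun w' xs => vals w' xs (code_gates L s cs us)).
Proof.
elim: s w code ws cs us => [|s IH] w code ws cs us hc hw le /=.
  exact: hoare_ret.
have le2 : 2 + 2 * L <= size cs by lia.
apply: hoare_bind (hoare_code_gate L (vals_take (2 + 2 * L) hc) hw _) _ _.
- by rewrite size_takel //; lia.
- by nia.
move=> w1 x e1 h1.
have hr : vals w1 (rcons ws x) (rcons us (code_gate L (take (2 + 2 * L) cs) us)).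
  by rewrite -!cats1; apply: vals_cat; rewrite ?(vals_ext e1 hw) // /vals /= h1.
apply: hoare_cons (IH _ _ _ _ _ (vals_drop _ (vals_ext e1 hc)) hr _) _ _ => //.
- by rewrite size_drop; lia.
- by rewrite size_rcons addSnnS mulSn; lia.
Qed.

Lemma size_code_gates L s cs us : size (code_gates L s cs us) = size us + s.
Proof. by elim: s cs us => [|s IH] cs us /=; rewrite ?addn0 // IH size_rcons addSnnS. Qed.

Lemma hoare_code_eval w n m s code xs cs us :
  vals w code cs -> vals w xs us -> size cs = code_len n m s -> size us = n ->
  hoare w (bcode_eval n m s code xs)
    ((s + m) * ((4 * addr_len n s + 8) * (n + s) + 14))
    (fun w' ys => vals w' ys (code_eval n m s cs us)).
Proof.
move=> hc hx sc sx; rewrite /bcode_eval /code_eval; set L := addr_len n s.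
rewrite /code_len -/L in sc.
apply: hoare_bind (hoare_code_gates hc hx _) _ _; first by lia.
  by rewrite sx; nia.
move=> w1 ws e1 h1; rewrite sx.
set g := fun j => code_sel _ _.
rewrite (_ : _ - _ = ((4 * L + 8) * (n + s) + 14) * size (iota 0 m)); last first.
  by rewrite size_iota -mulnBl mulnC; congr (_ * _); lia.
apply: hoare_cons (@hoare_mapb _ _ w1 _ (iota 0 m) ((4 * L + 8) * (n + s) + 14)
  (fun w' j x => is_true (wval w' x (g j))) _ _) _ _ => //.
- by move=> ? ? ? ?; apply: wval_ext.
- move=> w' j e' _.
  have sL : size (take L (drop (j * L) (drop (s * (2 + 2 * L)) cs))) <= L.
    by rewrite size_take_min geq_minl.
  apply: hoare_cons (hoare_select (vals_take L (vals_drop (j * L)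
    (vals_drop (s * (2 + 2 * L)) (vals_ext (wext_trans e1 e') hc))))
    (vals_ext e' h1)) _ _ => //.
  by rewrite size_code_gates sx; nia.
by move=> w' ys _; elim=> //= ? ? ? ? h _ h'; rewrite /vals /= h.
Qed.

(** * Codes of circuits *)

Lemma is_circuitP n m C : is_circuit n m C <->
  [/\ gwf n (gates C), all (fun w => w < n + csize C) (outs C) & size (outs C) = m].
Proof.
rewrite /is_circuit /csize; set gs := gates C.
have sz : size (zip (iota 0 (size gs)) gs) = size gs.
  by rewrite size_zip size_iota minnn.
have nz t : t < size gs ->
    nth (0, GFalse) (zip (iota 0 (size gs)) gs) t = (t, nth GFalse gs t).
  by move=> lt; rewrite nth_zip ?size_iota // nth_iota.
split=> [/and3P[/(all_nthP (0, GFalse)) h -> /eqP ->]|[h -> ->]].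
  by split=> // t lt; have := h t; rewrite sz nz // => /(_ lt).
rewrite eqxx andbT; apply/andP; split=> //; apply/(all_nthP (0, GFalse)) => t.
by rewrite sz => lt; rewrite nz //; apply: h.
Qed.

Lemma nth_gates_eval w gs x : x < size w ->
  nth false (gates_eval w gs) x = nth false w x.
Proof. by have [e ->] := wext_gates_eval w gs; rewrite nth_cat => ->. Qed.

Definition gate_code (L : nat) (g : gate) : seq bool :=
  match g with
  | GFalse => [:: false; false] ++ bits L 0 ++ bits L 0
  | GNot a => [:: false; true] ++ bits L a ++ bits L 0
  | GAnd a b => [:: true; false] ++ bits L a ++ bits L b
  | GOr a b => [:: true; true] ++ bits L a ++ bits L b
  end.

Lemma size_gate_code L g : size (gate_code L g) = 2 + 2 * L.
Proof. by case: g => *; rewrite /= size_cat !size_bits; lia. Qed.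

Lemma code_sel_bits L a us : a < size us -> size us <= 2 ^ L ->
  code_sel (bits L a) us = nth false us a.
Proof.
move=> lt le; rewrite /code_sel size_bits has_map /=.
have eqb j : j < size us -> (bits L a == bits L j) = (a == j).
  move=> lj; apply/eqP/eqP => [e|-> //].
  by rewrite -(@bits_valK L a) ?e ?bits_valK //; lia.
apply/hasP/idP => [[j]|h].
  by rewrite mem_iota add0n => /andP[_ /eqb /= ->] /andP[/eqP <-].
by exists a; rewrite ?mem_iota ?add0n //= eqxx.
Qed.

Lemma code_gateE L g us : gate_below (size us) g -> size us <= 2 ^ L ->
  code_gate L (gate_code L g) us = gate_eval us g.
Proof.
move=> h le; have tk (l l' : seq bool) a : take L (bits L a ++ l) = bits L a.
  by rewrite take_size_cat ?size_bits.
have dr a (l : seq bool) : drop L (bits L a ++ l) = l.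
  by rewrite drop_size_cat ?size_bits.
have tk' a : take L (bits L a) = bits L a by rewrite take_oversize ?size_bits.
case: g h => [|a|a b|a b] //= => [h|/andP[h h']|/andP[h h']];
  rewrite /code_gate /= !drop0 ?dr ?(tk _ [::]) ?tk' !code_sel_bits //.
Qed.

Lemma code_gatesE L s gs us rest : size gs = s -> gwf (size us) gs ->
  size us + s <= 2 ^ L ->
  code_gates L s (flatten [seq gate_code L g | g <- gs] ++ rest) us =
  gates_eval us gs.
Proof.
elim: gs s us => [|g gs IH] s us /= <- // wf le /=.
have tk : take (2 + 2 * L) ((gate_code L g ++ flatten [seq gate_code L g0 | g0 <- gs]) ++ rest) =
    gate_code L g by rewrite -catA take_size_cat ?size_gate_code.
have dr : drop (2 + 2 * L) ((gate_code L g ++ flatten [seq gate_code L g0 | g0 <- gs]) ++ rest) =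
    flatten [seq gate_code L g0 | g0 <- gs] ++ rest.
  by rewrite -catA drop_size_cat ?size_gate_code.
rewrite [2 + 2 * L]lock /= -lock tk dr code_gateE; last 2 first.
- by have := wf 0 isT; rewrite addn0.
- by lia.
rewrite IH // ?size_rcons; last by lia.
by move=> t lt; have := wf t.+1; rewrite addSnnS; apply.
Qed.

(** A code describes exactly s gates. The padding follows the gates of C, so no wire of C changes
    its number and the output addresses remain right. *)
Definition padded (s : nat) (C : circuit) : seq gate :=
  gates C ++ nseq (s - csize C) GFalse.

Definition circuit_code (n s : nat) (C : circuit) : seq bool :=
  let L := addr_len n s in
  flatten [seq gate_code L g | g <- padded s C] ++
  flatten [seq bits L o | o <- outs C].

Section Encoding.
Variables (n m s : nat) (C : circuit).
Hypotheses (hC : is_circuit n m C) (sC : csize C <= s).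
Let L := addr_len n s.

Let size_padded : size (padded s C) = s.
Proof. by rewrite size_cat size_nseq subnKC. Qed.

Let size_gcodes : size (flatten [seq gate_code L g | g <- padded s C]) = s * (2 + 2 * L).
Proof.
rewrite -{2}size_padded; elim: (padded s C) => //= g gs IH.
by rewrite size_cat IH size_gate_code mulSn.
Qed.

Let size_ocodes (os : seq nat) : size (flatten [seq bits L o | o <- os]) = size os * L.
Proof. by elim: os => //= o os IH; rewrite size_cat IH size_bits mulSn. Qed.

Lemma size_circuit_code : size (circuit_code n s C) = code_len n m s.
Proof.
have [_ _ so] := (is_circuitP n m C).1 hC.
by rewrite size_cat size_gcodes size_ocodes so.
Qed.

(** Since n + s <= 2 ^ L, distinct wires have distinct addresses, so every address selects the
    intended wire; the padding gates leave the wires of C untouched. *)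
Lemma circuit_codeE us : size us = n ->
  code_eval n m s (circuit_code n s C) us = ceval C us.
Proof.
move=> su; have [wf ao so] := (is_circuitP n m C).1 hC.
have leL : n + s <= 2 ^ L by apply: up_logP.
have wf' : gwf n (padded s C).
  apply: gwf_cat => // t; rewrite size_nseq => lt.
  by rewrite nth_nseq lt.
rewrite /code_eval -/L /ceval code_gatesE ?su //.
rewrite drop_size_cat // gates_eval_cat.
set w' := gates_eval (gates_eval _ _) _.
have sw : size w' = n + s.
  by rewrite !size_gates_eval su size_nseq /csize -addnA subnKC.
apply: (@eq_from_nth _ false); first by rewrite !size_map size_iota so.
move=> j; rewrite size_map size_iota => lt.
rewrite (nth_map 0) ?size_iota // nth_iota // add0n.
rewrite (nth_map 0); last by rewrite so.
have -> : take L (drop (j * L) (flatten [seq bits L o | o <- outs C])) =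
    bits L (nth 0 (outs C) j).
  move: lt; rewrite -so; elim: (outs C) j => // o os IH [_|j lt] /=.
    by rewrite mul0n drop0 take_size_cat ?size_bits.
  rewrite drop_cat size_bits ltnNge mulSn leq_addr /= addKn; exact: IH.
have lto : nth 0 (outs C) j < n + csize C.
  by move/(all_nthP 0): ao; apply; rewrite so.
rewrite code_sel_bits ?sw //; last by lia.
by rewrite /w' nth_gates_eval // size_gates_eval su.
Qed.

End Encoding.

Lemma hoare_inline w n m C xs bs : is_circuit n m C -> vals w xs bs ->
  size bs = n ->
  hoare w (binline n C xs) (csize C) (fun w' ys => vals w' ys (ceval C bs)).
Proof.
move=> /is_circuitP[wf ao so] hx sb; set i := size w.
pose r x := if x < n then nth 0 xs x else i + (x - n).
pose rg g := match g with GFalse => GFalse | GNot a => GNot (r a)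
  | GAnd a b => GAnd (r a) (r b) | GOr a b => GOr (r a) (r b) end.
(* Simulation invariant: v holds the values in the numbering of C, w1 those of the host circuit, and
   r sends each wire of C to a host wire with the same value. *)
suff main gs v w1 : gwf (size v) gs -> n <= size v ->
    size w1 = i + (size v - n) ->
    (forall x, x < size v -> wval w1 (r x) (nth false v x)) ->
    gwf (size w1) (map rg gs) /\
    (forall x, x < size v + size gs ->
      wval (gates_eval w1 (map rg gs)) (r x) (nth false (gates_eval v gs) x)).
  have [||||g1 g2] := main (gates C) bs w; rewrite ?sb //.
  - by rewrite subnn addn0.
  - by move=> x lt; rewrite /r lt; apply: vals_nth hx _; rewrite sb.
  split=> //=; first by rewrite size_map.
  rewrite -/i /ceval -/(map rg _); elim: (outs C) ao => //= o os IH /andP[lt h].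
  by rewrite /vals /= -/r g2 ?sb //; apply: IH.
elim: gs v w1 => [|g gs IH] v w1 gw le sw hv /=.
  by split=> // x; rewrite addn0; apply: hv.
have gb : gate_below (size v) g by have := gw 0 isT; rewrite addn0.
have gb' : gate_below (size w1) (rg g).
  case: g gb {gw} => //= [a|a b|a b] => [/hv|/andP[/hv h1 /hv h2]|/andP[/hv h1 /hv h2]];
  by [case/andP | case/andP: h1 => ->; case/andP: h2].
have ge : gate_eval w1 (rg g) = gate_eval v g.
  case: g gb {gw gb'} => //= [a|a b|a b] => [/hv|/andP[/hv h1 /hv h2]|/andP[/hv h1 /hv h2]].
  - by case/andP=> _ /eqP ->.
  - by case/andP: h1 => _ /eqP ->; case/andP: h2 => _ /eqP ->.
  - by case/andP: h1 => _ /eqP ->; case/andP: h2 => _ /eqP ->.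
have [||||g1 g2] := IH (rcons v (gate_eval v g)) (rcons w1 (gate_eval w1 (rg g))).
- by rewrite size_rcons => t lt; have := gw t.+1; rewrite addSnnS; apply.
- by rewrite size_rcons; lia.
- by rewrite !size_rcons sw; lia.
- move=> x; rewrite size_rcons ltnS leq_eqVlt => /orP[/eqP ->|lt].
    rewrite /r ltnNge le /= -sw /wval size_rcons ltnSn !nth_rcons !ltnn !eqxx /=.
    by rewrite ge.
  rewrite nth_rcons lt; apply: wval_ext (hv x lt).
  by exists [:: gate_eval w1 (rg g)]; rewrite cats1.
split; last by move=> x lt; apply: g2; rewrite size_rcons; lia.
move=> [_|t lt]; first by rewrite addn0.
by have := g1 t lt; rewrite size_rcons addSnnS.
Qed.

Lemma hoare_prob_ge w n l c P k k' v v' : num w c k v -> num w P k' v' ->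
  hoare w (bprob_ge n l c P) (12 * (n + k + l + k') + 6)
    (fun w' x => wval w' x (2 ^ l * v' <= 2 ^ n * v)).
Proof.
move=> hc hP; apply: hoare_bind (hoare_shift n hc) _ _ => [|w1 a e1 h1]; first by lia.
apply: hoare_bind (hoare_shift l (num_ext e1 hP)) _ _ => [|w2 b e2 h2]; first by lia.
by apply: hoare_cons (hoare_ge (num_ext e2 h1) h2) _ _ => //; lia.
Qed.

Lemma hoare_prob_ge_half w n l c P k v v' : num w c k v -> num w P n v' ->
  hoare w (bprob_ge_half n l c P) (200 * (n + k + l + 2) * (n + k + l + 2))
    (fun w' x => wval w' x
       (2 ^ l * (n * v') <= 2 ^ n.+1 * (n * v) + 2 ^ (l + n) * 3)).
Proof.
move=> hc hP.
have ltn : n < 2 ^ n.+1.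
  by apply: ltn_trans (ltn_expl n (isT : 1 < 2)) _; rewrite ltn_exp2l.
rewrite -mulnA; move eX : (n + k + l + 2) => X; move eY : (X * X) => Y.
have leY : 2 * X <= Y by rewrite -eY leq_mul2r; apply/orP; right; lia.
have b1 : n.+1 * (22 * n.+1 + 11 * k + 40) <= 42 * Y.
  by rewrite -eY mulnCA; apply: leq_mul; lia.
have b2 : n.+1 * (22 * n.+1 + 11 * n + 40) <= 53 * Y.
  by rewrite -eY mulnCA; apply: leq_mul; lia.
have := hoare_mul_const (bits n.+1 n) hc; rewrite size_bits bits_valK // => hm.
apply: hoare_bind (hoare_cons hm b1 (fun _ _ _ => id)) _ _; first by lia.
move=> w1 nc e1 [k1 [h1 le1]]; move: b1 => _.
apply: hoare_bind (hoare_shift n.+1 h1) _ _ => [|w2 nc2 e2 h2]; first by lia.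
apply: hoare_bind (hoare_consts _ _) _ _ => [|w3 three e3 /vals_num].
  by rewrite size_cat size_nseq /=; lia.
rewrite size_cat size_nseq bits_val_cat bits_val_nseq0 size_nseq /= add0n => h3.
apply: hoare_bind (hoare_add (num_ext e3 h2) h3) _ _ => [|w4 lhs e4 h4]; first by lia.
have e04 : wext w w4 by do ![apply: wext_trans; first by eassumption]; apply: wext_refl.
have := hoare_mul_const (bits n.+1 n) (num_ext e04 hP).
rewrite size_bits bits_valK // => hm'.
apply: hoare_bind (hoare_cons hm' b2 (fun _ _ _ => id)) _ _; first by lia.
move=> w5 nP e5 [k5 [h5 le5]]; move: b2 => _.
apply: hoare_bind (hoare_shift l h5) _ _ => [|w6 rhs e6 h6]; first by lia.
apply: hoare_cons (hoare_ge (num_ext (wext_trans e5 e6) h4) h6) _ _ => //.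
by lia.
Qed.

(** * Discrete logarithms and the corrected circuit *)

Lemma has_bits_val bs : has id bs = (0 < bits_val bs).
Proof. by elim: bs => [|[] bs IH] //=; rewrite IH double_gt0. Qed.

Definition cost_group (n : nat) : nat := 15 * n + 22.
Definition cost_log (n : nat) : nat := n * (96 * n * n + 170 * n) + 8 * n + 4.
Definition cost_eval (n s : nat) : nat :=
  (s + n) * ((4 * addr_len n s + 8) * (n + s) + 14).
Definition cost_D1 (n s : nat) : nat :=
  cost_eval n s + cost_log n + cost_group n + 1.
Definition cost_D2 (n s : nat) : nat :=
  cost_eval n s + 2 * cost_log n + cost_group n + n * (66 * n + 110) + 47 * n + 38.

(** Emits the gates of [bD2] but also returns the candidate. Thus each test inside D is gate for
    gate a D2 test of self_n, and a substitution can identify the two. *)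
Definition bD2_witness (n q g s : nat) (code b r : seq nat) :
    build (seq nat * nat) :=
  let* c := bCprime n q g s code b r in
  let* e := bis_log n q g c b in
  let* h := bin_group n q r in
  let* d := band h e in
  ret (c, d).

Lemma bind_with_witness A (m : build A) (F : A -> build nat) (G : build nat) i :
  let mw := let* c := m in let* e := F c in let* h := G in
    let* d := band h e in ret (c, d) in
  (let* c := m in let* e := F c in let* h := G in band h e) i =
  ((mw i).1, (mw i).2.2).
Proof. by []. Qed.

Lemma bD2_witnessE n q g s code b r i :
  bD2 n q g s code b r i =
  ((bD2_witness n q g s code b r i).1, (bD2_witness n q g s code b r i).2.2).
Proof. exact: bind_with_witness. Qed.

(* The result is the selected value, whether some candidate passed, and whether
   the selected value is a logarithm of b. The last test is repeated for each
   suffix of the list of candidates only to make the derivation inductive. *)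
Fixpoint bchoose (n q g : nat) (base b : seq nat) (cands : seq (seq nat * nat)) :
    build (seq nat * nat * nat) :=
  if cands is (c, d) :: cands' then
    let* r := bchoose n q g base b cands' in
    let* sel := mapb (fun ab => bmux d ab.1 ab.2) (zip c r.1.1) in
    let* any := bor d r.1.2 in
    let* e := bis_log n q g sel b in
    ret (sel, any, e)
  else
    let* any := bfalse in
    let* e := bis_log n q g base b in
    ret (base, any, e).

Definition bcands (n q g s : nat) (images : seq (seq bool)) (code b : seq nat) :
    build (seq (seq nat * nat)) :=
  mapb (fun x => let* xs := bconsts x in bD2_witness n q g s code b xs) images.

(** The tests evaluate C through its code on constant wires, because they must have the shape they
    have in self_n; only the default C(b) comes from an inlined copy of C. *)
Definition bcorrected (n q g s : nat) (cs : seq bool) (images : seq (seq bool))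
    (C : circuit) (b : seq nat) : build (seq nat * nat * nat) :=
  let* code := bconsts cs in
  let* cands := bcands n q g s images code b in
  let* base := binline n C b in
  bchoose n q g base b cands.

Section DiscreteLog.
Variables n q g : nat.
Hypotheses (q_gt1 : 1 < q) (q_le : q <= 2 ^ n) (g_lt : g < q).

Let q_gt0 : 0 < q. Proof. by lia. Qed.

Lemma hoare_in_group w xs v : num w xs n v ->
  hoare w (bin_group n q xs) (cost_group n) (fun w' x => wval w' x (0 < v < q)).
Proof.
clear q_gt0 q_gt1 g_lt; move=> hx; rewrite /cost_group.
have ltq : q < 2 ^ n.+1 by rewrite expnS; have := expn_gt0 2 n; lia.
have [bs [hb sb eb]] := hx.
apply: hoare_bind (hoare_bany hb) _ _ => [|w1 nz e1 h1]; first by lia.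
apply: hoare_bind (hoare_bits w1 ltq) _ _ => [|w2 qs e2 h2]; first by lia.
apply: hoare_bind (hoare_ge (num_ext (wext_trans e1 e2) hx) h2) _ _
  => [|w3 ge e3 h3]; first by lia.
apply: hoare_bind (hoare_not h3) _ _ => [|w4 lt e4 h4]; first by lia.
apply: hoare_cons (hoare_and (wval_ext (wext_trans e2 (wext_trans e3 e4)) h1) h4) _ _.
  by lia.
by move=> w5 x _; rewrite has_bits_val eb -ltnNge.
Qed.

Lemma hoare_is_log w es bs v v' : num w es n v -> num w bs n v' ->
  hoare w (bis_log n q g es bs) (cost_log n)
    (fun w' x => wval w' x (g ^ v %% q == v')).
Proof.
move=> he hb; rewrite /cost_log.
apply: hoare_bind (hoare_powm q_gt0 q_le g_lt he) _ _ => [|w1 ps e1 h1]; first by lia.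
by apply: hoare_cons (hoare_eq h1 (num_ext e1 hb)) _ _ => //; lia.
Qed.

Variable s : nat.

Lemma hoare_D1 w code xs cs us : vals w code cs -> size cs = code_len n n s ->
  vals w xs us -> size us = n ->
  hoare w (bD1 n q g s code xs) (cost_D1 n s)
    (fun w' x => wval w' x ((0 < bits_val us < q) &&
       (g ^ bits_val (code_eval n n s cs us) %% q == bits_val us))).
Proof.
move=> hc sc hx sx; rewrite /cost_D1; have hxn := vals_num hx; rewrite sx in hxn.
apply: hoare_bind (hoare_code_eval hc hx sc sx) _ _ => [|w1 a e1 h1].
  by rewrite /cost_eval; lia.
rewrite -/(cost_eval n s).
have := vals_num h1; rewrite size_map size_iota => h1n.
apply: hoare_bind (hoare_is_log h1n (num_ext e1 hxn)) _ _ => [|w2 e e2 h2]; first by lia.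
apply: hoare_bind (hoare_in_group (num_ext (wext_trans e1 e2) hxn)) _ _
  => [|w3 h e3 h3]; first by lia.
by apply: hoare_cons (hoare_and h3 (wval_ext e3 h2)) _ _ => //; lia.
Qed.

(** Only an implication, since the acceptance bit also demands that the sample r lie in the
    group. *)
Definition is_candidate (v : nat) (w : seq bool) (cd : seq nat * nat) : Prop :=
  exists vc d, [/\ num w cd.1 n vc, wval w cd.2 d & d -> g ^ vc %% q = v].

Lemma is_candidate_ext v w w' cd : wext w w' ->
  is_candidate v w cd -> is_candidate v w' cd.
Proof.
move=> e [vc [d [h1 h2 h3]]]; exists vc, d; split=> //; first exact: num_ext h1.
exact: wval_ext h2.
Qed.

Lemma hoare_D2 w code cs b v r us : vals w code cs -> size cs = code_len n n s ->
  num w b n v -> vals w r us -> size us = n ->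
  hoare w (bD2_witness n q g s code b r) (cost_D2 n s) (is_candidate v).
Proof.
move=> hc sc hb hr sr; rewrite /cost_D2; have hrn := vals_num hr; rewrite sr in hrn.
have h' : hoare w (bCprime n q g s code b r)
    (cost_eval n s + cost_log n + n * (66 * n + 110) + 47 * n + 37)
    (fun w' c => exists vc, num w' c n vc).
  apply: hoare_bind (hoare_powm q_gt0 q_le g_lt hrn) _ _ => [|w1 gr e1 h1].
    by rewrite /cost_log; lia.
  apply: hoare_bind (hoare_mulm q_gt0 q_le (num_ext e1 hb) h1) _ _.
    by rewrite /cost_log; lia.
  move=> w2 y e2 [u2 h2 _]; have [ys [hys sys _]] := h2.
  have e02 := wext_trans e1 e2.
  apply: hoare_bind (hoare_code_eval (vals_ext e02 hc) hys sc sys) _ _.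
    by rewrite /cost_log -/(cost_eval n s); lia.
  rewrite -/(cost_eval n s) => w3 a e3 h3.
  have := vals_num h3; rewrite size_map size_iota => h3n.
  have q1_gt0 : 0 < q.-1 by lia.
  have q1_le : q.-1 <= 2 ^ n by lia.
  have q1_lt : q.-1 < 2 ^ n by lia.
  apply: hoare_bind (hoare_mod q1_gt0 q1_le h3n) _ _.
    by rewrite /cost_log; lia.
  move=> w4 a' e4 [u4 h4].
  apply: hoare_bind (hoare_bits w4 q1_lt) _ _ => [|w5 o e5 h5].
    by rewrite /cost_log; lia.
  have e05 := wext_trans e02 (wext_trans e3 (wext_trans e4 e5)).
  apply: hoare_bind (hoare_sub h5 (num_ext e05 hrn)) _ _.
    by rewrite /cost_log maxnn; lia.
  rewrite maxnn => w6 nr e6 [u6 [h6 _ _]].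
  apply: hoare_cons (hoare_addm q1_gt0 q1_le (num_ext (wext_trans e5 e6) h4) h6) _ _.
    by rewrite /cost_log; lia.
  by move=> w7 c _ [u7 h7 _]; exists u7.
apply: hoare_bind h' _ _ => [|w1 c e1 [vc h1]]; first by lia.
apply: hoare_bind (hoare_is_log h1 (num_ext e1 hb)) _ _ => [|w2 e e2 h2]; first by lia.
apply: hoare_bind (hoare_in_group (num_ext (wext_trans e1 e2) hrn)) _ _
  => [|w3 h e3 h3]; first by lia.
apply: hoare_bind (hoare_and h3 (wval_ext e3 h2)) _ _ => [|w4 d e4 h4]; first by lia.
apply: hoare_ret; exists vc, ((0 < bits_val us < q) && (g ^ vc %% q == v)); split=> //.
  exact: num_ext (wext_trans e2 (wext_trans e3 e4)) h1.
by case/andP=> _ /eqP.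
Qed.

(** A candidate replaces the current value only after passing the test, so the property of being a
    logarithm of b is never lost on the way. *)
Lemma hoare_choose w base b cands v0 v : num w base n v0 -> num w b n v ->
  List.Forall (is_candidate v w) cands ->
  hoare w (bchoose n q g base b cands) ((size cands).+1 * (4 * n + (1 + cost_log n)))
    (fun w' r => exists u a e, [/\ num w' r.1.1 n u, wval w' r.1.2 a,
       wval w' r.2 e & g ^ v0 %% q = v -> g ^ u %% q = v]).
Proof.
move=> h0 hb; elim: cands => [_|[c d] cands IH H] /=.
  apply: hoare_bind (hoare_false w) _ _ => [|w1 any e1 h1]; first by lia.
  apply: hoare_bind (hoare_is_log (num_ext e1 h0) (num_ext e1 hb)) _ _; first by lia.
  move=> w2 e e2 h2; apply: hoare_ret.
  exists v0, false; eexists; split; first exact: num_ext (wext_trans e1 e2) h0.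
  - exact: wval_ext h1.
  - exact: h2.
  - by [].
inversion H as [|? ? [vc [dd [hc hd ed]]] H']; subst.
rewrite mulSn; move: (_.+1 * _) (IH H') => X {}IH.
apply: hoare_bind IH _ _; first exact: leq_addl.
rewrite addnK.
move=> w1 r e1 [u [a [e [h1 h2 h3 h4]]]].
have [cbs [hcb scb ecb]] := num_ext e1 hc; have [rbs [hrb srb erb]] := h1.
apply: hoare_bind (hoare_mapzip (c := 4) (g := fun x y => if dd then x else y)
  hcb hrb _ _) _ _.
- by rewrite scb srb.
- move=> w' x y b' d' e' hx' hy'; apply: hoare_mux hx' hy'.
  exact: wval_ext (wext_trans e1 e') hd.
- by rewrite scb leq_addr.
move=> w2 sel e2; have -> : [seq (if dd then p.1 else p.2) | p <- zip cbs rbs] =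
    if dd then cbs else rbs.
  case: (dd); first by rewrite [LHS]unzip1_zip // scb srb.
  by rewrite [LHS]unzip2_zip // scb srb.
move=> h5; have h5n : num w2 sel n (if dd then vc else u).
  by case: (dd) h5 => h5; [exists cbs | exists rbs].
have e02 := wext_trans e1 e2.
apply: hoare_bind (hoare_or (wval_ext e02 hd) (wval_ext e2 h2)) _ _
  => [|w3 any e3 h6]; rewrite scb addKn //.
apply: hoare_bind (hoare_is_log (num_ext e3 h5n) (num_ext (wext_trans e02 e3) hb)) _ _.
  by rewrite addKn.
move=> w4 e' e4 h7; apply: hoare_ret; do 3 eexists; split.
- exact: num_ext (wext_trans e3 e4) h5n.
- exact: wval_ext h6.
- exact: h7.
- by move=> /h4; case: (dd) ed => // ->.
Qed.

Definition cost_corrected (Z : nat) : nat :=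
  2 * code_len n n s + ((2 * n + cost_D2 n s) * Z +
    (s + Z.+1 * (4 * n + (1 + cost_log n)))).

Lemma hoare_cands w code cs images b v : size cs = code_len n n s ->
  all (fun x => size x == n) images -> vals w code cs -> num w b n v ->
  hoare w (bcands n q g s images code b) ((2 * n + cost_D2 n s) * size images)
    (fun w' => Forall2 (fun _ => is_candidate v w') images).
Proof.
move=> sc im hc hb.
apply: (@hoare_mapb _ _ w _ images (2 * n + cost_D2 n s)
  (fun w' _ => is_candidate v w')).
- by move=> ? ? ? ?; apply: is_candidate_ext.
- move=> w' x e' /(allP im)/eqP sx.
  apply: hoare_bind (hoare_consts _ _) _ _; rewrite sx ?leq_addr //.
  move=> w2 xs e2 h2; have e12 := wext_trans e' e2; rewrite addKn.
  exact: hoare_D2 (vals_ext e12 hc) sc (num_ext e12 hb) h2 sx.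
Qed.

Lemma hoare_corrected w cs images C b bs : size cs = code_len n n s ->
  all (fun x => size x == n) images -> is_circuit n n C -> csize C <= s ->
  vals w b bs -> size bs = n ->
  hoare w (bcorrected n q g s cs images C b) (cost_corrected (size images))
    (fun w' r => exists u a e, [/\ num w' r.1.1 n u, wval w' r.1.2 a,
       wval w' r.2 e &
       g ^ bits_val (ceval C bs) %% q = bits_val bs -> g ^ u %% q = bits_val bs]).
Proof.
move=> sc im hC leC hb sb; have hbn := vals_num hb; rewrite sb in hbn.
rewrite /cost_corrected; move eZ : (size images) => Z.
apply: hoare_bind (hoare_consts w cs) _ _ => [|w1 code e1 h1].
  by rewrite sc leq_addr.
rewrite sc addKn.
apply: hoare_bind (hoare_cands sc im h1 (num_ext e1 hbn)) _ _.
  by rewrite eZ leq_addr.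
rewrite eZ addKn => w2 cands e2 h2; have e02 := wext_trans e1 e2.
apply: hoare_bind (hoare_inline hC (vals_ext e02 hb) sb) _ _ => [|w3 base e3 h3].
  by apply: leq_trans leC (leq_addr _ _).
have szc : size cands = Z by rewrite -eZ; elim: h2 => //= ? ? ? ? _ _ ->.
have := vals_num h3; have [_ _ so] := (is_circuitP n n C).1 hC.
rewrite size_map so => h3n.
apply: hoare_cons (hoare_choose h3n (num_ext (wext_trans e02 e3) hbn) _) _ _ => //.
  elim: h2 => [|? ? ? ? hc _ IH]; constructor=> //; exact: is_candidate_ext hc.
by rewrite szc -(leq_add2l (csize C)) subnKC ?leq_add2r // (leq_trans leC) ?leq_addr.
Qed.

Lemma hoare_dlog w d b v : num w b n v ->
  (exists u, num w d n u /\ (0 < v < q -> g ^ u %% q = v)) ->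
  hoare w (let* h := bin_group n q b in let* e := bis_log n q g d b in bimp h e)
    (cost_group n + cost_log n + 2) (fun w' x => wval w' x true).
Proof.
move=> hb [u [hd hu]].
apply: hoare_bind (hoare_in_group hb) _ _ => [|w1 h e1 h1]; first by lia.
apply: hoare_bind (hoare_is_log (num_ext e1 hd) (num_ext e1 hb)) _ _
  => [|w2 e e2 h2]; first by lia.
apply: hoare_cons (hoare_imp (wval_ext e2 h1) h2) _ _; first by lia.
by move=> w3 x _; case: (0 < v < q) hu => // ->; rewrite ?eqxx.
Qed.

End DiscreteLog.

(** * Parametricity of circuit constructions *)

Section Forall2.
Variables (A B : Type) (R : A -> B -> Prop).

Lemma Forall2_size s t : Forall2 R s t -> size s = size t.
Proof. by elim=> //= ? ? ? ? _ _ ->. Qed.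

Lemma Forall2_cat s t s' t' :
  Forall2 R s t -> Forall2 R s' t' -> Forall2 R (s ++ s') (t ++ t').
Proof. by move=> + h'; elim=> //= *; constructor. Qed.

Lemma Forall2_seq1 a b : R a b -> Forall2 R [:: a] [:: b].
Proof. by move=> h; constructor. Qed.

Lemma Forall2_nseq k a b : R a b -> Forall2 R (nseq k a) (nseq k b).
Proof. by move=> h; elim: k => //= *; constructor. Qed.

Lemma Forall2_take k s t : Forall2 R s t -> Forall2 R (take k s) (take k t).
Proof. by move=> h; elim: h k => [|? ? ? ? ? ? IH] [|k] //=; constructor; auto. Qed.

Lemma Forall2_drop k s t : Forall2 R s t -> Forall2 R (drop k s) (drop k t).
Proof. by move=> h; elim: h k => [|? ? ? ? ? ? IH] [|k] //=; constructor; auto. Qed.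

Lemma Forall2_nth a b k s t : Forall2 R s t -> k < size s ->
  R (nth a s k) (nth b t k).
Proof. by move=> h; elim: h k => [|? ? ? ? ? ? IH] [|k] //=; apply: IH. Qed.

Lemma Forall2_nthI a b s t : size s = size t ->
  (forall k, k < size s -> R (nth a s k) (nth b t k)) -> Forall2 R s t.
Proof.
elim: s t => [|x s IH] [|y t] //= [sz] h; constructor; first exact: (h 0).
by apply: IH => // k lt; apply: (h k.+1).
Qed.

End Forall2.

Lemma Forall2_zip A B A' B' (R : A -> B -> Prop) (R' : A' -> B' -> Prop) s t s' t' :
  Forall2 R s t -> Forall2 R' s' t' ->
  Forall2 (fun p q => R p.1 q.1 /\ R' p.2 q.2) (zip s s') (zip t t').
Proof.
move=> h; elim: h s' t' => [|? ? ? ? ? ? IH] s' t' [|? ? ? ? ? ?] //=;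
by constructor=> //; apply: IH.
Qed.

Lemma Forall2_refl A (R : A -> A -> Prop) s : (forall a, R a a) -> Forall2 R s s.
Proof. by move=> h; elim: s => // *; constructor. Qed.

Lemma size_mapb A B (h : A -> build B) s i : size (mapb h s i).2 = size s.
Proof. by elim: s i => //= a s IH i; rewrite IH. Qed.

Lemma size_bpad m xs i : size (bpad m xs i).2 = size xs + (m - size xs).
Proof. by rewrite /= size_cat size_nseq. Qed.

Lemma size_badd_carry xs ys c i :
  size (badd_carry xs ys c i).2 = (minn (size xs) (size ys)).+1.
Proof.
by elim: xs ys c i => [|x xs IH] [|y ys] c i //=; rewrite IH minnSS.
Qed.

(** Three kinds of R are used below: derivable equivalence of wires (a segment and its copy agree),
    substitution of wires of D for wires of self_n (a segment is renamed into D), and equality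
    restricted to given inputs and new wires (a segment reads nothing else). *)
Definition grel (R : nat -> nat -> Prop) (g1 g2 : gate) : Prop :=
  match g1, g2 with
  | GFalse, GFalse => True
  | GNot a, GNot b => R a b
  | GAnd a b, GAnd a' b' | GOr a b, GOr a' b' => R a a' /\ R b b'
  | _, _ => False
  end.

(* Parametricity: related inputs yield related gates and results, provided R
   relates the new wires in order. *)
Record relb (R : nat -> nat -> Prop) A B (RA : A -> B -> Prop)
    (m1 : build A) (m2 : build B) : Prop := Relb { relbP : forall i j,
  (forall t, t < size (m1 i).1 -> R (i + t) (j + t)) ->
  Forall2 (grel R) (m1 i).1 (m2 j).1 /\ RA (m1 i).2 (m2 j).2 }.

Section Parametricity.
Variable R : nat -> nat -> Prop.
Notation RL := (Forall2 R).
Notation relw := (relb R R).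
Notation rell := (relb R RL).

Lemma relb_ret A B (RA : A -> B -> Prop) a b :
  RA a b -> relb R RA (ret a) (ret b).
Proof. by move=> h; split=> i j _; split=> //=; constructor. Qed.

Lemma relb_bind A B A' B' (RA : A -> A' -> Prop) (RB : B -> B' -> Prop)
    m1 m2 k1 k2 :
  relb R RA m1 m2 -> (forall a b, RA a b -> relb R RB (k1 a) (k2 b)) ->
  relb R RB (bind m1 k1) (bind m2 k2).
Proof.
move=> [hm] hk; split=> i j; rewrite /bind /=; set r1 := m1 i; set r2 := m2 j => hR.
have [g1 h1] : Forall2 (grel R) r1.1 r2.1 /\ RA r1.2 r2.2.
  by apply: hm => t lt; apply: hR; rewrite size_cat ltn_addr.
have [|g2 h2] := relbP (hk _ _ h1) (i := i + size r1.1) (j := j + size r2.1).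
  move=> t lt; rewrite -(Forall2_size g1) -!addnA; apply: hR.
  by rewrite size_cat ltn_add2l.
by split=> //; apply: Forall2_cat.
Qed.

(** Sizes have to be tracked where a construction picks a wire by [nth]: out of range the default
    wire 0 would be returned, and 0 need not be related to itself. *)
Lemma relb_size A B (RA : A -> B -> Prop) m1 m2 k :
  relb R (Forall2 RA) m1 m2 -> (forall i, size (m1 i).2 = k) ->
  relb R (fun a b => Forall2 RA a b /\ size a = k) m1 m2.
Proof. by move=> [h] hi; split=> i j /h [h1 h2]. Qed.

Lemma relb_emit g1 g2 : grel R g1 g2 -> relw (emit g1) (emit g2).
Proof.
move=> h; split=> i j hR; split=> /=; first by constructor.
by have := hR 0 isT; rewrite !addn0.
Qed.

Lemma relb_mapb A B A' B' (RA : A -> A' -> Prop) (RB : B -> B' -> Prop)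
    (h1 : A -> build B) (h2 : A' -> build B') s1 s2 :
  Forall2 RA s1 s2 ->
  (forall a b, RA a b -> relb R RB (h1 a) (h2 b)) ->
  relb R (Forall2 RB) (mapb h1 s1) (mapb h2 s2).
Proof.
move=> hs hh; elim: hs => [|a b {}s1 {}s2 hab hs IH] /=.
  by apply: relb_ret; constructor.
apply: relb_bind (hh _ _ hab) _ => y y' hy.
apply: relb_bind IH _ => ys ys' hys.
by apply: relb_ret; constructor.
Qed.

Lemma relb_false : relw bfalse bfalse. Proof. exact: relb_emit. Qed.

Lemma relb_not a a' : R a a' -> relw (bnot a) (bnot a').
Proof. by move=> h; apply: relb_emit. Qed.

Lemma relb_and a a' b b' : R a a' -> R b b' -> relw (band a b) (band a' b').
Proof. by move=> h h'; apply: relb_emit. Qed.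

Lemma relb_or a a' b b' : R a a' -> R b b' -> relw (bor a b) (bor a' b').
Proof. by move=> h h'; apply: relb_emit. Qed.

Ltac rel1 := first [ eassumption | exact: relb_false
  | apply: relb_not | apply: relb_and | apply: relb_or ].
Ltac rel := repeat first [ rel1
  | apply: relb_bind; [ rel1; by eauto | move=> ? ? ? ] ].

Lemma relb_const b : relw (bconst b) (bconst b).
Proof. by case: b; rewrite /bconst ?/btrue; rel. Qed.

Lemma relb_consts bs : rell (bconsts bs) (bconsts bs).
Proof.
apply: (relb_mapb (RA := eq)); first exact: Forall2_refl.
by move=> b _ <-; apply: relb_const.
Qed.

Lemma relb_xor a a' b b' : R a a' -> R b b' -> relw (bxor a b) (bxor a' b').
Proof. by move=> h h'; rewrite /bxor; rel. Qed.

Lemma relb_mux c c' a a' b b' : R c c' -> R a a' -> R b b' ->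
  relw (bmux c a b) (bmux c' a' b').
Proof. by move=> h h' h''; rewrite /bmux; rel. Qed.

Lemma relb_ball s s' : RL s s' -> relw (ball s) (ball s').
Proof.
elim=> [|? ? ? ? ? ? IH] /=; first exact: relb_const true.
by apply: relb_bind IH _ => ? ? ?; rel.
Qed.

Lemma relb_bany s s' : RL s s' -> relw (bany s) (bany s').
Proof.
elim=> [|? ? ? ? ? ? IH] /=; first exact: relb_false.
by apply: relb_bind IH _ => ? ? ?; rel.
Qed.

Lemma relb_pad m s s' : RL s s' -> rell (bpad m s) (bpad m s').
Proof.
move=> h; apply: relb_bind relb_false _ => z z' hz; apply: relb_ret.
by rewrite (Forall2_size h); apply: Forall2_cat h (Forall2_nseq _ hz).
Qed.

Lemma relb_shift m s s' : RL s s' -> rell (bshift m s) (bshift m s').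
Proof.
move=> h; apply: relb_bind relb_false _ => z z' hz; apply: relb_ret.
exact: Forall2_cat (Forall2_nseq _ hz) h.
Qed.

Lemma relb_add_carry xs xs' ys ys' c c' : RL xs xs' -> RL ys ys' -> R c c' ->
  rell (badd_carry xs ys c) (badd_carry xs' ys' c').
Proof.
move=> hx; elim: hx ys ys' c c' => [|x x' {}xs {}xs' hx hxs IH] ys ys' c c' hy hc /=.
  by apply: relb_ret; apply: Forall2_seq1.
case: hy => [|y y' {}ys {}ys' hy hys]; first by apply: relb_ret; apply: Forall2_seq1.
apply: relb_bind (relb_xor hx hy) _ => ? ? h1.
apply: relb_bind (relb_xor h1 hc) _ => ? ? h2.
apply: relb_bind (relb_and hx hy) _ => ? ? h3.
apply: relb_bind (relb_and h1 hc) _ => ? ? h4.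
apply: relb_bind (relb_or h3 h4) _ => ? ? h5.
apply: relb_bind (IH _ _ _ _ hys h5) _ => ? ? h6.
by apply: relb_ret; constructor.
Qed.

Lemma relb_add xs xs' ys ys' : RL xs xs' -> RL ys ys' ->
  rell (badd xs ys) (badd xs' ys').
Proof.
move=> hx hy; rewrite /badd (Forall2_size hx) (Forall2_size hy).
apply: relb_bind (relb_pad _ hx) _ => ? ? h1.
apply: relb_bind (relb_pad _ hy) _ => ? ? h2.
apply: relb_bind relb_false _ => ? ? h3.
exact: relb_add_carry.
Qed.

Lemma relb_sub xs xs' ys ys' : RL xs xs' -> RL ys ys' ->
  relb R (fun p q => RL p.1 q.1 /\ R p.2 q.2) (bsub xs ys) (bsub xs' ys').
Proof.
move=> hx hy; rewrite /bsub -(Forall2_size hx) -(Forall2_size hy).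
apply: relb_bind (relb_size (relb_pad _ hx) (size_bpad _ xs)) _ => ? ? [h1 s1].
apply: relb_bind (relb_size (relb_pad _ hy) (size_bpad _ ys)) _ => ? ? [h2 s2].
apply: relb_bind (relb_size (relb_mapb (RB := R) h2 _) (size_mapb _ _)) _.
  by move=> ? ? ?; apply: relb_not.
move=> ? ? [h3 s3]; apply: relb_bind (relb_const true) _ => ? ? h4.
apply: relb_bind (relb_size (relb_add_carry h1 h3 h4) (size_badd_carry _ _ _)) _.
move=> ? ? [h5 s5]; apply: relb_ret; split=> /=; first exact: Forall2_take.
by apply: Forall2_nth h5 _; rewrite s5 s3 s2 s1; lia.
Qed.

Lemma relb_ge xs xs' ys ys' : RL xs xs' -> RL ys ys' ->
  relw (bge xs ys) (bge xs' ys').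
Proof.
by move=> hx hy; apply: relb_bind (relb_sub hx hy) _ => ? ? [_ h]; apply: relb_ret.
Qed.

Lemma relb_eq xs xs' ys ys' : RL xs xs' -> RL ys ys' ->
  relw (beq xs ys) (beq xs' ys').
Proof.
move=> hx hy; rewrite /beq (Forall2_size hx) (Forall2_size hy).
apply: relb_bind (relb_pad _ hx) _ => ? ? h1.
apply: relb_bind (relb_pad _ hy) _ => ? ? h2.
apply: relb_bind (relb_mapb (RB := R) (Forall2_zip h1 h2) _) _.
  move=> ? ? [h h']; apply: relb_bind (relb_xor h h') _ => ? ? ?.
  exact: relb_not.
by move=> ? ? h3; apply: relb_ball.
Qed.

Lemma relb_count xs xs' : RL xs xs' -> rell (bcount xs) (bcount xs').
Proof.
elim=> [|? ? ? ? h _ IH] /=; first by apply: relb_ret; constructor.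
by apply: relb_bind IH _ => ? ? h'; apply: relb_add => //; apply: Forall2_seq1.
Qed.

Lemma relb_mul_const c xs xs' : RL xs xs' ->
  rell (bmul_const c xs) (bmul_const c xs').
Proof.
move=> h; elim: c => [|b c IH] /=; first by apply: relb_ret; constructor.
apply: relb_bind IH _ => ? ? h1; apply: relb_bind (relb_shift 1 h1) _ => ? ? h2.
by case: b; [apply: relb_add | apply: relb_ret].
Qed.

Lemma relb_muxes c c' xs xs' ys ys' : R c c' -> RL xs xs' -> RL ys ys' ->
  rell (mapb (fun ab => bmux c ab.1 ab.2) (zip xs ys))
       (mapb (fun ab => bmux c' ab.1 ab.2) (zip xs' ys')).
Proof.
move=> hc hx hy; apply: relb_mapb (Forall2_zip hx hy) _ => ? ? [h h'].
exact: relb_mux.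
Qed.

Lemma relb_reduce n m xs xs' : RL xs xs' ->
  rell (breduce n m xs) (breduce n m xs').
Proof.
move=> h; apply: relb_bind (relb_consts _) _ => ? ? h1.
apply: relb_bind (relb_sub h h1) _ => d d' [h2 h3].
rewrite (Forall2_size h2); apply: relb_bind (relb_pad _ h) _ => ? ? h4.
apply: relb_bind (relb_muxes h3 h2 h4) _ => ? ? h5.
by apply: relb_ret; apply: Forall2_take.
Qed.

Lemma relb_mod n m xs xs' : RL xs xs' -> rell (bmod n m xs) (bmod n m xs').
Proof.
elim=> [|? ? ? ? h _ IH] /=; first exact: relb_consts.
by apply: relb_bind IH _ => ? ? h'; apply: relb_reduce; constructor.
Qed.

Lemma relb_addm n m xs xs' ys ys' : RL xs xs' -> RL ys ys' ->
  rell (baddm n m xs ys) (baddm n m xs' ys').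
Proof.
move=> h h'; apply: relb_bind (relb_add h h') _ => ? ? h1.
exact: relb_reduce.
Qed.

Lemma relb_mulm n m xs xs' ys ys' : RL xs xs' -> RL ys ys' ->
  rell (bmulm n m xs ys) (bmulm n m xs' ys').
Proof.
move=> h; elim=> [|y y' ? ? hy _ IH] /=; first exact: relb_consts.
apply: relb_bind IH _ => ? ? h1; apply: relb_bind (relb_shift 1 h1) _ => ? ? h2.
apply: relb_bind (relb_reduce _ _ h2) _ => ? ? h3.
apply: relb_bind (relb_mapb (RB := R) h _) _ => [? ? ?|? ? h4].
  exact: relb_and.
exact: relb_addm.
Qed.

Lemma relb_powm n m g es es' : RL es es' ->
  rell (bpowm n m g es) (bpowm n m g es').
Proof.
elim=> [|e e' ? ? he _ IH] /=; first exact: relb_consts.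
apply: relb_bind IH _ => ? ? h1; apply: relb_bind (relb_mulm n m h1 h1) _ => ? ? h2.
apply: relb_bind (relb_consts _) _ => ? ? h3.
apply: relb_bind (relb_mulm n m h3 h2) _ => ? ? h4.
exact: relb_muxes.
Qed.

Lemma relb_in_group n q xs xs' : RL xs xs' ->
  relw (bin_group n q xs) (bin_group n q xs').
Proof.
move=> h; apply: relb_bind (relb_bany h) _ => ? ? h1.
apply: relb_bind (relb_consts _) _ => ? ? h2.
apply: relb_bind (relb_ge h h2) _ => ? ? h3.
by rel.
Qed.

Lemma relb_is_log n q g es es' bs bs' : RL es es' -> RL bs bs' ->
  relw (bis_log n q g es bs) (bis_log n q g es' bs').
Proof.
move=> h h'; apply: relb_bind (relb_powm n q g h) _ => ? ? h1.
exact: relb_eq.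
Qed.

Lemma relb_eq_const xs xs' c : RL xs xs' ->
  relw (beq_const xs c) (beq_const xs' c).
Proof.
move=> h; apply: relb_bind (relb_mapb (RB := R)
  (Forall2_zip h (Forall2_refl c (fun a => erefl a))) _) _.
  move=> [x b] [x' b'] /= [hx <-]; case: b; first exact: relb_ret.
  exact: relb_not.
by move=> ? ? h1; apply: relb_ball.
Qed.

Lemma relb_select adr adr' ws ws' : RL adr adr' -> RL ws ws' ->
  relw (bselect adr ws) (bselect adr' ws').
Proof.
move=> h hw; rewrite /bselect (Forall2_size hw) (Forall2_size h).
apply: relb_bind (relb_mapb (RB := R)
  (Forall2_zip (Forall2_refl _ (fun a => erefl a)) hw) _) _.
  move=> [j x] [j' x'] /= [<- hx].
  by apply: relb_bind (relb_eq_const _ h) _ => ? ? ?; apply: relb_and.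
by move=> ? ? h1; apply: relb_bany.
Qed.

Lemma relb_code_gate L code code' ws ws' : RL code code' -> RL ws ws' ->
  2 <= size code -> relw (bcode_gate L code ws) (bcode_gate L code' ws').
Proof.
move=> hc hw le.
have h1 := Forall2_nth 0 0 hc le.
have h0 := Forall2_nth 0 0 hc (leq_trans (isT : 0 < 2) le).
apply: relb_bind (relb_select (Forall2_take L (Forall2_drop 2 hc)) hw) _ => ? ? ha.
apply: relb_bind (relb_select (Forall2_take L (Forall2_drop (2 + L) hc)) hw) _.
move=> ? ? hb; apply: relb_bind (relb_not ha) _ => ? ? hna.
apply: relb_bind (relb_and h1 hna) _ => ? ? hlo.
apply: relb_bind (relb_and ha hb) _ => ? ? hcon.
apply: relb_bind (relb_or ha hb) _ => ? ? hdis.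
apply: relb_bind (relb_mux h1 hdis hcon) _ => ? ? hhi.
exact: relb_mux.
Qed.

Lemma relb_code_gates L s code code' ws ws' : RL code code' -> RL ws ws' ->
  s * (2 + 2 * L) <= size code ->
  rell (bcode_gates L s code ws) (bcode_gates L s code' ws').
Proof.
elim: s code code' ws ws' => [|s IH] code code' ws ws' hc hw le.
  exact: relb_ret.
rewrite /bcode_gates -/bcode_gates.
apply: relb_bind (relb_code_gate L (Forall2_take _ hc) hw _) _.
  by rewrite size_takel; lia.
move=> ? ? h; apply: IH; first exact: Forall2_drop.
  by rewrite -!cats1; apply: Forall2_cat => //; apply: Forall2_seq1.
by rewrite size_drop; lia.
Qed.

Lemma relb_code_eval n m s code code' xs xs' : RL code code' -> RL xs xs' ->
  size code = code_len n m s ->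
  rell (bcode_eval n m s code xs) (bcode_eval n m s code' xs').
Proof.
move=> hc hx sc; apply: relb_bind (relb_code_gates hc hx _) _.
  by rewrite sc /code_len leq_addr.
move=> ? ? h; apply: relb_mapb (Forall2_refl _ (fun a => erefl a)) _ => j _ <-.
by apply: relb_select => //; do 2 apply: Forall2_drop || apply: Forall2_take;
  apply: Forall2_drop.
Qed.

Lemma relb_D1 n q g s code code' xs xs' : RL code code' -> RL xs xs' ->
  size code = code_len n n s ->
  relw (bD1 n q g s code xs) (bD1 n q g s code' xs').
Proof.
move=> hc hx sc; apply: relb_bind (relb_code_eval hc hx sc) _ => ? ? h1.
apply: relb_bind (relb_is_log n q g h1 hx) _ => ? ? h2.
apply: relb_bind (relb_in_group n q hx) _ => ? ? h3.
exact: relb_and.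
Qed.

Lemma relb_D2 n q g s code code' b b' r r' : RL code code' -> RL b b' ->
  RL r r' -> size code = code_len n n s ->
  relw (bD2 n q g s code b r) (bD2 n q g s code' b' r').
Proof.
move=> hc hb hr sc.
have h' : rell (bCprime n q g s code b r) (bCprime n q g s code' b' r').
  apply: relb_bind (relb_powm n q g hr) _ => ? ? h1.
  apply: relb_bind (relb_mulm n q hb h1) _ => ? ? h2.
  apply: relb_bind (relb_code_eval hc h2 sc) _ => ? ? h3.
  apply: relb_bind (relb_mod n q.-1 h3) _ => ? ? h4.
  apply: relb_bind (relb_consts _) _ => ? ? h5.
  apply: relb_bind (relb_sub h5 hr) _ => ? ? [h6 _].
  exact: relb_addm.
apply: relb_bind h' _ => ? ? h1.
apply: relb_bind (relb_is_log n q g h1 hb) _ => ? ? h2.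
apply: relb_bind (relb_in_group n q hr) _ => ? ? h3.
exact: relb_and.
Qed.

Lemma relb_prob_ge n l c c' P P' : RL c c' -> RL P P' ->
  relw (bprob_ge n l c P) (bprob_ge n l c' P').
Proof.
move=> hc hP; apply: relb_bind (relb_shift n hc) _ => ? ? h1.
apply: relb_bind (relb_shift l hP) _ => ? ? h2.
exact: relb_ge.
Qed.

Lemma relb_prob_ge_half n l c c' P P' : RL c c' -> RL P P' ->
  relw (bprob_ge_half n l c P) (bprob_ge_half n l c' P').
Proof.
move=> hc hP; apply: relb_bind (relb_mul_const _ hc) _ => ? ? h1.
apply: relb_bind (relb_shift _ h1) _ => ? ? h2.
apply: relb_bind (relb_consts _) _ => ? ? h3.
apply: relb_bind (relb_add h2 h3) _ => ? ? h4.
apply: relb_bind (relb_mul_const _ hP) _ => ? ? h5.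
apply: relb_bind (relb_shift _ h5) _ => ? ? h6.
exact: relb_ge.
Qed.

End Parametricity.

(** * Completeness of Frege systems and short derivations *)

(** Provability from hypotheses without counting lines; lengths come back in [scheme_bound] through
    finiteness. *)
Inductive frege_prov (H : pform -> Prop) : pform -> Prop :=
  | fp_ax A : frege_axiom A -> frege_prov H A
  | fp_hyp A : H A -> frege_prov H A
  | fp_mp A B : frege_prov H A -> frege_prov H (FImp A B) -> frege_prov H B.

Definition hadd (H : pform -> Prop) (A : pform) : pform -> Prop :=
  fun B => B = A \/ H B.

Section FregeProv.
Implicit Types (H : pform -> Prop) (A B C : pform).

Lemma fp_weak H H' A : (forall B, H B -> H' B) ->
  frege_prov H A -> frege_prov H' A.
Proof.
move=> sub; elim=> [B h|B h|B C _ h1 _ h2]; first exact: fp_ax.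
  by apply: fp_hyp; apply: sub.
exact: fp_mp h1 h2.
Qed.

Lemma fp_add H A B : frege_prov H B -> frege_prov (hadd H A) B.
Proof. by apply: fp_weak; right. Qed.

Lemma fp_top H A : frege_prov (hadd H A) A.
Proof. by apply: fp_hyp; left. Qed.

Lemma fp_K H A B : frege_prov H A -> frege_prov H (FImp B A).
Proof. by move=> h; apply: fp_mp h _; apply: fp_ax; constructor. Qed.

Lemma fp_ded H A B : frege_prov (hadd H A) B -> frege_prov H (FImp A B).
Proof.
elim=> [C h|C [->|h]|C D _ h1 _ h2].
- by apply: fp_K; apply: fp_ax.
- apply: fp_mp (fp_ax _ (Ax_K A A)) _.
  by apply: fp_mp (fp_ax _ (Ax_K A (FImp A A))) _; apply: fp_ax; constructor.
- by apply: fp_K; apply: fp_hyp.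
- by apply: fp_mp h1 _; apply: fp_mp h2 _; apply: fp_ax; constructor.
Qed.

Lemma fp_not H A B : frege_prov (hadd H A) B -> frege_prov (hadd H A) (FNot B) ->
  frege_prov H (FNot A).
Proof.
move=> /fp_ded h1 /fp_ded h2; apply: fp_mp h2 _; apply: fp_mp h1 _.
by apply: fp_ax; constructor.
Qed.

Lemma fp_nn H A : frege_prov H (FNot (FNot A)) -> frege_prov H A.
Proof. by move=> h; apply: fp_mp h _; apply: fp_ax; constructor. Qed.

Lemma fp_absurd H A B : frege_prov H A -> frege_prov H (FNot A) -> frege_prov H B.
Proof. by move=> h h'; apply: fp_nn; apply: (@fp_not _ _ A); apply: fp_add. Qed.

(** Classical case distinction from double negation: assuming not B, the proof of B from A refutes
    A, and then the other proof yields B. *)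
Lemma fp_case H A B : frege_prov (hadd H A) B -> frege_prov (hadd H (FNot A)) B ->
  frege_prov H B.
Proof.
move=> h h'; apply: fp_nn; apply: (@fp_not _ _ B); last exact: fp_top.
apply: fp_mp (fp_add _ (fp_ded h')); apply: (@fp_not _ _ B).
  by apply: fp_weak h => C [->|]; [left | right; right].
by apply: fp_add; apply: fp_top.
Qed.

Definition lit (v : nat -> bool) A : pform := if feval v A then A else FNot A.

Fixpoint vars_below (V : nat) A : bool :=
  match A with
  | FVar x => x < V
  | FBot => true
  | FNot A => vars_below V A
  | FAnd A B | FOr A B | FImp A B => vars_below V A && vars_below V B
  end.

Definition lits (v : nat -> bool) (V : nat) : pform -> Prop :=
  fun B => exists2 x, x < V & B = lit v (FVar x).

(** Kalmar's lemma, by induction on A: the literals describing v decide A. *)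
Lemma kalmar v V A : vars_below V A -> frege_prov (lits v V) (lit v A).
Proof.
elim: A => [x lt||A IH|A IHA B IHB|A IHA B IHB|A IHA B IHB] /=;
  rewrite ?/lit /=.
- by apply: fp_hyp; exists x.
- move=> _; apply: (@fp_not _ _ FBot); first exact: fp_top.
  by apply: fp_mp (fp_top _ _) _; apply: fp_ax; constructor.
- move=> /IH; rewrite /lit; case: (feval v A) => //= h.
  by apply: (@fp_not _ _ A); [apply: fp_add | apply: fp_top].
- move=> /andP[/IHA + /IHB]; rewrite /lit.
  case: (feval v A) => /= hA; last first.
    move=> _; apply: (@fp_not _ _ A); last exact: fp_add.
    by apply: fp_mp (fp_top _ _) _; apply: fp_ax; constructor.
  case: (feval v B) => /= hB.
    by apply: fp_mp hB _; apply: fp_mp hA _; apply: fp_ax; constructor.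
  apply: (@fp_not _ _ B); last exact: fp_add.
  by apply: fp_mp (fp_top _ _) _; apply: fp_ax; constructor.
- move=> /andP[/IHA + /IHB]; rewrite /lit.
  case: (feval v A) => /= hA.
    by move=> _; apply: fp_mp hA _; apply: fp_ax; constructor.
  case: (feval v B) => /= hB.
    by apply: fp_mp hB _; apply: fp_ax; constructor.
  apply: (@fp_not _ _ A); last exact: fp_add.
  (* With both disjuncts refuted, the disjunction implies A: trivially from A, and from B by
     absurdity. This contradicts not A. *)
  apply: fp_mp (fp_top _ _) _.
  apply: (@fp_mp _ (FImp B A)).
    by apply: fp_ded; apply: (@fp_absurd _ B); [apply: fp_top | do 2 apply: fp_add].
  apply: (@fp_mp _ (FImp A A)); first by apply: fp_ded; apply: fp_top.
  by apply: fp_ax; constructor.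
- move=> /andP[/IHA + /IHB]; rewrite /lit.
  case: (feval v A) => /= hA; last first.
    move=> _; apply: fp_ded.
    by apply: (@fp_absurd _ A); [apply: fp_top | apply: fp_add].
  case: (feval v B) => /= hB; first exact: fp_K.
  apply: (@fp_not _ _ B); last exact: fp_add.
  by apply: fp_mp (fp_top _ _); apply: fp_add.
Qed.

Lemma frege_complete V A : tautology A -> vars_below V A ->
  frege_prov (fun=> False) A.
Proof.
move=> tA vA.
(* The literals are discharged one variable at a time: k counts the variables already eliminated,
   and the proofs for the two values of the next variable are merged by cases. *)
suff elim_vars k v : k <= V -> frege_prov (lits v (V - k)) A.
  by have := elim_vars V (fun=> false) (leqnn _); rewrite subnn; apply: fp_weak => B [].
elim: k v => [|k IH] v le.
  by have := kalmar v vA; rewrite /lit tA subn0.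
pose x := V - k.+1; have ex : V - k = x.+1 by rewrite /x; lia.
pose vx b := [eta v with x |-> b].
have sub b B : lits (vx b) (V - k) B ->
    hadd (lits v x) (if b then FVar x else FNot (FVar x)) B.
  case=> y; rewrite ex ltnS leq_eqVlt => /orP[/eqP ->|lt] ->.
    by left; rewrite /lit /= eqxx.
  by right; exists y => //; rewrite /lit /= ltn_eqF.
apply: (@fp_case _ (FVar x)).
- by apply: fp_weak (sub true) (IH (vx true) (ltnW le)).
- by apply: fp_weak (sub false) (IH (vx false) (ltnW le)).
Qed.

End FregeProv.

(** * Proofs as lists of lines *)

Inductive frege_lines : seq pform -> Prop :=
  | FL_nil : frege_lines [::]
  | FL_cons prev A : frege_lines prev ->
      frege_axiom A \/ (exists B, B \in prev /\ FImp B A \in prev) ->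
      frege_lines (A :: prev).

Lemma frege_lines_cat a b : frege_lines a -> frege_lines b -> frege_lines (a ++ b).
Proof.
move=> ha hb; elim: ha => //= prev A _ IH [h|[B [h1 h2]]]; constructor=> //.
  by left.
by right; exists B; rewrite !mem_cat h1 h2.
Qed.

Lemma frege_prov_lines A : frege_prov (fun=> False) A ->
  exists2 pi, frege_lines pi & A \in pi.
Proof.
elim=> [B h|//|B C _ [p1 l1 in1] _ [p2 l2 in2]].
  by exists [:: B]; rewrite ?mem_head //; do ?constructor.
exists (C :: p1 ++ p2); last exact: mem_head.
constructor; first exact: frege_lines_cat.
by right; exists B; rewrite !mem_cat in1 in2 orbT.
Qed.

Lemma frege_axiom_subst s A : frege_axiom A -> frege_axiom (fsubst s A).
Proof. by case=> *; constructor. Qed.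

(** The axioms are schemes, so a substitution maps a proof to a proof with equally many lines. Hence
    one proof of a scheme serves all its instances, however large the substituted formulas are. *)
Lemma frege_lines_subst s pi : frege_lines pi -> frege_lines (map (fsubst s) pi).
Proof.
elim=> [|prev A _ IH [h|[B [h1 h2]]]] /=; constructor=> //.
  by left; apply: frege_axiom_subst.
by right; exists (fsubst s B); split; [|change (FImp _ _) with (fsubst s (FImp B A))];
  apply: map_f.
Qed.

Lemma fsize_subst s A M : 0 < M -> (forall x, fsize (s x) <= M) ->
  fsize (fsubst s A) <= fsize A * M.
Proof.
move=> M0 h; elim: A => [x||A IH|A IA B IB|A IA B IB|A IA B IB] /=;
  rewrite ?mul1n // mulSn ?mulnDl; lia.
Qed.

(** The recursion bounds the depth; the list covers the formulas of size at most k in V variables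
    and contains larger ones too. *)
Fixpoint forms (V k : nat) : seq pform :=
  if k is k'.+1 then
    FBot :: map FVar (iota 0 V) ++ map FNot (forms V k') ++
    [seq FAnd A B | A <- forms V k', B <- forms V k'] ++
    [seq FOr A B | A <- forms V k', B <- forms V k'] ++
    [seq FImp A B | A <- forms V k', B <- forms V k']
  else [::].

Lemma mem_forms V k A : fsize A <= k -> vars_below V A -> A \in forms V k.
Proof.
elim: k A => [|k IH] A; first by case: A.
case: A => [x||A|A B|A B|A B] //= le h; rewrite inE /=; rewrite ?mem_cat.
- by rewrite map_f ?mem_iota ?add0n ?orbT.
- by rewrite eqxx.
- by rewrite (map_f FNot) ?orbT //; apply: IH.
- case/andP: h => hA hB; rewrite (allpairs_f (fun A B => FAnd A B)) ?orbT //; apply: IH => //; lia.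
- case/andP: h => hA hB; rewrite (allpairs_f (fun A B => FOr A B)) ?orbT //; apply: IH => //; lia.
- case/andP: h => hA hB; rewrite (allpairs_f (fun A B => FImp A B)) ?orbT //; apply: IH => //; lia.
Qed.

(* By completeness and finiteness, the schemes of bounded size have proofs of
   bounded size. *)
Lemma scheme_bound V k : exists c, forall A, tautology A -> fsize A <= k ->
  vars_below V A ->
  exists pi, [/\ frege_lines pi, A \in pi, size pi <= c &
                 all (fun B => fsize B <= c) pi].
Proof.
suff [c h] : exists c, forall A, A \in forms V k -> tautology A -> vars_below V A ->
    exists pi, [/\ frege_lines pi, A \in pi, size pi <= c &
                   all (fun B => fsize B <= c) pi].
  by exists c => A tA le vA; apply: h => //; apply: mem_forms.
elim: (forms V k) => [|F Fs [c IH]]; first by exists 0.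
have [c' h'] : exists c, tautology F -> vars_below V F ->
    exists pi, [/\ frege_lines pi, F \in pi, size pi <= c &
                   all (fun B => fsize B <= c) pi].
  (* Where the premises fail, the bound 0 holds vacuously; whether F is a tautology is decided
     classically. *)
  have [vF|nvF] := boolP (vars_below V F); last by exists 0.
  have [pr|npr] := Classical_Prop.classic (tautology F); last by exists 0.
  have [pi l1 l2] := frege_prov_lines (frege_complete pr vF).
  exists (size pi + sumn (map fsize pi)) => _ _; exists pi; split=> //; first by lia.
  apply/allP => B; elim: (pi) => //= D l IHl; rewrite inE => /orP[/eqP ->|/IHl]; lia.
exists (c + c') => A; rewrite inE => /orP[/eqP -> tA vA|inF tA vA].
  have [pi [h1 h2 h3 h4]] := h' tA vA; exists pi; split=> //; first by lia.
  by apply: sub_all h4 => B; lia.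
have [pi [h1 h2 h3 h4]] := IH A inF tA vA; exists pi; split=> //; first by lia.
by apply: sub_all h4 => B; lia.
Qed.

Lemma EF_lines_suffix Ax goal a b : EF_lines Ax goal (a ++ b) -> EF_lines Ax goal b.
Proof. by elim: a => //= A a IH h; apply: IH; inversion h. Qed.

Lemma EF_lines_frege Ax goal pi T : frege_lines pi -> EF_lines Ax goal T ->
  EF_lines Ax goal (pi ++ T).
Proof.
move=> h hT; elim: h => //= prev A _ IH [h|[B [h1 h2]]]; constructor=> //.
  exact: Or41.
by apply: Or42; exists B; rewrite !mem_cat h1 h2.
Qed.

Lemma EF_lines_mp Ax goal T A B : EF_lines Ax goal T -> A \in T ->
  FImp A B \in T -> EF_lines Ax goal (B :: T).
Proof. by move=> h h1 h2; constructor=> //; apply: Or42; exists A. Qed.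

(** * Derivations with a budget of lines *)

Section Derivations.
Variables (Ax : pform -> Prop) (goal : pform).

(* The limits 100 and 12, and 9 premises in [deriv_rule], are large enough for
   every rule used below. *)
Definition is_scheme_bound (c : nat) : Prop :=
  forall A, tautology A -> fsize A <= 100 -> vars_below 12 A ->
  exists pi, [/\ frege_lines pi, A \in pi, size pi <= c &
                 all (fun B => fsize B <= c) pi].

Variables (c M : nat).

Definition rule_cost : nat := c + 10.
Definition line_size : nat := (c + 100) * M.

(** The analogue of [hoare] for proofs: T are the lines so far, latest first, and k is a budget of
    further lines. Line lengths are bounded separately, so proof size is a product of two bounds. *)
Definition deriv (T : seq pform) (k : nat) (Q : seq pform -> Prop) : Prop :=
  exists T', [/\ EF_lines Ax goal (T' ++ T), size T' <= k,
                 all (fun A => fsize A <= line_size) T' & Q (T' ++ T)].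

Lemma deriv_ret T k (Q : seq pform -> Prop) :
  EF_lines Ax goal T -> Q T -> deriv T k Q.
Proof. by exists [::]. Qed.

Lemma deriv_bind T k1 k (Q1 Q2 : seq pform -> Prop) :
  deriv T k1 Q1 -> k1 <= k ->
  (forall T1, EF_lines Ax goal T1 -> {subset T <= T1} -> Q1 T1 ->
     deriv T1 (k - k1) Q2) ->
  deriv T k Q2.
Proof.
move=> [T1 [l1 s1 a1 q1]] le h2.
have sub : {subset T <= T1 ++ T} by move=> A; rewrite mem_cat orbC => ->.
have [T2 [l2 s2 a2 q2]] := h2 _ l1 sub q1.
exists (T2 ++ T1); rewrite -catA all_cat a1 a2 size_cat; split=> //; lia.
Qed.

Lemma deriv_cons T k k' (Q Q' : seq pform -> Prop) :
  deriv T k Q -> k <= k' ->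
  (forall T1, {subset T <= T1} -> Q T1 -> Q' T1) -> deriv T k' Q'.
Proof.
move=> [T1 [l1 s1 a1 q1]] le h; exists T1; split=> //; first by lia.
by apply: h q1 => A; rewrite mem_cat orbC => ->.
Qed.

Lemma deriv_post T k (Q Q' : seq pform -> Prop) : deriv T k Q ->
  (forall T1, EF_lines Ax goal T1 -> {subset T <= T1} -> Q T1 -> Q' T1) ->
  deriv T k Q'.
Proof.
move=> [T1 [l1 s1 a1 q1]] h; exists T1; split=> //.
by apply: h q1 => // A; rewrite mem_cat orbC => ->.
Qed.

Lemma deriv_axiom T A : EF_lines Ax goal T -> Ax A -> fsize A <= line_size ->
  deriv T 1 (fun T' => A \in T').
Proof.
move=> hT hA sA; exists [:: A]; rewrite /= sA mem_head; split=> //.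
by constructor=> //; apply: Or44.
Qed.

(** Induction unfolded inside the proof system: the derivation of [A t] may use all earlier
    [A u]. *)
Lemma deriv_loop (A : nat -> pform) N d T : EF_lines Ax goal T ->
  (forall t T1, t < N -> EF_lines Ax goal T1 -> {subset T <= T1} ->
     (forall u, u < t -> A u \in T1) -> deriv T1 d (fun T2 => A t \in T2)) ->
  deriv T (N * d) (fun T' => forall u, u < N -> A u \in T').
Proof.
move=> hT; elim: N => [|N IH] h; first exact: deriv_ret.
apply: deriv_bind (IH _) _ _; first by move=> *; apply: h => //; lia.
  by rewrite mulSn leq_addl.
move=> T1 l1 sub h1; rewrite mulSn addnK.
apply: deriv_cons (h N T1 _ l1 sub h1) _ _ => // T2 sub2 h2 u.
by rewrite ltnS leq_eqVlt => /orP[/eqP ->|/h1/sub2].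
Qed.

Hypotheses (hc : is_scheme_bound c) (M_gt0 : 0 < M).

(** A valid rule with premises ps and conclusion F costs a constant number of lines: at most c for
    an instance of the implication from ps to F, by completeness, and one modus ponens per premise.
    The list l instantiates the schematic variables. *)
Lemma deriv_rule (l ps : seq pform) (F : pform) T :
  tautology (foldr FImp F ps) -> fsize (foldr FImp F ps) <= 100 ->
  vars_below 12 (foldr FImp F ps) -> size ps <= 9 ->
  EF_lines Ax goal T -> all (fun A => fsize A <= M) l ->
  all (fun p => fsubst (nth FBot l) p \in T) ps ->
  deriv T rule_cost (fun T' => fsubst (nth FBot l) F \in T').
Proof.
move=> tF sF vF sp hT sl hp; set s := nth FBot l.
have ss x : fsize (s x) <= M.
  have [lt|le] := ltnP x (size l); first by move/(all_nthP FBot): sl; apply.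
  by rewrite /s nth_default.
have [pi [l1 l2 l3 l4]] := hc tF sF vF.
have l5 : EF_lines Ax goal (map (fsubst s) pi ++ T).
  by apply: EF_lines_frege => //; apply: frege_lines_subst.
have l6 : fsubst s (foldr FImp F ps) \in map (fsubst s) pi ++ T.
  by rewrite mem_cat map_f.
have l7 : all (fun A => fsize A <= line_size) (map (fsubst s) pi).
  rewrite all_map; apply: sub_all l4 => B le /=.
  apply: leq_trans (fsize_subst _ M_gt0 ss) _; rewrite leq_mul2r.
  by apply/orP; right; lia.
suff [T' [h1 h2 h3 h4]] : exists T', [/\ EF_lines Ax goal (T' ++ map (fsubst s) pi ++ T),
    size T' <= size ps, all (fun A => fsize A <= line_size) T' &
    fsubst s F \in T' ++ map (fsubst s) pi ++ T].
  exists (T' ++ map (fsubst s) pi); rewrite -catA all_cat h3 l7 size_cat size_map.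
  by split=> //; rewrite /rule_cost; lia.
have {}hp : all (fun p => fsubst s p \in map (fsubst s) pi ++ T) ps.
  by apply: sub_all hp => p; rewrite mem_cat orbC => ->.
move: (map _ _ ++ T) l5 l6 hp => U l5 l6 hp {sp tF vF l1 l2}.
elim: ps U l5 l6 hp sF => [|p ps IH] U l5 l6 /=; first by exists [::].
case/andP=> hp hps sF.
have [||||T' [h1 h2 h3 h4]] := IH (fsubst s (foldr FImp F ps) :: U).
- exact: EF_lines_mp hp l6.
- exact: mem_head.
- by apply: sub_all hps => p'; rewrite inE orbC => ->.
- by lia.
exists (T' ++ [:: fsubst s (foldr FImp F ps)]); rewrite -catA; split=> //=.
  by rewrite size_cat /=; lia.
rewrite all_cat h3 /= andbT; apply: leq_trans (fsize_subst _ M_gt0 ss) _.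
by rewrite leq_mul2r; apply/orP; right; lia.
Qed.

End Derivations.

(** * Derivations about circuits *)

Definition gate_def (x : nat) (g : gate) : pform := FIff (FVar x) (gate_form g).

Definition gate_defs (i : nat) (gs : seq gate) : seq pform :=
  [seq gate_def jg.1 jg.2 | jg <- zip (iota i (size gs)) gs].

Definition conj : seq pform -> pform := foldr FAnd (FNot FBot).

Lemma circuit_formE N m : circuit_form N m =
  FImp (conj (gate_defs N (m N).1)) (FVar (m N).2).
Proof. by []. Qed.

Lemma size_gate_defs i gs : size (gate_defs i gs) = size gs.
Proof. by rewrite size_map size_zip size_iota minnn. Qed.

Lemma nth_gate_defs i gs t : t < size gs ->
  nth FBot (gate_defs i gs) t = gate_def (i + t) (nth GFalse gs t).
Proof.
move=> lt; rewrite (nth_map (0, GFalse)) ?size_zip ?size_iota ?minnn //.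
by rewrite nth_zip ?size_iota // nth_iota.
Qed.

Lemma fsize_conj k Fs : all (fun A => fsize A <= k) Fs ->
  fsize (conj Fs) <= k.+1 * size Fs + 2.
Proof.
elim: Fs => [_|A Fs IH /= /andP[hA /IH]]; first by rewrite muln0.
by rewrite mulnS; lia.
Qed.

Lemma fsize_gate_def x g : fsize (gate_def x g) <= 11.
Proof. by case: g. Qed.

Lemma fsize_gate_defs i gs : fsize (conj (gate_defs i gs)) <= 12 * size gs + 2.
Proof.
rewrite -(size_gate_defs i gs); apply: fsize_conj.
apply/(all_nthP FBot) => t; rewrite size_gate_defs => lt; rewrite nth_gate_defs //.
exact: fsize_gate_def.
Qed.

Ltac taut := let v := fresh "v" in
  intro v; simpl; destruct (v 0), (v 1), (v 2), (v 3), (v 4), (v 5), (v 6), (v 7);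
  reflexivity.

Ltac prems := rewrite /= ?andbT; repeat (apply/andP; split); eassumption.

#[local] Opaque bis_log bin_group.

Section CircuitProofs.
Variables (n : nat) (GS : seq gate).
Hypothesis GS_wf : gwf n GS.

(** Subcircuits of D are identified by the position of their gates, so that statements about a
    construction can be applied to the wires it occupies in D. *)
Definition located (i : nat) (gs : seq gate) : Prop :=
  exists pre post, GS = pre ++ gs ++ post /\ i = n + size pre.

Lemma located_refl : located n GS.
Proof. by exists [::], [::]; rewrite cats0 addn0. Qed.

Lemma located_cat i a b : located i (a ++ b) -> located i a /\ located (i + size a) b.
Proof.
case=> pre [post [eG ->]]; split.
  by exists pre, (b ++ post); rewrite eG -!catA.
by exists (pre ++ a), post; rewrite eG size_cat -!catA addnA.
Qed.

Lemma located_cons i g gs : located i (g :: gs) ->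
  located i [:: g] /\ located (i + 1) gs.
Proof. exact: (@located_cat i [:: g]). Qed.

Lemma located_bind A B (m : build A) (k : A -> build B) i :
  located i (bind m k i).1 ->
  located i (m i).1 /\ located (i + size (m i).1) (k (m i).2 (i + size (m i).1)).1.
Proof. exact: located_cat. Qed.

Lemma located_gwf i gs : located i gs -> gwf i gs.
Proof.
case=> pre [post [eG ->]] t lt; have := @GS_wf (size pre + t).
have nlt : (size pre + t < size pre) = false by lia.
by rewrite addnA eG !size_cat nth_cat nlt addKn nth_cat lt; apply; lia.
Qed.

Lemma located_size i gs : located i gs -> size gs <= size GS.
Proof. by case=> pre [post [-> _]]; rewrite !size_cat; lia. Qed.

Lemma located_mapb A B (h : A -> build B) s i a0 b0 t :
  located i (mapb h s i).1 -> t < size s ->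
  exists i', located i' (h (nth a0 s t) i').1 /\
    nth b0 (mapb h s i).2 t = (h (nth a0 s t) i').2.
Proof.
elim: s i t => [|a s IH] i t //= /located_cat[l1 /located_cat[l2 _]].
case: t => [_|t lt]; first by exists i.
exact: IH l2 lt.
Qed.

Variables (Ax : pform -> Prop) (goal : pform) (c M : nat).

Notation G := (conj (gate_defs n GS)).
Notation EF := (EF_lines Ax goal).
Notation derivable := (deriv Ax goal c M).
Notation rc := (rule_cost c).


(** The gate definitions of D are the premise G of the goal. The derivation keeps G as an explicit
    premise, and [base] makes each single definition available under it. *)
Definition base (T : seq pform) : Prop :=
  EF T /\ forall t, t < size GS ->
    FImp G (gate_def (n + t) (nth GFalse GS t)) \in T.

Lemma base_sub T T' : base T -> EF T' -> {subset T <= T'} -> base T'.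
Proof. by move=> [_ h] h' sub; split=> // t lt; apply: sub; apply: h. Qed.

Lemma base_def T i gs t : base T -> located i gs -> t < size gs ->
  FImp G (gate_def (i + t) (nth GFalse gs t)) \in T.
Proof.
move=> [_ h] [pre [post [eG ->]]] lt; have := h (size pre + t).
have nlt : (size pre + t < size pre) = false by lia.
have ltG : size pre + t < size GS by rewrite eG !size_cat; lia.
by rewrite addnA {3}eG nth_cat nlt addKn nth_cat lt; apply.
Qed.

Lemma fsize_conj_drop t Fs : fsize (conj (drop t Fs)) <= fsize (conj Fs).
Proof.
elim: Fs t => [|A Fs IH] [|t] //=.
by apply: leq_trans (IH t) _; lia.
Qed.

Lemma conj_drop t Fs : t < size Fs ->
  conj (drop t Fs) = FAnd (nth FBot Fs t) (conj (drop t.+1 Fs)).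
Proof. by move=> lt; rewrite (drop_nth FBot). Qed.

Hypotheses (hc : is_scheme_bound c) (M_gt : fsize (conj (gate_defs n GS)) + 20 <= M).

Let M_gt0 : 0 < M. Proof. by lia. Qed.
Let G_le : fsize G <= M. Proof. by lia. Qed.

Ltac rule l ps F :=
  apply: (@deriv_rule Ax goal c M hc M_gt0 (l : seq pform) (ps : seq pform) F) => //.

Lemma deriv_base : derivable [::] ((2 * size GS + 1) * rc) base.
Proof.
set Fs := gate_defs n GS; have sF : size Fs = size GS by rewrite size_gate_defs.
have sdrop t : fsize (conj (drop t Fs)) <= M.
  by apply: leq_trans (fsize_conj_drop _ _) _; rewrite /Fs; lia.
(* The conjunction is nested to the right: its tails are derived one from the other, and afterwards
   the head of each tail. *)
apply: deriv_bind (deriv_loop (A := fun t => FImp G (conj (drop t Fs)))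
  (N := size GS + 1) (d := rc) _ _) _ _.
- exact: EF_nil.
- case=> [|t] T lt hT _ hA.
    rewrite drop0; rule [:: G] (@nil pform) (FImp (FVar 0) (FVar 0)); first by taut.
    by rewrite /= G_le.
  have lt' : t < size Fs by rewrite sF; lia.
  have h := hA t (ltnSn t); rewrite conj_drop // in h.
  rule [:: G; nth FBot Fs t; conj (drop t.+1 Fs)]
    [:: FImp (FVar 0) (FAnd (FVar 1) (FVar 2))] (FImp (FVar 0) (FVar 2)).
  + by taut.
  + rewrite /= G_le sdrop nth_gate_defs -?sF // !andbT.
    by apply: leq_trans (fsize_gate_def _ _) _; lia.
  + by prems.
- by rewrite leq_mul2r; lia.
move=> T1 l1 _ h1.
have -> : (2 * size GS + 1) * rc - (size GS + 1) * rc = size GS * rc.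
  by rewrite -mulnBl; congr (_ * _); lia.
apply: deriv_cons (deriv_bind (deriv_loop (A := fun t => FImp G (nth FBot Fs t))
  (N := size GS) (d := rc) l1 _) (leqnn _) (k := size GS * rc) (Q2 := base) _) _ _ => //.
- move=> t T lt hT sub _.
  have h := sub _ (h1 t (ltn_addr 1 lt)); rewrite conj_drop ?sF // in h.
  rule [:: G; nth FBot Fs t; conj (drop t.+1 Fs)]
    [:: FImp (FVar 0) (FAnd (FVar 1) (FVar 2))] (FImp (FVar 0) (FVar 1)).
  + by taut.
  + rewrite /= G_le sdrop nth_gate_defs // !andbT.
    by apply: leq_trans (fsize_gate_def _ _) _; lia.
  + by prems.
- move=> T2 l2 _ h2; apply: deriv_ret => //; split=> // t lt.
  by have := h2 t lt; rewrite nth_gate_defs.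
Qed.

(** L is an additional assumption, such as the failure of all candidates; keeping it in the premise
    of each line avoids transforming proofs by the deduction theorem. *)
Definition under (L : pform) : pform := FAnd G L.

Definition eqv (L : pform) (x y : nat) : pform :=
  FImp (under L) (FIff (FVar x) (FVar y)).

(** Induction along the gates: gates of the same kind with equivalent inputs have equivalent
    outputs. Corresponding inputs either have the same offset in the two segments or are known to be
    equivalent beforehand. *)
Lemma deriv_copy T L i j gs1 gs2 : base T -> fsize L <= 10 ->
  located i gs1 -> located j gs2 ->
  Forall2 (grel (fun x y => (exists2 t, t < size gs1 & x = i + t /\ y = j + t) \/
    eqv L x y \in T)) gs1 gs2 ->
  derivable T (size gs1 * rc)
    (fun T' => forall t, t < size gs1 -> eqv L (i + t) (j + t) \in T').
Proof.
move=> bT sL li lj hg; have wf := located_gwf li.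
apply: deriv_loop; first by case: bT.
move=> t T1 lt l1 sub hA.
have bT1 := base_sub bT l1 sub.
have lt2 : t < size gs2 by rewrite -(Forall2_size hg).
have := base_def bT1 lj lt2; have := base_def bT1 li lt.
(* Gates read earlier wires only, so an internal input has an offset below t and is covered by the
   lines already derived. *)
have R1 x y : x < i + t -> (exists2 t, t < size gs1 & x = i + t /\ y = j + t) \/
    eqv L x y \in T -> eqv L x y \in T1.
  by move=> ltx [[u _ [ex ey]]|/sub //]; rewrite ex ey; apply: hA; lia.
have := Forall2_nth GFalse GFalse hg lt; have := wf t lt.
have sL' : fsize L <= M by lia.
case: (nth GFalse gs1 t) => [|a|a b|a b]; case: (nth GFalse gs2 t) => [|a'|a' b'|a' b'] //=.
- move=> _ _ h1 h2.
  rule [:: G; L; FVar (i + t); FVar (j + t)]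
    [:: FImp (FVar 0) (FIff (FVar 2) FBot); FImp (FVar 0) (FIff (FVar 3) FBot)]
    (FImp (FAnd (FVar 0) (FVar 1)) (FIff (FVar 2) (FVar 3))).
  + by taut.
  + by rewrite /= G_le sL' M_gt0.
  + by prems.
- move=> la ha h1 h2; have {}ha := R1 _ _ la ha.
  rule [:: G; L; FVar (i + t); FVar (j + t); FVar a; FVar a']
    [:: FImp (FVar 0) (FIff (FVar 2) (FNot (FVar 4)));
        FImp (FVar 0) (FIff (FVar 3) (FNot (FVar 5)));
        FImp (FAnd (FVar 0) (FVar 1)) (FIff (FVar 4) (FVar 5))]
    (FImp (FAnd (FVar 0) (FVar 1)) (FIff (FVar 2) (FVar 3))).
  + by taut.
  + by rewrite /= G_le sL' M_gt0.
  + by prems.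
- move=> /andP[la lb] [ha hb] h1 h2; have {}ha := R1 _ _ la ha; have {}hb := R1 _ _ lb hb.
  rule [:: G; L; FVar (i + t); FVar (j + t); FVar a; FVar a'; FVar b; FVar b']
    [:: FImp (FVar 0) (FIff (FVar 2) (FAnd (FVar 4) (FVar 6)));
        FImp (FVar 0) (FIff (FVar 3) (FAnd (FVar 5) (FVar 7)));
        FImp (FAnd (FVar 0) (FVar 1)) (FIff (FVar 4) (FVar 5));
        FImp (FAnd (FVar 0) (FVar 1)) (FIff (FVar 6) (FVar 7))]
    (FImp (FAnd (FVar 0) (FVar 1)) (FIff (FVar 2) (FVar 3))).
  + by taut.
  + by rewrite /= G_le sL' M_gt0.
  + by prems.
- move=> /andP[la lb] [ha hb] h1 h2; have {}ha := R1 _ _ la ha; have {}hb := R1 _ _ lb hb.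
  rule [:: G; L; FVar (i + t); FVar (j + t); FVar a; FVar a'; FVar b; FVar b']
    [:: FImp (FVar 0) (FIff (FVar 2) (FOr (FVar 4) (FVar 6)));
        FImp (FVar 0) (FIff (FVar 3) (FOr (FVar 5) (FVar 7)));
        FImp (FAnd (FVar 0) (FVar 1)) (FIff (FVar 4) (FVar 5));
        FImp (FAnd (FVar 0) (FVar 1)) (FIff (FVar 6) (FVar 7))]
    (FImp (FAnd (FVar 0) (FVar 1)) (FIff (FVar 2) (FVar 3))).
  + by taut.
  + by rewrite /= G_le sL' M_gt0.
  + by prems.
Qed.

Lemma deriv_log_copy T L q g i j es es' b : base T -> fsize L <= 10 ->
  located i (bis_log n q g es b i).1 -> located j (bis_log n q g es' b j).1 ->
  size es = size es' ->
  (forall k, k < size es -> eqv L (nth 0 es k) (nth 0 es' k) \in T) ->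
  derivable T ((size b + size GS) * rc)
    (fun T' => eqv L (bis_log n q g es b i).2 (bis_log n q g es' b j).2 \in T').
Proof.
move=> bT sL li lj ss he; have sL' : fsize L <= M by lia.
apply: deriv_bind (deriv_loop (A := fun k => eqv L (nth 0 b k) (nth 0 b k))
  (N := size b) (d := rc) _ _) _ _.
- by case: bT.
- move=> k T1 _ l1 _ _.
  rule [:: G; L; FVar (nth 0 b k)] (@nil pform)
    (FImp (FAnd (FVar 0) (FVar 1)) (FIff (FVar 2) (FVar 2))).
  + by taut.
  + by rewrite /= G_le sL' M_gt0.
- by rewrite leq_mul2r leq_addr orbT.
move=> T1 l1 sub hb; rewrite mulnDl addKn.
have bT1 := base_sub bT l1 sub.
set m := bis_log n q g es b i.
(* Parametricity for this relation is exactly the hypothesis of [deriv_copy] on the two tests. *)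
pose R x y := (exists2 t, t < size m.1 & x = i + t /\ y = j + t) \/
  eqv L x y \in T1.
have [|||g1 r1] := relbP (@relb_is_log R n q g es es' b b _ _) (i := i) (j := j).
- by apply: (@Forall2_nthI _ _ _ 0 0) => // k lt; right; apply: sub; apply: he.
- by apply: (@Forall2_nthI _ _ _ 0 0) => // k lt; right; apply: hb.
- by move=> t lt; left; exists t.
apply: deriv_cons (deriv_copy bT1 sL li lj g1) _ _.
  by rewrite leq_mul2r (located_size li) orbT.
move=> T2 sub2 h2; case: r1 => [[t lt [-> ->]]|/sub2 //].
exact: h2.
Qed.

Definition cst (b : bool) : pform := if b then FNot FBot else FBot.

Lemma deriv_consts T i bs : base T -> located i (bconsts bs i).1 ->
  derivable T (size bs * rc)
    (fun T' => forall t, t < size bs ->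
       FImp G (FIff (FVar (nth 0 (bconsts bs i).2 t)) (cst (nth false bs t))) \in T').
Proof.
move=> bT li; apply: (@deriv_loop _ _ _ _
  (fun t => FImp G (FIff (FVar (nth 0 (bconsts bs i).2 t)) (cst (nth false bs t))))).
  by case: bT.
move=> t T1 lt l1 sub _.
have bT1 := base_sub bT l1 sub.
have [i' [l' ->]] := located_mapb false 0 li lt.
case: (nth false bs t) l' => l'.
  have := base_def bT1 l' (isT : 0 < 2); have := base_def bT1 l' (isT : 1 < 2).
  rewrite addn0 /= => h1 h0.
  rule [:: G; FVar i'; FVar (i' + 1)]
    [:: FImp (FVar 0) (FIff (FVar 1) FBot);
        FImp (FVar 0) (FIff (FVar 2) (FNot (FVar 1)))]
    (FImp (FVar 0) (FIff (FVar 2) (FNot FBot))).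
  + by taut.
  + by rewrite /= G_le M_gt0.
  + by prems.
have := base_def bT1 l' (isT : 0 < 1); rewrite addn0 /= => h0.
exact: deriv_ret l1 h0.
Qed.

(** * The chain of selections in D *)

Section Choose.
Variables (q g : nat) (base0 b : seq nat).

Lemma size_choose cands i : (forall cd, cd \in cands -> size cd.1 = size base0) ->
  size (bchoose n q g base0 b cands i).2.1.1 = size base0.
Proof.
elim: cands i => [|[c1 d] cands IH] i //= hs.
rewrite size_mapb size_zip IH; last by move=> cd h; apply: hs; rewrite inE h orbT.
by rewrite (hs (c1, d)) ?mem_head // minnn.
Qed.

(** The flag is an iterated disjunction of the acceptance bits; its negation is pushed down the
    chain and refutes one bit per step. *)
Lemma deriv_choose_none T L cands i : base T -> fsize L <= 10 ->
  located i (bchoose n q g base0 b cands i).1 ->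
  FImp (under L) (FNot (FVar (bchoose n q g base0 b cands i).2.1.2)) \in T ->
  derivable T (size cands * (2 * rc))
    (fun T' => forall cd, cd \in cands ->
       FImp (under L) (FIff (FVar cd.2) FBot) \in T').
Proof.
move=> bT sL; have sL' : fsize L <= M by lia.
elim: cands i T bT => [|[c1 d] cands IH] i T bT /=.
  by move=> _ _; apply: deriv_ret => //; case: bT.
move=> /located_cat[l1 /located_cat[_ /located_cons[l3 _]]].
have := base_def bT l3 (isT : 0 < 1); rewrite addn0 /=.
set r := bchoose n q g base0 b cands i in l1 *.
set any := _ + _ => h0 hany.
apply: (@deriv_bind _ _ _ _ _ rc _ (fun T' => FImp (under L) (FIff (FVar d) FBot) \in T')).
- rule [:: G; L; FVar any; FVar d; FVar r.2.1.2]
    [:: FImp (FVar 0) (FIff (FVar 2) (FOr (FVar 3) (FVar 4)));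
        FImp (FAnd (FVar 0) (FVar 1)) (FNot (FVar 2))]
    (FImp (FAnd (FVar 0) (FVar 1)) (FIff (FVar 3) FBot)).
  + by taut.
  + by case: bT.
  + by rewrite /= G_le sL' M_gt0.
  + by prems.
- by lia.
move=> T1 lT1 sub1 hd; have bT1 := base_sub bT lT1 sub1.
apply: (@deriv_bind _ _ _ _ _ rc _ (fun T' => FImp (under L) (FNot (FVar r.2.1.2)) \in T')).
- have {}h0 := sub1 _ h0; have {}hany := sub1 _ hany.
  rule [:: G; L; FVar any; FVar d; FVar r.2.1.2]
    [:: FImp (FVar 0) (FIff (FVar 2) (FOr (FVar 3) (FVar 4)));
        FImp (FAnd (FVar 0) (FVar 1)) (FNot (FVar 2))]
    (FImp (FAnd (FVar 0) (FVar 1)) (FNot (FVar 4))).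
  + by taut.
  + by rewrite /= G_le sL' M_gt0.
  + by prems.
- by lia.
move=> T2 lT2 sub2 hr; have bT2 := base_sub bT1 lT2 sub2.
apply: deriv_cons (IH i T2 bT2 l1 hr) _ _; first by lia.
move=> T3 sub3 h3 cd; rewrite inE => /orP[/eqP ->|/h3 //].
by apply: sub3; apply: sub2.
Qed.

(** The acceptance bit is a conjunction with the test on the candidate and so implies it; the
    position of that test is recorded because the test on the selected value will be compared with
    it. *)
Definition checked (cd : seq nat * nat) : Prop :=
  exists h i j, [/\ located j [:: GAnd h (bis_log n q g cd.1 b i).2], j = cd.2 &
    located i (bis_log n q g cd.1 b i).1].

Lemma deriv_muxes T d xs ys i : base T -> size xs = size ys ->
  let m := mapb (fun ab => bmux d ab.1 ab.2) (zip xs ys) i in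
  located i m.1 ->
  derivable T (size xs * (2 * rc)) (fun T' => forall k, k < size xs ->
    eqv (FVar d) (nth 0 m.2 k) (nth 0 xs k) \in T' /\
    eqv (FNot (FVar d)) (nth 0 m.2 k) (nth 0 ys k) \in T').
Proof.
move=> bT ss m li.
suff h (s : bool) T1 : base T1 -> derivable T1 (size xs * rc)
    (fun T' => forall k, k < size xs ->
    eqv (if s then FVar d else FNot (FVar d)) (nth 0 m.2 k)
      (nth 0 (if s then xs else ys) k) \in T').
  apply: deriv_bind (h true T bT) _ _ => [|T1 l1 sub1 h1]; first by lia.
  apply: deriv_cons (h false T1 (base_sub bT l1 sub1)) _ _ => [|T2 sub2 h2 k lt].
    by lia.
  by split; [apply: sub2; apply: h1 | apply: h2].
move=> bT1; apply: deriv_loop; first by case: bT1.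
move=> k T2 lt l2 sub2 _; have bT2 := base_sub bT1 l2 sub2.
have lt' : k < size (zip xs ys) by rewrite size_zip -ss minnn.
have [i' [l' ->]] := located_mapb (0, 0) 0 li lt'.
rewrite nth_zip // in l' *.
have := base_def bT2 l' (isT : 0 < 4); have := base_def bT2 l' (isT : 1 < 4).
have := base_def bT2 l' (isT : 2 < 4); have := base_def bT2 l' (isT : 3 < 4).
rewrite /= !addn0 !addn1 !addn2 !addn3 => h3 h2 h1 h0.
pose l := [:: G; FVar d; FVar i'; FVar (nth 0 xs k); FVar (nth 0 ys k);
  FVar i'.+1; FVar i'.+2; FVar i'.+3].
pose ps := [:: FImp (FVar 0) (FIff (FVar 2) (FNot (FVar 1)));
  FImp (FVar 0) (FIff (FVar 5) (FAnd (FVar 1) (FVar 3)));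
  FImp (FVar 0) (FIff (FVar 6) (FAnd (FVar 2) (FVar 4)));
  FImp (FVar 0) (FIff (FVar 7) (FOr (FVar 5) (FVar 6)))].
case: s.
- rule l ps (FImp (FAnd (FVar 0) (FVar 1)) (FIff (FVar 7) (FVar 3))).
  + by taut.
  + by rewrite /= G_le M_gt0.
  + by prems.
- rule l ps (FImp (FAnd (FVar 0) (FNot (FVar 1))) (FIff (FVar 7) (FVar 4))).
  + by taut.
  + by rewrite /= G_le M_gt0.
  + by prems.
Qed.

Lemma choose_log cands i :
  located i (bchoose n q g base0 b cands i).1 ->
  exists j, located j (bis_log n q g (bchoose n q g base0 b cands i).2.1.1 b j).1 /\
    (bchoose n q g base0 b cands i).2.2 =
    (bis_log n q g (bchoose n q g base0 b cands i).2.1.1 b j).2.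
Proof.
case: cands => [|[c1 d] cands] /=.
  by move=> /located_cons[_ /located_cat[l _]]; eexists; split; [exact: l|].
move=> /located_cat[_ /located_cat[_ /located_cons[_ /located_cat[l _]]]].
by eexists; split; [exact: l|].
Qed.

(** If the first candidate passes, the selected bits equal it and the test on them is a copy of its
    test. Otherwise they equal the bits selected from the rest, the test is a copy of the previous
    one, and the induction hypothesis applies. *)
Lemma deriv_choose T cands i : base T ->
  (forall cd, cd \in cands -> size cd.1 = size base0 /\ checked cd) ->
  located i (bchoose n q g base0 b cands i).1 ->
  derivable T ((size cands).+1 * ((2 * size base0 + 2 * size b + 2 * size GS + 2) * rc))
    (fun T' => FImp G (FImp (FVar (bchoose n q g base0 b cands i).2.1.2)
       (FVar (bchoose n q g base0 b cands i).2.2)) \in T').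
Proof.
elim: cands i T => [|[c1 d] cands IH] i T bT hcs /=.
  move=> /located_cons[l1 _].
  have := base_def bT l1 (isT : 0 < 1); rewrite addn0 /=; set e := (_ _).2 => h0.
  apply: (@deriv_cons _ _ _ _ _ rc _ (fun T' => FImp G (FImp (FVar i) (FVar e)) \in T')) => //.
  - rule [:: G; FVar i; FVar e] [:: FImp (FVar 0) (FIff (FVar 1) FBot)]
      (FImp (FVar 0) (FImp (FVar 1) (FVar 2))).
    + by taut.
    + by case: bT.
    + by rewrite /= G_le M_gt0.
    + by prems.
  - by rewrite mul1n leq_pmull //; lia.
move=> /located_cat[l1 /located_cat[l2 /located_cons[l3 /located_cat[l4 _]]]].
have [] := hcs (c1, d) (mem_head _ _).
move=> /= sc [h [ie [j [ld ej le]]]]; rewrite {}ej /= in ld le.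
have hcs' cd : cd \in cands -> size cd.1 = size base0 /\ checked cd.
  by move=> hin; apply: hcs; rewrite inE hin orbT.
rewrite mulSn; set W := _.+1 * _; set X := (2 * _ + 2 * _ + _ + _) * _.
apply: deriv_bind (IH i T bT hcs' l1) _ _; first by rewrite leq_addl.
rewrite addnK; move=> T1 lT1 sub1.
have bT1 := base_sub bT lT1 sub1; clear IH W.
have sr : size (bchoose n q g base0 b cands i).2.1.1 = size base0.
  by apply: size_choose => cd /hcs'[].
(* Budget of one step: the multiplexers under d and under not d, two copies of the test, and two
   rules. *)
have erc : X = size base0 * (2 * rc) + ((size b + size GS) * rc +
   ((size b + size GS) * rc + (rc + rc))) by rewrite /X; lia.
rewrite {}erc; clear X.
have [jr [ljr ejr]] := choose_log l1.
move: (bchoose n q g base0 b cands i) sr ljr ejr l1 l2 l3 l4 => r sr ljr ejr l1 l2 l3 l4 hr.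
have := base_def bT1 l3 (isT : 0 < 1); rewrite addn0 /= => hany.
set sel := mapb _ _ _ in l2 l3 l4 hany *.
set any := i + size r.1 + size sel.1 in l3 l4 hany *.
set E := bis_log _ _ _ _ _ _ in l4 *.
have hm : size c1 = size r.2.1.1 by rewrite sc sr.
have ssel : size sel.2 = size base0 by rewrite size_mapb size_zip sc sr minnn.
rewrite -{1}sc.
apply: deriv_bind (deriv_muxes bT1 hm l2) _ _; first by rewrite leq_addr.
rewrite addKn sc => T2 lT2 sub2 hsel; have bT2 := base_sub bT1 lT2 sub2.
apply: deriv_bind (deriv_log_copy (L := FVar d) bT2 _ l4 le _ _) _ _ => //.
- by rewrite ssel sc.
- by move=> k; rewrite ssel => lt; case: (hsel k lt).
- by rewrite leq_addr.
rewrite addKn => T3 lT3 sub3 he1; have bT3 := base_sub bT2 lT3 sub3.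
apply: deriv_bind (deriv_log_copy (L := FNot (FVar d)) bT3 _ l4 ljr _ _) _ _ => //.
- by rewrite ssel sr.
- by move=> k; rewrite ssel => lt; apply: sub3; case: (hsel k lt).
- by rewrite leq_addr.
rewrite addKn => T4 lT4 sub4; rewrite -ejr => he2.
have bT4 := base_sub bT3 lT4 sub4.
have := base_def bT4 ld (isT : 0 < 1); rewrite addn0 /= => hd.
have {}he1 := sub4 _ he1; rewrite /= -/E in he1 he2.
have {}hr := sub4 _ (sub3 _ (sub2 _ hr)).
have {}hany := sub4 _ (sub3 _ (sub2 _ hany)).
apply: (@deriv_bind _ _ _ _ _ rc _ (fun T' => FImp G (FImp (FVar d) (FVar E.2)) \in T')).
- rule [:: G; FVar d; FVar h; FVar (bis_log n q g c1 b ie).2; FVar E.2]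
    [:: FImp (FVar 0) (FIff (FVar 1) (FAnd (FVar 2) (FVar 3)));
        FImp (FAnd (FVar 0) (FVar 1)) (FIff (FVar 4) (FVar 3))]
    (FImp (FVar 0) (FImp (FVar 1) (FVar 4))).
  + by taut.
  + by rewrite /= G_le M_gt0.
  + by prems.
- exact: leq_addr.
rewrite addKn => T5 lT5 sub5 hdE.
have {}he2 := sub5 _ he2; have {}hr := sub5 _ hr; have {}hany := sub5 _ hany.
rule [:: G; FVar d; FVar any; FVar r.2.1.2; FVar E.2; FVar r.2.2]
  [:: FImp (FVar 0) (FIff (FVar 2) (FOr (FVar 1) (FVar 3)));
      FImp (FVar 0) (FImp (FVar 1) (FVar 4));
      FImp (FVar 0) (FImp (FVar 3) (FVar 5));
      FImp (FAnd (FVar 0) (FNot (FVar 1))) (FIff (FVar 4) (FVar 5))]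
  (FImp (FVar 0) (FImp (FVar 2) (FVar 4))).
+ by taut.
+ by rewrite /= G_le M_gt0.
+ by prems.
Qed.

End Choose.
End CircuitProofs.

(** * Substitution instances of circuit formulas *)

Lemma gate_eval_ext w e g : gate_below (size w) g ->
  gate_eval (w ++ e) g = gate_eval w g.
Proof.
by case: g => //= [a|a b|a b] => [ha|/andP[ha hb]|/andP[ha hb]];
  rewrite !nth_cat ha ?hb.
Qed.

(** Gates read earlier wires, whose values persist, so every defining equation holds in the final
    vector of wires. *)
Lemma nth_gates_evalE w gs t : gwf (size w) gs -> t < size gs ->
  nth false (gates_eval w gs) (size w + t) =
  gate_eval (gates_eval w gs) (nth GFalse gs t).
Proof.
elim: gs w t => [|g gs IH] w t //= wf; set w1 := rcons w _.
have s1 : size w1 = (size w).+1 by rewrite size_rcons.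
case: t => [_|t lt]; last first.
  rewrite addnS -addSn -s1; apply: IH => //.
  by rewrite s1 => u lu; have := wf u.+1; rewrite addnS -addSn; apply.
have gb : gate_below (size w) g by have := wf 0 isT; rewrite addn0.
rewrite addn0 nth_gates_eval ?s1 // nth_rcons ltnn eqxx /=.
have [e ->] := wext_gates_eval w1 gs.
by rewrite /w1 -cats1 -catA gate_eval_ext.
Qed.

Lemma fsubst_gate_def F X x g : x < size F -> gate_below x g ->
  fsubst (nth FBot (F ++ X)) (gate_def x g) = fsubst (nth FBot F) (gate_def x g).
Proof.
move=> lt gb; have e y : y <= x -> nth FBot (F ++ X) y = nth FBot F y.
  by move=> le; rewrite nth_cat ifT //; lia.
by case: g gb => [|a|a b|a b] /= => [_|h|/andP[h h']|/andP[h h']];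
  rewrite ?e // ltnW.
Qed.

#[local] Opaque bis_log bin_group.

Section Instance.
Variables (n : nat) (GS : seq gate).
Variables (Ax : pform -> Prop) (goal : pform) (c M : nat).
Variables (L : pform).

Notation G := (conj (gate_defs n GS)).
Notation H := (under n GS L).
Notation EF := (EF_lines Ax goal).
Notation derivable := (deriv Ax goal c M).
Notation rc := (rule_cost c).

(* F lists the formulas substituted for the wires, w the truth values assigned
   to them where they are constant. *)
Definition wire_known (T F : seq pform) (w : seq bool) (x : nat) : Prop :=
  FImp H (FIff (nth FBot F x) (cst (nth false w x))) \in T.

Definition gates_hold (T F : seq pform) (i : nat) (gs : seq gate) : Prop :=
  forall t, t < size gs ->
    FImp H (fsubst (nth FBot F) (gate_def (i + t) (nth GFalse gs t))) \in T.

Lemma holds_cat T F i a b :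
  gates_hold T F i a -> gates_hold T F (i + size a) b -> gates_hold T F i (a ++ b).
Proof.
move=> ha hb t; rewrite size_cat nth_cat => lt; case: ltnP => h; first exact: ha.
by have := hb (t - size a); rewrite -addnA subnKC //; apply; lia.
Qed.

Lemma holds_ext T T' F X i gs : {subset T <= T'} -> gwf i gs ->
  i + size gs <= size F -> gates_hold T F i gs -> gates_hold T' (F ++ X) i gs.
Proof.
move=> sub wf le h t lt; rewrite fsubst_gate_def; last exact: wf.
  by apply: sub; apply: h.
by lia.
Qed.

Lemma known_ext T T' F X w Y x : {subset T <= T'} -> x < size F -> size F = size w ->
  wire_known T F w x -> wire_known T' (F ++ X) (w ++ Y) x.
Proof. by move=> sub lt e h; rewrite /wire_known !nth_cat -e lt; apply: sub. Qed.

Lemma fsize_cst b : fsize (cst b) <= 2. Proof. by case: b. Qed.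

Hypotheses (hc : is_scheme_bound c) (M_gt : fsize (conj (gate_defs n GS)) + 20 <= M).
Hypothesis (sL : fsize L <= 10).

Let M_gt0 : 0 < M. Proof. by lia. Qed.
Let H_le : fsize H <= M. Proof. by rewrite /under /=; lia. Qed.
Let small2 A : fsize A <= 2 -> fsize A <= M. Proof. by lia. Qed.

Ltac rule l ps F :=
  apply: (@deriv_rule Ax goal c M hc M_gt0 (l : seq pform) (ps : seq pform) F) => //.

Ltac gate_rule A B con u v w :=
  rule [:: H; A; B]
    [:: FImp (FVar 0) (FIff (FVar 1) u); FImp (FVar 0) (FIff (FVar 2) v)]
    (FImp (FVar 0) (FIff w (con (FVar 1) (FVar 2))));
  [ by taut | by apply/and4P; split | by prems ].

Lemma deriv_const_gate T A B (u v : bool) : EF T -> fsize A <= M -> fsize B <= M ->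
  FImp H (FIff A (cst u)) \in T -> FImp H (FIff B (cst v)) \in T ->
  derivable T rc (fun T' => FImp H (FIff (cst (u && v)) (FAnd A B)) \in T') /\
  derivable T rc (fun T' => FImp H (FIff (cst (u || v)) (FOr A B)) \in T').
Proof.
move=> hT sA sB; case: u; case: v => hu hv; split.
- gate_rule A B FAnd (FNot FBot) (FNot FBot) (FNot FBot).
- gate_rule A B FOr (FNot FBot) (FNot FBot) (FNot FBot).
- gate_rule A B FAnd (FNot FBot) FBot FBot.
- gate_rule A B FOr (FNot FBot) FBot (FNot FBot).
- gate_rule A B FAnd FBot (FNot FBot) FBot.
- gate_rule A B FOr FBot (FNot FBot) (FNot FBot).
- gate_rule A B FAnd FBot FBot FBot.
- gate_rule A B FOr FBot FBot FBot.
Qed.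

(** Each new wire is replaced by the constant formula of its value; its substituted definition
    follows from the constants known at its inputs. Only wires in K and new wires are read, so F may
    contain non-constant formulas elsewhere. *)
Lemma deriv_const_segment T F w gs (K : nat -> Prop) :
  EF T -> size F = size w -> all (fun A => fsize A <= 2) F -> gwf (size w) gs ->
  Forall2 (grel (fun x y => x = y /\ (K x \/ size w <= x))) gs gs ->
  (forall x, K x -> x < size w -> wire_known T F w x) ->
  derivable T (size gs * (2 * rc)) (fun T' =>
    let w' := gates_eval w gs in
    let F' := F ++ map cst (drop (size w) w') in
    gates_hold T' F' (size w) gs /\
    forall t, t < size gs -> wire_known T' F' w' (size w + t)).
Proof.
move=> hT sF aF wf loc hK /=; set w' := gates_eval w gs; set F' := F ++ _.
have sw' : size w' = size w + size gs by rewrite size_gates_eval.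
have nF' x : size w <= x -> x < size w' -> nth FBot F' x = cst (nth false w' x).
  move=> le lt; rewrite nth_cat sF ltnNge le /= (nth_map false) ?size_drop; last by lia.
  by rewrite nth_drop subnKC.
have [e we] := wext_gates_eval w gs; rewrite -/w' in we.
have sF' x : fsize (nth FBot F' x) <= M.
  apply: small2; have aF' : all (fun A => fsize A <= 2) F'.
    by rewrite all_cat aF all_map; apply/allP => b _; apply: fsize_cst.
  have [lt|le] := ltnP x (size F'); last by rewrite nth_default.
  by move/(all_nthP FBot): aF'; apply.
have small b : fsize (cst b) <= M by apply: small2; apply: fsize_cst.
apply: deriv_bind (deriv_loop (A := fun t => FImp H (FIff (nth FBot F' (size w + t))
  (cst (nth false w' (size w + t))))) (N := size gs) (d := rc) hT _) _ _.
- move=> t T1 lt l1 _ _; rewrite nF'; [|by lia|by lia].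
  rule [:: H; cst (nth false w' (size w + t))] (@nil pform)
    (FImp (FVar 0) (FIff (FVar 1) (FVar 1))); first by taut.
  by rewrite /= H_le small.
- by lia.
move=> T1 l1 sub1 h1.
have -> : size gs * (2 * rc) - size gs * rc = size gs * rc by lia.
have kn x : x < size w' -> x = x /\ (K x \/ size w <= x) -> wire_known T1 F' w' x.
  move=> ltx [_ [hx|lex]]; last first.
    by have := h1 (x - size w); rewrite subnKC // => h; apply: h; lia.
  have [ltw|lew] := ltnP x (size w).
    rewrite /F' we; apply: known_ext (hK x hx ltw) => //; by rewrite sF.
  by have := h1 (x - size w); rewrite subnKC // => h; apply: h; lia.
apply: deriv_cons (deriv_loop (A := fun t => FImp H (fsubst (nth FBot F')
    (gate_def (size w + t) (nth GFalse gs t)))) (N := size gs) (d := rc) l1 _) _ _ => //.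
- move=> t T2 lt l2 sub2 _; rewrite /gate_def /= nF'; [|by lia|by lia].
  rewrite nth_gates_evalE // -/w'.
  have := Forall2_nth GFalse GFalse loc lt; have := wf t lt.
  case: (nth GFalse gs t) => [|a|a b|a b] /=.
  + move=> _ _; rule [:: H] (@nil pform) (FImp (FVar 0) (FIff FBot FBot)); first by taut.
    by rewrite /= H_le.
  + move=> la ha; have {}ha := sub2 _ (kn a (ltn_trans la _) ha).
    move: ha; rewrite sw' ltn_add2l => /(_ lt).
    case: (nth false w' a) => ha.
    * rule [:: H; nth FBot F' a] [:: FImp (FVar 0) (FIff (FVar 1) (cst true))]
        (FImp (FVar 0) (FIff (cst false) (FNot (FVar 1)))); first by taut.
      - by rewrite /= H_le sF'.
      - by prems.
    * rule [:: H; nth FBot F' a] [:: FImp (FVar 0) (FIff (FVar 1) (cst false))]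
        (FImp (FVar 0) (FIff (cst true) (FNot (FVar 1)))); first by taut.
      - by rewrite /= H_le sF'.
      - by prems.
  + move=> /andP[la lb] [ha hb].
    have la' : a < size w' by lia.
    have lb' : b < size w' by lia.
    have {}ha := sub2 _ (kn a la' ha); have {}hb := sub2 _ (kn b lb' hb).
    by have [] := deriv_const_gate l2 (sF' a) (sF' b) ha hb.
  + move=> /andP[la lb] [ha hb].
    have la' : a < size w' by lia.
    have lb' : b < size w' by lia.
    have {}ha := sub2 _ (kn a la' ha); have {}hb := sub2 _ (kn b lb' hb).
    by have [] := deriv_const_gate l2 (sF' a) (sF' b) ha hb.
- move=> T2 sub2 h2; split=> // t lt; apply: sub2; exact: h1.
Qed.

(** Here the new wires are replaced by variables of D so that each substituted definition is
    literally a gate definition of D, available from [base]. *)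
Lemma deriv_real_segment T F j gs gs2 : base n GS Ax goal T ->
  gwf (size F) gs -> located n GS j gs2 ->
  Forall2 (grel (fun x y => (x < size F /\ nth FBot F x = FVar y) \/
    (exists2 t, t < size gs & x = size F + t /\ y = j + t))) gs gs2 ->
  derivable T (size gs * rc)
    (fun T' => gates_hold T' (F ++ map FVar (iota j (size gs))) (size F) gs).
Proof.
move=> bT wf lj hg; set F' := F ++ _.
apply: (@deriv_loop _ _ _ _ (fun t => FImp H (fsubst (nth FBot F')
    (gate_def (size F + t) (nth GFalse gs t))))); first by case: bT.
move=> t T1 lt l1 sub1 _; have bT1 := base_sub bT l1 sub1.
have lt2 : t < size gs2 by rewrite -(Forall2_size hg).
have := base_def bT1 lj lt2.
have nF' x y : (x < size F /\ nth FBot F x = FVar y) \/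
    (exists2 t, t < size gs & x = size F + t /\ y = j + t) -> nth FBot F' x = FVar y.
  case=> [[ltx <-]|[u lu [-> ->]]]; first by rewrite nth_cat ltx.
  rewrite nth_cat ifF; last by lia.
  by rewrite addKn (nth_map 0) ?size_iota // nth_iota.
have -> : fsubst (nth FBot F') (gate_def (size F + t) (nth GFalse gs t)) =
    gate_def (j + t) (nth GFalse gs2 t).
  have := Forall2_nth GFalse GFalse hg lt.
  have e0 : nth FBot F' (size F + t) = FVar (j + t) by apply: nF'; right; exists t.
  case: (nth GFalse gs t) => [|a|a b|a b]; case: (nth GFalse gs2 t) => [|a'|a' b'|a' b'] //=;
    rewrite /gate_def /= e0 //.
  - by move=> /nF' ->.
  - by move=> [/nF' -> /nF' ->].
  - by move=> [/nF' -> /nF' ->].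
move=> hd; set A := gate_def _ _ in hd *.
have sA : fsize A <= M by apply: leq_trans (fsize_gate_def _ _) _; lia.
have G_le : fsize G <= M by lia.
have L_le : fsize L <= M by lia.
rule [:: G; L; A] [:: FImp (FVar 0) (FVar 2)] (FImp (FAnd (FVar 0) (FVar 1)) (FVar 2)).
- by taut.
- by rewrite /= G_le L_le sA.
- by prems.
Qed.

(** Detaches the output of an axiom instance: its premise is the conjunction of the substituted gate
    definitions, all of which are derived under H. *)
Lemma deriv_instance T F N (m : build nat) : EF T -> gates_hold T F N (m N).1 ->
  Ax (fsubst (nth FBot F) (circuit_form N m)) ->
  fsize (fsubst (nth FBot F) (circuit_form N m)) <= M ->
  derivable T ((size (m N).1 + 2) * rc + 1)
    (fun T' => FImp H (nth FBot F (m N).2) \in T').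
Proof.
rewrite circuit_formE; set gs := (m N).1; set o := (m N).2.
set Fs := gate_defs N gs; set s := nth FBot F => hT hh hA /= sM.
have sF : size Fs = size gs by rewrite size_gate_defs.
have fE Gs : fsubst s (conj Gs) = conj (map (fsubst s) Gs).
  by elim: Gs => //= A Gs ->.
have sdrop t : fsize (fsubst s (conj (drop t Fs))) <= M.
  rewrite fE map_drop; apply: leq_trans (fsize_conj_drop _ _) _.
  by rewrite -fE; lia.
(* The conjunction is assembled from its end; [A t] collects the last t definitions. *)
pose A t := FImp H (fsubst s (conj (drop (size gs - t) Fs))).
apply: deriv_bind (deriv_loop (A := A) (N := (size gs).+1) (d := rc) hT _) _ _.
- case=> [|t] T1 lt l1 sub1 hA1; rewrite /A.
    rewrite subn0 drop_oversize ?sF //.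
    rule [:: H] (@nil pform) (FImp (FVar 0) (FNot FBot)); first by taut.
    by rewrite /= H_le.
  have h1 := hA1 t (ltnSn t); rewrite /A in h1.
  have et : (size gs - t.+1).+1 = size gs - t by lia.
  have lt' : size gs - t.+1 < size gs by lia.
  have h0 := sub1 _ (hh _ lt').
  rewrite conj_drop ?sF // et nth_gate_defs //.
  rewrite (_ : forall A B, fsubst s (FAnd A B) = FAnd (fsubst s A) (fsubst s B)) //.
  move: (fsubst s (conj (drop (size gs - t) Fs))) (sdrop (size gs - t)) h1 => X sX h1.
  rewrite -/s in h0; have sA : fsize (fsubst s (gate_def (N + (size gs - t.+1))
      (nth GFalse gs (size gs - t.+1)))) <= M.
    have := sdrop (size gs - t.+1); rewrite conj_drop ?sF // nth_gate_defs //.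
    by move: (gate_def _ _) => Y /=; lia.
  move: (fsubst s (gate_def _ _)) sA h0 => Y sY h0.
  rule [:: H; Y; X] [:: FImp (FVar 0) (FVar 1); FImp (FVar 0) (FVar 2)]
    (FImp (FVar 0) (FAnd (FVar 1) (FVar 2))); first by taut.
  - by rewrite /= H_le sX sY.
  - by prems.
- by lia.
move=> T1 l1 sub1 h1.
have := h1 (size gs) (ltnSn _); rewrite /A subnn drop0 => hconj.
apply: deriv_bind (deriv_axiom (c := c) l1 hA _) _ _.
- by rewrite /line_size /=; nia.
- by lia.
move=> T2 l2 sub2 h2; have {}hconj := sub2 _ hconj.
change (is_true (FImp (fsubst s (conj Fs)) (s o) \in T2)) in h2.
have := sdrop 0; rewrite drop0 => s0.
move: (fsubst s (conj Fs)) s0 hconj h2 sM => X s0 hconj h2 sM.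
apply: (@deriv_cons _ _ _ _ _ rc _ (fun T' => FImp H (s o) \in T')) => //; last by lia.
rule [:: H; X; s o] [:: FImp (FVar 0) (FVar 1); FImp (FVar 1) (FVar 2)]
  (FImp (FVar 0) (FVar 2)); first by taut.
- by rewrite /= H_le s0; lia.
- by prems.
Qed.

End Instance.

(** * The instance of the axiom *)

Lemma bind_ge A (m : build A) (k : A -> build nat) j :
  (forall a i, i <= (k a i).2) -> j <= (bind m k j).2.
Proof. by move=> h; apply: leq_trans (h _ _); rewrite leq_addr. Qed.

(** An acceptance bit is a new wire of its own segment, so the value recorded for it can be
    prescribed along with that segment. *)
Lemma bD2_ge n q g s code b r j : j <= (bD2 n q g s code b r j).2.
Proof. by do 3 (apply: bind_ge => ? ?). Qed.

#[local] Opaque bis_log bin_group bD1 bD2 bcount bprob_ge bprob_ge_half.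

Lemma Forall2_diag (P : nat -> Prop) s :
  Forall2 (fun x y => x = y /\ P x) s s -> forall x, x \in s -> P x.
Proof.
elim: s => [|a s IH] h x //; inversion h as [|? ? ? ? [_ Pa] h'].
by rewrite inE => /orP[/eqP ->|] //; apply: IH.
Qed.

Lemma Forall2_diagI (P : nat -> Prop) s : (forall x, x \in s -> P x) ->
  Forall2 (fun x y => x = y /\ P x) s s.
Proof.
elim: s => [|a s IH] h; constructor; first by split=> //; apply: h; rewrite mem_head.
by apply: IH => x hx; apply: h; rewrite inE hx orbT.
Qed.

Definition bself (n q g s l : nat) (images : seq (seq bool)) (P b code : seq nat) :
    build nat :=
  let* d1 := mapb (fun x =>
      let* xs := bconsts x in bD1 n q g s code xs) images in
  let* d2 := mapb (fun x =>
      let* xs := bconsts x in bD2 n q g s code b xs) images in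
  let* c1 := bcount d1 in
  let* c2 := bcount d2 in
  let* prem := bprob_ge n l c1 P in
  let* inG := bin_group n q b in
  let* concl := bprob_ge_half n l c2 P in
  let* hyp := band prem inG in
  bimp hyp concl.

(** Cuts self_n into seven segments and three last gates, because they receive different kinds of
    substitution. *)
Lemma bself_shape (m1 m2 : build (seq nat)) (k3 : seq nat -> build (seq nat))
    (k5 k7 : seq nat -> build nat) (m6 : build nat) i1 :
  let r1 := m1 i1 in let i2 := i1 + size r1.1 in
  let r2 := m2 i2 in let i3 := i2 + size r2.1 in
  let r3 := k3 r1.2 i3 in let i4 := i3 + size r3.1 in
  let r4 := k3 r2.2 i4 in let i5 := i4 + size r4.1 in
  let r5 := k5 r3.2 i5 in let i6 := i5 + size r5.1 in
  let r6 := m6 i6 in let i7 := i6 + size r6.1 in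
  let r7 := k7 r4.2 i7 in let i8 := i7 + size r7.1 in
  let r := (let* d1 := m1 in let* d2 := m2 in let* c1 := k3 d1 in
    let* c2 := k3 d2 in let* prem := k5 c1 in let* inG := m6 in
    let* concl := k7 c2 in let* hyp := band prem inG in bimp hyp concl) i1 in
  [/\ r.1 = [:: ] ++ r1.1 ++ r2.1 ++ r3.1 ++ r4.1 ++ r5.1 ++ r6.1 ++ r7.1 ++
       [:: GAnd r5.2 r6.2; GNot i8; GOr (i8 + 1) r7.2],
      r.2 = i8 + 1 + 1 &
      size r.1 = size r1.1 + (size r2.1 + (size r3.1 + (size r4.1 +
        (size r5.1 + (size r6.1 + (size r7.1 + 3))))))].
Proof. by split=> //=; rewrite !size_cat. Qed.

Lemma hoare_image A B (m : build A) (m' : build B) p w s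
    (Q : seq bool -> A -> Prop) (Q' : seq bool -> B -> Prop) :
  (forall i, m' i = ((m i).1, p (m i).2)) -> hoare w m s Q ->
  (forall w' a, Q w' a -> Q' w' (p a)) -> hoare w m' s Q'.
Proof. by move=> e [h1 h2 h3] hQ; rewrite /hoare e; split=> //; apply: hQ. Qed.

Lemma hoare_bD2 n q g s w code cs b v r us : 1 < q -> q <= 2 ^ n -> g < q ->
  vals w code cs -> size cs = code_len n n s ->
  num w b n v -> vals w r us -> size us = n ->
  hoare w (bD2 n q g s code b r) (cost_D2 n s) (fun w' d => d < size w').
Proof.
move=> h1 h2 h3 hc sc hb hr sr.
apply: hoare_image (bD2_witnessE n q g s code b r)
  (hoare_D2 (s := s) h1 h2 h3 hc sc hb hr sr) _ => w' a [vc [d [_ /andP[lt _] _]]].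
exact: lt.
Qed.

Lemma mapb_ge A (h : A -> build nat) s i : (forall a j, j <= (h a j).2) ->
  forall x, x \in (mapb h s i).2 -> i <= x.
Proof.
move=> hh; elim: s i => [|a s IH] i x //=; rewrite inE => /orP[/eqP ->|/IH]; first exact: hh.
by lia.
Qed.

Definition accepted (n q g s : nat) (cs x : seq bool) : bool :=
  (0 < bits_val x < q) &&
  (g ^ bits_val (code_eval n n s cs x) %% q == bits_val x).

Section Tests.
Variables (n q g s : nat) (w : seq bool) (code : seq nat) (cs : seq bool).
Hypotheses (q_gt1 : 1 < q) (q_le : q <= 2 ^ n) (g_lt : g < q).
Hypotheses (hcode : vals w code cs) (cs_size : size cs = code_len n n s).
Variable images : seq (seq bool).
Hypothesis im_size : all (fun x => size x == n) images.

Lemma hoare_D1s :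
  hoare w (mapb (fun x => let* xs := bconsts x in bD1 n q g s code xs) images)
    ((2 * n + cost_D1 n s) * size images)
    (fun w' ts => vals w' ts (map (accepted n q g s cs) images)).
Proof.
apply: hoare_cons (@hoare_mapb _ _ w _ images (2 * n + cost_D1 n s)
  (fun w' x y => is_true (wval w' y (accepted n q g s cs x))) _ _) (leqnn _) _.
- by move=> ? ? ? ?; apply: wval_ext.
- move=> w' x e' /(allP im_size)/eqP sx.
  apply: hoare_bind (hoare_consts _ _) _ _; rewrite sx ?leq_addr //.
  move=> w2 xs e2 hx2; rewrite addKn.
  exact: hoare_D1 (vals_ext (wext_trans e' e2) hcode) cs_size hx2 sx.
- by move=> w' ts _; elim=> //= ? ? ? ? hh _ hh'; rewrite /vals /= hh.
Qed.

Lemma hoare_D2s b v : num w b n v ->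
  hoare w (mapb (fun x => let* xs := bconsts x in bD2 n q g s code b xs) images)
    ((2 * n + cost_D2 n s) * size images)
    (fun w' ts => size ts = size images /\ forall x, x \in ts -> x < size w').
Proof.
move=> hb; apply: hoare_cons (@hoare_mapb _ _ w _ images (2 * n + cost_D2 n s)
  (fun w' _ y => is_true (y < size w')) _ _) (leqnn _) _.
- by move=> ? ? ? ? [e ->]; rewrite size_cat => /ltn_addr; apply.
- move=> w' x e' /(allP im_size)/eqP sx.
  apply: hoare_bind (hoare_consts _ _) _ _; rewrite sx ?leq_addr //.
  move=> w2 xs e2 hx2; rewrite addKn.
  have e02 := wext_trans e' e2.
  exact: hoare_bD2 (vals_ext e02 hcode) cs_size (num_ext e02 hb) hx2 sx.
- move=> w' ts _ hf; split; first by rewrite (Forall2_size hf).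
  elim: hf => //= x y ? ? hh _ hh' z.
  by rewrite inE => /orP[/eqP ->|/hh'].
Qed.

End Tests.

(** * Deriving from self_n that b is outside the group if all candidates fail *)

Section SelfProof.
Variables (n : nat) (GS : seq gate).
Variables (Ax : pform -> Prop) (goal : pform) (c M : nat).
Hypotheses (hc : is_scheme_bound c) (M_gt : fsize (conj (gate_defs n GS)) + 20 <= M).
Variables (L : pform).
Hypothesis (sL : fsize L <= 10).

Notation H := (under n GS L).
Notation base := (base n GS Ax goal).
Notation derivable := (deriv Ax goal c M).
Notation rc := (rule_cost c).
Notation known := (wire_known n GS L).
Notation holds := (gates_hold n GS L).
Notation located := (located n GS).

Let M_gt0 : 0 < M. Proof. by lia. Qed.
Let H_le : fsize H <= M. Proof. by rewrite /under /=; lia. Qed.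

Ltac rule l ps F :=
  apply: (@deriv_rule Ax goal c M hc M_gt0 (l : seq pform) (ps : seq pform) F) => //.

(** The state of a substitution under construction. The size bound 2 on its formulas keeps the final
    instance linear in the size of self_n. *)
Definition inv (i : nat) (T F : seq pform) (w : seq bool) (gs : seq gate) : Prop :=
  [/\ base T, size F = size w, size w = i + size gs,
      all (fun A => fsize A <= 2) F & gwf i gs /\ holds T F i gs].

Definition is_new (ins : seq nat) (w : seq bool) (x : nat) : Prop :=
  x \in ins \/ size w <= x.

Lemma known_mono T T' F X w w' x : {subset T <= T'} -> size F = size w ->
  wext w w' -> x < size w -> known T F w x -> known T' (F ++ X) w' x.
Proof. by move=> sub sF [Y ->] lt; apply: known_ext => //; rewrite sF. Qed.

(** Parametricity for a restriction of equality yields locality: the segment reads only wires in ins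
    or new ones, so knowing the constants at ins is enough to evaluate it. *)
Lemma deriv_step_const i A (m : build A) (RA : A -> A -> Prop) T F w gs ins :
  inv i T F w gs -> gwf (size w) (m (size w)).1 ->
  relb (fun x y => x = y /\ is_new ins w x) RA m m ->
  (forall x, x \in ins -> x < size w -> known T F w x) ->
  RA (m (size w)).2 (m (size w)).2 /\
  derivable T (size (m (size w)).1 * (2 * rc)) (fun T' =>
    let w' := gates_eval w (m (size w)).1 in
    let F' := F ++ map cst (drop (size w) w') in
    inv i T' F' w' (gs ++ (m (size w)).1) /\
    forall x, is_new ins w x -> x < size w' -> known T' F' w' x).
Proof.
move=> [bT sF sw aF [wf hh]] wf' [rel] kn.
have [|loc res] := rel (size w) (size w).
  by move=> t _; split=> //; right; rewrite leq_addr.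
split=> //; move: (m (size w)).1 wf' loc => gs' wf' loc {rel res}.
apply: deriv_post (deriv_const_segment hc M_gt sL (K := fun x => x \in ins) _ sF aF wf' loc kn) _.
  by case: bT.
move=> T' lT' sub [h1 h2] /=; set w' := gates_eval w gs'; set F' := F ++ _ in h1 h2 *.
have sw' : size w' = size w + size gs' by rewrite size_gates_eval.
split.
  split.
  - exact: base_sub bT lT' sub.
  - by rewrite size_cat size_map size_drop sw' sF addKn.
  - by rewrite sw' sw size_cat addnA.
  - by rewrite all_cat aF all_map; apply/allP => b _; apply: fsize_cst.
  - split; first by apply: gwf_cat => //; rewrite -sw.
    apply: holds_cat; last by rewrite -sw.
    by apply: holds_ext hh => //; rewrite sF sw.
have new x : size w <= x -> x < size w' -> known T' F' w' x.
  by move=> le lt; have := h2 (x - size w); rewrite subnKC //; apply; lia.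
move=> x [hx|le] lt; last exact: new.
have [ltw|lew] := ltnP x (size w); last exact: new.
by apply: known_mono (kn x hx ltw) => //; apply: wext_gates_eval.
Qed.

Definition fwire (F : seq pform) (N j : nat) (x y : nat) : Prop :=
  (x < size F /\ nth FBot F x = FVar y) \/
  (exists2 t, t < N & x = size F + t /\ y = j + t).

(** The values false appended to w are placeholders; nothing is claimed here to be known about these
    wires. *)
Lemma deriv_step_real i j gs' gs2 T F w gs :
  inv i T F w gs -> gwf (size w) gs' -> located j gs2 ->
  Forall2 (grel (fwire F (size gs') j)) gs' gs2 ->
  derivable T (size gs' * (2 * rc)) (fun T' =>
    inv i T' (F ++ map FVar (iota j (size gs'))) (w ++ nseq (size gs') false)
      (gs ++ gs')).
Proof.
move=> [bT sF sw aF [wf hh]] wf' lj hg.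
have le : size gs' * rc <= size gs' * (2 * rc) by rewrite leq_mul2l leq_pmull ?orbT.
rewrite -sF in wf'.
apply: deriv_cons (deriv_post (deriv_real_segment hc M_gt sL bT wf' lj hg) _) le
  (fun _ _ => id).
move=> T' lT' sub h1; split.
- exact: base_sub bT lT' sub.
- by rewrite !size_cat size_map size_iota size_nseq sF.
- by rewrite !size_cat size_nseq sw addnA.
- by rewrite all_cat aF all_map; apply/allP.
- split; first by apply: gwf_cat => //; rewrite -sw -sF.
  apply: holds_cat; last by rewrite -sw -sF.
  by apply: holds_ext hh => //; rewrite sF sw.
Qed.

Variables (q g s l vP : nat) (images : seq (seq bool)) (cs : seq bool).
Variable code : seq nat.
Hypotheses (q_gt1 : 1 < q) (q_le : q <= 2 ^ n) (g_lt : g < q) (vP_lt : vP < 2 ^ n).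
Hypotheses (im_size : all (fun x => size x == n) images).
Hypotheses (cs_size : size cs = code_len n n s) (code_size : size code = size cs).

Hypotheses (prem_true : 2 ^ l * vP <= 2 ^ n * count (accepted n q g s cs) images)
  (concl_false : ~~ (2 ^ l * (n * vP) <= 2 ^ (l + n) * 3)).

Let N := n + n + code_len n n s.
Let P0 := iota 0 n.
Let b0 := iota n n.
Let code0 := iota (n + n) (code_len n n s).
Let b := iota 0 n.
Let m := bself n q g s l images P0 b0 code0.

(** The substitution for the inputs of self_n: the bits of p become constants, those of b the input
    variables of D, and the code bits the constant wires of D. In [w0] the values at b are
    placeholders. *)
Let F0 : seq pform := map cst (bits n vP) ++ map FVar b ++ map FVar code.
Let w0 : seq bool := bits n vP ++ nseq n false ++ cs.

Lemma size_start : size F0 = size w0 /\ size w0 = N.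
Proof.
rewrite /F0 /w0 /N !size_cat !size_map !size_iota ?size_bits size_nseq code_size.
by rewrite cs_size addnA.
Qed.

Lemma vals_start : [/\ vals w0 P0 (bits n vP), vals w0 b0 (nseq n false) & vals w0 code0 cs].
Proof.
rewrite /w0; split.
- have := @vals_iota (bits n vP ++ nseq n false ++ cs) 0 (bits n vP).
  rewrite size_bits !size_cat size_bits leq_addr; apply=> // t lt.
  by rewrite add0n nth_cat size_bits lt.
- have := @vals_iota (bits n vP ++ nseq n false ++ cs) n (nseq n false).
  rewrite size_nseq !size_cat size_bits size_nseq addnA leq_addr; apply=> // t lt.
  rewrite nth_cat size_bits ltnNge leq_addr /= addKn nth_cat size_nseq lt //.
- rewrite /code0 -cs_size; apply: vals_iota.
    by rewrite !size_cat size_bits size_nseq; lia.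
  move=> t lt; rewrite nth_cat size_bits -addnA ltnNge leq_addr /= addKn.
  by rewrite nth_cat size_nseq ltnNge leq_addr /= addKn.
Qed.

Lemma nth_start_b t : t < n -> nth FBot F0 (n + t) = FVar t.
Proof.
move=> lt; rewrite /F0 nth_cat size_map size_bits ltnNge leq_addr /= addKn.
by rewrite nth_cat size_map size_iota lt (nth_map 0) ?size_iota // nth_iota.
Qed.

Lemma nth_start_code t : t < size cs -> nth FBot F0 (n + n + t) = FVar (nth 0 code t).
Proof.
move=> lt; rewrite /F0 nth_cat size_map size_bits -addnA ltnNge leq_addr /= addKn.
rewrite nth_cat size_map size_iota ltnNge leq_addr /= addKn.
by rewrite (nth_map 0) // code_size.
Qed.

Lemma deriv_start T : base T ->
  (forall t, t < size cs -> FImp (conj (gate_defs n GS))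
     (FIff (FVar (nth 0 code t)) (cst (nth false cs t))) \in T) ->
  derivable T (N * rc) (fun T' => inv N T' F0 w0 [::] /\
    forall x, x \in P0 ++ code0 -> known T' F0 w0 x).
Proof.
move=> bT hcode; have [sF sw] := size_start.
have small b' : fsize (cst b') <= M by apply: leq_trans (fsize_cst _) _; lia.
have G_le : fsize (conj (gate_defs n GS)) <= M by lia.
have L_le : fsize L <= M by lia.
(* The trivial [FImp H H] at the positions of b lets one loop run over all inputs. *)
pose A x := if x \in P0 ++ code0 then
    FImp H (FIff (nth FBot F0 x) (cst (nth false w0 x)))
  else FImp H H.
apply: deriv_post (deriv_loop (A := A) (N := N) (d := rc) _ _) _.
- by case: bT.
- move=> x T1 lt l1 sub1 _; rewrite /A; case: ifP => hx; last first.
    rule [:: H] (@nil pform) (FImp (FVar 0) (FVar 0)); first by taut.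
    by rewrite /= H_le.
  move: hx; rewrite mem_cat !mem_iota add0n /= => /orP[ltn|/andP[le lt']].
    rewrite /F0 /w0 !nth_cat size_map size_bits ltn (nth_map false) ?size_bits //.
    rule [:: H; cst (nth false (bits n vP) x)] (@nil pform)
      (FImp (FVar 0) (FIff (FVar 1) (FVar 1))); first by taut.
    by rewrite /= H_le small.
  have ltc : x - (n + n) < size cs by rewrite cs_size; lia.
  have := nth_start_code ltc; rewrite subnKC // => ->.
  have -> : nth false w0 x = nth false cs (x - (n + n)).
    rewrite /w0 !nth_cat size_bits size_nseq ifF; last by lia.
    by rewrite ifF; [congr (nth _ _ _); lia | lia].
  have h := sub1 _ (hcode _ ltc).
  rule [:: conj (gate_defs n GS); L; FVar (nth 0 code (x - (n + n)));
      cst (nth false cs (x - (n + n)))]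
    [:: FImp (FVar 0) (FIff (FVar 2) (FVar 3))]
    (FImp (FAnd (FVar 0) (FVar 1)) (FIff (FVar 2) (FVar 3))); first by taut.
  - by rewrite /= G_le L_le small M_gt0.
  - by prems.
move=> T' l' sub h; split; last first.
  move=> x hx; have := h x; rewrite /A hx; apply.
  by move: hx; rewrite mem_cat !mem_iota /N; lia.
split=> //; first exact: base_sub bT l' sub.
- by rewrite addn0.
- rewrite /F0 !all_cat !all_map; apply/and3P; split; apply/allP => //.
  by move=> b' _; apply: fsize_cst.
Qed.

Definition sle (T F : seq pform) (w : seq bool) (T' F' : seq pform)
    (w' : seq bool) : Prop :=
  [/\ {subset T <= T'}, exists X, F' = F ++ X & wext w w'].

Lemma sle_trans T1 F1 w1 T2 F2 w2 T3 F3 w3 :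
  sle T1 F1 w1 T2 F2 w2 -> sle T2 F2 w2 T3 F3 w3 -> sle T1 F1 w1 T3 F3 w3.
Proof.
move=> [s1 [X1 e1] w12] [s2 [X2 e2] w23]; split.
- by move=> A /s1/s2.
- by exists (X1 ++ X2); rewrite e2 e1 catA.
- exact: wext_trans w12 w23.
Qed.

Lemma sle_known T F w T' F' w' x : sle T F w T' F' w' -> size F = size w ->
  x < size w -> known T F w x -> known T' F' w' x.
Proof. by move=> [sub [X ->] we] sF lt; apply: known_mono. Qed.

Lemma sle_nth T F w T' F' w' x : sle T F w T' F' w' -> x < size F ->
  nth FBot F' x = nth FBot F x.
Proof. by move=> [_ [X ->] _] lt; rewrite nth_cat lt. Qed.

Lemma vals_range w xs bs x : vals w xs bs -> x \in xs -> x < size w.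
Proof.
elim: xs bs => [|y xs IH] [|b' bs] //= /andP[/andP[lt _] h].
by rewrite inE => /orP[/eqP ->|/IH] //; apply; apply: h.
Qed.

Lemma num_range w xs k v x : num w xs k v -> x \in xs -> x < size w.
Proof. by move=> [bs [h _ _]]; apply: vals_range h. Qed.

(** * The argument for abstract segments of self_n *)

Section Abstract.
Variables (m1 m2 m2' : build (seq nat)) (k3 : seq nat -> build (seq nat)).
Variables (k5 k7 : seq nat -> build nat) (m6 m6' : build nat) (bs1 : seq bool) (Z : nat).
Notation Hoare w m Q := (exists s, hoare w m s Q).
Hypotheses (h1 : Hoare w0 m1 (fun w' xs => vals w' xs bs1))
  (rel1 : forall R, Forall2 R code0 code0 -> relb R (Forall2 R) m1 m1)
  (h2 : forall w, wext w0 w ->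
     Hoare w m2 (fun w' xs => forall x, x \in xs -> x < size w'))
  (ge2 : forall i x, x \in (m2 i).2 -> i <= x)
  (sz2 : forall i, size (m2 i).2 = Z)
  (rel2 : forall R, Forall2 R code0 code -> Forall2 R b0 b ->
     relb R (Forall2 R) m2 m2')
  (h3 : forall w xs bs, vals w xs bs ->
     Hoare w (k3 xs) (fun w' ys => exists k, num w' ys k (count id bs)))
  (rel3 : forall R xs, Forall2 R xs xs -> relb R (Forall2 R) (k3 xs) (k3 xs))
  (h5 : forall w xs k, num w xs k (count id bs1) -> num w P0 n vP ->
     Hoare w (k5 xs) (fun w' x => wval w' x true))
  (rel5 : forall R xs, Forall2 R xs xs -> Forall2 R P0 P0 -> relb R R (k5 xs) (k5 xs))
  (h6 : forall w, wext w0 w -> Hoare w m6 (fun w' x => x < size w'))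
  (rel6 : forall R, Forall2 R b0 b -> relb R R m6 m6')
  (h7 : forall w xs k, num w xs k 0 -> num w P0 n vP ->
     Hoare w (k7 xs) (fun w' x => wval w' x false))
  (rel7 : forall R xs, Forall2 R xs xs -> Forall2 R P0 P0 -> relb R R (k7 xs) (k7 xs)).

Let mm : build nat :=
  let* d1 := m1 in let* d2 := m2 in let* c1 := k3 d1 in
  let* c2 := k3 d2 in let* prem := k5 c1 in let* inG := m6 in
  let* concl := k7 c2 in let* hyp := band prem inG in bimp hyp concl.

Lemma known_results w (xs ins : seq nat) w' F' T' x :
  Forall2 (fun x y => x = y /\ is_new ins w x) xs xs ->
  (forall x, is_new ins w x -> x < size w' -> known T' F' w' x) ->
  x \in xs -> x < size w' -> known T' F' w' x.
Proof. by move=> /Forall2_diag hx h /hx; apply: h. Qed.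

(** The D2 tests [m2] and the membership test [m6] become copies of wires of D; all other segments
    are constant. The premise evaluates to true and, the D2 bits being false under H, the conclusion
    to false. What remains of the axiom is the negation of the membership bit of b. *)
Lemma deriv_self_abs T j2 j6 : inv (size w0) T F0 w0 [::] ->
  (forall x, x \in P0 ++ code0 -> known T F0 w0 x) ->
  located j2 (m2' j2).1 ->
  (forall d, d \in (m2' j2).2 -> FImp H (FIff (FVar d) FBot) \in T) ->
  located j6 (m6' j6).1 ->
  (forall sigma, Ax (fsubst sigma (circuit_form (size w0) mm))) ->
  24 * size (mm (size w0)).1 + 10 <= M ->
  derivable T ((15 * size (mm (size w0)).1 + 7) * rc)
    (fun T' => FImp H (FNot (FVar (m6' j6).2)) \in T').
Proof.
move=> inv0 kn0 lj2 hD2 lj6 hAx sM.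
have le2M : 2 <= M by lia.
(* Size of the instance: a formula of size at most 12 S + 4, for S gates, whose variables are
   replaced by formulas of size at most 2. *)
have finM x : x <= 12 * size (mm (size w0)).1 + 2 -> (x + 1).+1 * 2 <= M by lia.
have [_ sF0 _ _ _] := inv0; have [vP0 vb0 vc0] := vals_start.
have nP0 : num w0 P0 n vP.
  by have := vals_num vP0; rewrite size_bits bits_valK.
have := bself_shape m1 m2 k3 k5 k7 m6 (size w0); cbv zeta; rewrite -/mm.
set r1 := m1 (size w0); set i2 := size w0 + size r1.1.
set r2 := m2 i2; set i3 := i2 + size r2.1.
set r3 := k3 r1.2 i3; set i4 := i3 + size r3.1.
set r4 := k3 r2.2 i4; set i5 := i4 + size r4.1.
set r5 := k5 r3.2 i5; set i6 := i5 + size r5.1.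
set r6 := m6 i6; set i7 := i6 + size r6.1.
set r7 := k7 r4.2 i7; set i8 := i7 + size r7.1.
case=> eg eo; set S := size (mm (size w0)).1 in sM * => eS.
pose B := S * (2 * rc).
have leB k : k <= S -> k * (2 * rc) <= B by move=> h; rewrite leq_mul2r h orbT.
have [le1 le2 le3] : [/\ size r1.1 <= S, size r2.1 <= S & size r3.1 <= S].
  by rewrite eS; split; lia.
have [le4 le5 le6 le7] : [/\ size r4.1 <= S, size r5.1 <= S, size r6.1 <= S &
    size r7.1 <= S] by rewrite eS; split; lia.
(* Seven segments at two rules per gate, the three last gates, and the detachment of the axiom; the
   term 2 * rc - 1 is slack. *)
have -> : (15 * S + 7) * rc = B + (B + (B + (B + (B + (B + (B +
    (3 * rc + ((S + 2) * rc + 1 + (2 * rc - 1))))))))).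
  by rewrite /B /rule_cost; lia.
move eX : (3 * rc + _) => X.
have [s1 [wf1 _ v1]] := h1.
have [] := deriv_step_const (ins := code0) inv0 wf1 (rel1 _) _.
- apply: Forall2_diagI => x hx; exact: or_introl.
- by move=> x hx _; apply: kn0; rewrite mem_cat hx orbT.
rewrite -/r1 => RA1 D1.
set w1 := gates_eval w0 r1.1 in v1; set F1 := F0 ++ map cst (drop (size w0) w1).
have sw1 : size w1 = i2 by rewrite size_gates_eval.
apply: deriv_bind (deriv_cons D1 (leB _ le1) (fun _ _ => id)) (leq_addr _ _) _.
rewrite addKn.
move=> T1 lT1 sub1 [inv1 kn1]; rewrite -/w1 -/F1 in inv1 kn1; clear D1.
have sle1 : sle T F0 w0 T1 F1 w1.
  by split=> //; [exists (map cst (drop (size w0) w1)) | apply: wext_gates_eval].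
have [bT1 sF1 _ _ _] := inv1.
have we01 : wext w0 w1 by case: sle1.
have [s2 [wf2 _ v2]] := h2 we01.
rewrite sw1 -/r2 in wf2 v2.
have Fb0 (Fk : seq pform) Tk wk N' j : sle T F0 w0 Tk Fk wk ->
    Forall2 (fwire Fk N' j) b0 b.
  move=> lek; apply: (@Forall2_nthI _ _ _ 0 0); first by rewrite !size_iota.
  move=> t; rewrite size_iota => lt; rewrite !nth_iota // add0n; left.
  have ltF : n + t < size F0 by rewrite sF0 (size_start).2 /N; lia.
  rewrite (sle_nth lek) // nth_start_b //; split=> //.
  by case: lek => _ [Y ->] _; rewrite size_cat; lia.
have [||| grel2 RA2] := relbP (rel2 (R := fwire F1 (size r2.1) j2) _ _) (i := i2) (j := j2).
- apply: (@Forall2_nthI _ _ _ 0 0); first by rewrite size_iota code_size cs_size.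
  move=> t; rewrite size_iota => lt; rewrite nth_iota //; left.
  have ltF : n + n + t < size F0 by rewrite sF0 (size_start).2 /N; lia.
  rewrite (sle_nth sle1) // nth_start_code ?cs_size //; split=> //.
  by rewrite size_cat; lia.
- exact: Fb0 sle1.
- by move=> t lt; right; exists t => //; rewrite sF1 sw1.
rewrite -/r2 in grel2 RA2; rewrite -sw1 in wf2.
apply: deriv_bind (deriv_cons (deriv_step_real inv1 wf2 lj2 grel2) (leB _ le2)
  (fun _ _ => id)) (leq_addr _ _) _.
rewrite addKn.
set F2 := F1 ++ _; set w2 := w1 ++ _; move=> T2 lT2 sub2 inv2.
have sle12 : sle T1 F1 w1 T2 F2 w2.
  by split=> //; [exists (map FVar (iota j2 (size r2.1))) | exists (nseq (size r2.1) false)].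
have sle2 := sle_trans sle1 sle12.
have [bT2 sF2 _ _ _] := inv2.
have sw2 : size w2 = i3 by rewrite size_cat size_nseq sw1.
have ltd2 x : x \in r2.2 -> x < size w2.
  by move/v2; rewrite size_gates_eval sw2 sw1.
(* At the acceptance bits the placeholder false is the right value: under H each of them is
   equivalent to false, which [kd2] then records. *)
have vald2 x : x \in r2.2 -> nth false w2 x = false.
  move=> hx; have := ge2 hx; rewrite -/i2 => le.
  by rewrite nth_cat sw1 ltnNge le /= nth_nseq if_same.
have vd2 : vals w2 r2.2 (nseq Z false).
  rewrite -(sz2 i2) -/r2; move: (r2.2) ltd2 vald2 => xs.
  elim: xs => [|x xs IH] //= lt vl; rewrite /vals /= /wval lt ?mem_head // vl ?mem_head //=.
  by apply: IH => y hy; [apply: lt | apply: vl]; rewrite inE hy orbT.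
have kd2 x : x \in r2.2 -> known T2 F2 w2 x.
  move=> hx; rewrite /wire_known vald2 //.
  have [t lt et] : exists2 t, t < size r2.2 & nth 0 r2.2 t = x by apply/nthP.
  have := Forall2_nth 0 0 RA2 lt; rewrite et => hR.
  have sz : size r2.2 = size (m2' j2).2 := Forall2_size RA2.
  have hd : FImp H (FIff (FVar (nth 0 (m2' j2).2 t)) FBot) \in T2.
    by case: sle2 => sub _ _; apply: sub; apply: hD2; rewrite mem_nth // -sz.
  suff -> : nth FBot F2 x = FVar (nth 0 (m2' j2).2 t) by [].
  case: hR => [[ltx <-]|[u lu [-> ->]]]; first by rewrite nth_cat ltx.
  rewrite nth_cat ifF; last by apply: negbTE; rewrite -leqNgt leq_addr.
  by rewrite addKn (nth_map 0) ?size_iota // nth_iota.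
have v1' : vals w2 r1.2 bs1 by apply: vals_ext v1; case: sle12.
have [s3 [wf3 _ [kk3 n3]]] := h3 v1'.
have [] := deriv_step_const (ins := r1.2) inv2 wf3 (rel3 _) _.
- apply: Forall2_diagI => x hx; exact: or_introl.
- move=> x hx _; have lt := vals_range v1 hx.
  exact: (sle_known sle12 sF1 lt (known_results RA1 kn1 hx lt)).
rewrite sw2 -/r3 in n3 * => RA3 D3.
set w3 := gates_eval w2 r3.1 in n3 *; set F3 := F2 ++ map cst (drop (size w2) w3).
have sw3 : size w3 = i4 by rewrite size_gates_eval sw2.
apply: deriv_bind (deriv_cons D3 (leB _ le3) (fun _ _ => id)) (leq_addr _ _) _.
rewrite addKn.
rewrite -sw2 -/F3 => T3 lT3 sub3 [inv3 kn3]; clear D3.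
have sle23 : sle T2 F2 w2 T3 F3 w3.
  by split=> //; [exists (map cst (drop (size w2) w3)) | apply: wext_gates_eval].
have sle3 := sle_trans sle2 sle23.
have [bT3 sF3 _ _ _] := inv3.
have vd2' : vals w3 r2.2 (nseq Z false) by apply: vals_ext vd2; case: sle23.
have [s4 [wf4 _ [kk4 n4]]] := h3 vd2'.
have [] := deriv_step_const (ins := r2.2) inv3 wf4 (rel3 _) _.
- apply: Forall2_diagI => x hx; exact: or_introl.
- move=> x hx _; exact: (sle_known sle23 sF2 (ltd2 x hx) (kd2 x hx)).
rewrite sw3 -/r4 in n4 * => RA4 D4.
set w4 := gates_eval w3 r4.1 in n4 *; set F4 := F3 ++ map cst (drop (size w3) w4).
have sw4 : size w4 = i5 by rewrite size_gates_eval sw3.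
apply: deriv_bind (deriv_cons D4 (leB _ le4) (fun _ _ => id)) (leq_addr _ _) _.
rewrite addKn -sw3 -/F4 => T4 lT4 sub4 [inv4 kn4]; clear D4.
have sle34 : sle T3 F3 w3 T4 F4 w4.
  by split=> //; [exists (map cst (drop (size w3) w4)) | apply: wext_gates_eval].
have sle4 := sle_trans sle3 sle34.
have [bT4 sF4 _ _ _] := inv4.
have {}n4 : num w4 r4.2 kk4 0 by move: n4; rewrite count_nseq.
have knP (Tk Fk : seq pform) wk x : sle T F0 w0 Tk Fk wk -> x \in P0 -> known Tk Fk wk x.
  move=> lek hx; apply: (sle_known lek sF0 (vals_range vP0 hx)).
  by apply: kn0; rewrite mem_cat hx.
have nPk (Tk Fk : seq pform) wk : sle T F0 w0 Tk Fk wk -> num wk P0 n vP.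
  by case=> _ _ we; apply: num_ext nP0.
have n3' : num w4 r3.2 kk3 (count id bs1) by apply: num_ext n3; case: sle34.
have [s5 [wf5 _ v5]] := h5 n3' (nPk _ _ _ sle4).
have [] := deriv_step_const (ins := r3.2 ++ P0) inv4 wf5 (rel5 _ _) _.
- by apply: Forall2_diagI => x hx; left; rewrite mem_cat hx.
- by apply: Forall2_diagI => x hx; left; rewrite mem_cat hx orbT.
- move=> x; rewrite mem_cat => /orP[hx|hx] _; last exact: knP sle4 hx.
  have lt := num_range n3 hx.
  exact: (sle_known sle34 sF3 lt (known_results RA3 kn3 hx lt)).
rewrite sw4 -/r5 in v5 * => RA5 D5.
set w5 := gates_eval w4 r5.1 in v5 *; set F5 := F4 ++ map cst (drop (size w4) w5).
have sw5 : size w5 = i6 by rewrite size_gates_eval sw4.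
apply: deriv_bind (deriv_cons D5 (leB _ le5) (fun _ _ => id)) (leq_addr _ _) _.
rewrite addKn -sw4 -/F5 => T5 lT5 sub5 [inv5 kn5]; clear D5.
have sle45 : sle T4 F4 w4 T5 F5 w5.
  by split=> //; [exists (map cst (drop (size w4) w5)) | apply: wext_gates_eval].
have sle5 := sle_trans sle4 sle45.
have [bT5 sF5 _ _ _] := inv5.
have lt5 : r5.2 < size w5 by case/andP: v5.
have k5r : FImp H (FIff (nth FBot F5 r5.2) (FNot FBot)) \in T5.
  have := kn5 _ RA5.2 lt5; rewrite /wire_known.
  by case/andP: v5 => _ /eqP ->.
have we05 : wext w0 w5 by case: sle5.
have [s6 [wf6 _ v6]] := h6 we05.
rewrite sw5 -/r6 in wf6 v6.
have [||grel6 RA6] := relbP (rel6 (R := fwire F5 (size r6.1) j6) _) (i := i6) (j := j6).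
- exact: Fb0 sle5.
- by move=> t lt; right; exists t => //; rewrite sF5 sw5.
rewrite -/r6 in grel6 RA6; rewrite -sw5 in wf6.
apply: deriv_bind (deriv_cons (deriv_step_real inv5 wf6 lj6 grel6) (leB _ le6)
  (fun _ _ => id)) (leq_addr _ _) _.
rewrite addKn; set F6 := F5 ++ _; set w6 := w5 ++ _; move=> T6 lT6 sub6 inv6.
have sle56 : sle T5 F5 w5 T6 F6 w6.
  by split=> //; [exists (map FVar (iota j6 (size r6.1))) | exists (nseq (size r6.1) false)].
have sle6 := sle_trans sle5 sle56.
have [bT6 sF6 _ _ _] := inv6.
have sw6 : size w6 = i7 by rewrite size_cat size_nseq sw5.
have lt6 : r6.2 < size w6 by move: v6; rewrite size_gates_eval sw5 sw6.
have nF6 : nth FBot F6 r6.2 = FVar (m6' j6).2.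
  case: RA6 => [[ltx <-]|[u lu [-> ->]]]; first by rewrite nth_cat ltx.
  rewrite nth_cat ifF; last by apply: negbTE; rewrite -leqNgt leq_addr.
  by rewrite addKn (nth_map 0) ?size_iota // nth_iota.
have sle46 := sle_trans sle45 sle56.
have n4' : num w6 r4.2 kk4 0 by apply: num_ext n4; case: sle46.
have [s7 [wf7 _ v7]] := h7 n4' (nPk _ _ _ sle6).
have [] := deriv_step_const (ins := r4.2 ++ P0) inv6 wf7 (rel7 _ _) _.
- by apply: Forall2_diagI => x hx; left; rewrite mem_cat hx.
- by apply: Forall2_diagI => x hx; left; rewrite mem_cat hx orbT.
- move=> x; rewrite mem_cat => /orP[hx|hx] _; last exact: knP sle6 hx.
  have lt := num_range n4 hx.
  exact: (sle_known sle46 sF4 lt (known_results RA4 kn4 hx lt)).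
rewrite sw6 -/r7 in v7 * => RA7 D7.
set w7 := gates_eval w6 r7.1 in v7 *; set F7 := F6 ++ map cst (drop (size w6) w7).
have sw7 : size w7 = i8 by rewrite size_gates_eval sw6.
apply: deriv_bind (deriv_cons D7 (leB _ le7) (fun _ _ => id)) (leq_addr _ _) _.
rewrite addKn -sw6 -/F7 => T7 lT7 sub7 [inv7 kn7]; clear D7.
have sle67 : sle T6 F6 w6 T7 F7 w7.
  by split=> //; [exists (map cst (drop (size w6) w7)) | apply: wext_gates_eval].
have sle7 := sle_trans sle6 sle67.
have [bT7 sF7 swg aF7 [wf7g hh7]] := inv7.
have lt7 : r7.2 < size w7 by case/andP: v7.
have k7r : FImp H (FIff (nth FBot F7 r7.2) FBot) \in T7.
  have := kn7 _ RA7.2 lt7; rewrite /wire_known.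
  by case/andP: v7 => _ /eqP ->.
set h := (m6' j6).2 in nF6 *.
set lastg := [:: GAnd _ _; _; _] in eg.
(* With a true premise the conjunction of premise and membership is h, its negation is not h, and
   with a false conclusion the final disjunction is not h as well. *)
pose F8 := F7 ++ [:: FVar h; FNot (FVar h); FNot (FVar h)].
have sle57 := sle_trans sle56 sle67.
have n5 : nth FBot F8 r5.2 = nth FBot F5 r5.2.
  by rewrite nth_cat ifT ?(sle_nth sle57) ?sF5 //; case: sle57 => _ [Y ->] _;
     rewrite size_cat ltn_addr // sF5.
have n6 : nth FBot F8 r6.2 = FVar h.
  by rewrite nth_cat ifT ?(sle_nth sle67) ?sF6 //; case: sle67 => _ [Y ->] _;
     rewrite size_cat ltn_addr // sF6.
have n7 : nth FBot F8 r7.2 = nth FBot F7 r7.2 by rewrite nth_cat sF7 lt7.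
have s8 : size F7 = i8 by rewrite sF7 sw7.
have n8 t : nth FBot F8 (i8 + t) = nth FBot [:: FVar h; FNot (FVar h); FNot (FVar h)] t.
  by rewrite nth_cat s8 ltnNge leq_addr /= addKn.
have k5r' : FImp H (FIff (nth FBot F5 r5.2) (FNot FBot)) \in T7.
  by case: sle57 => sub _ _; apply: sub.
have small2 (A : pform) : fsize A <= 2 -> fsize A <= M by move=> h'; apply: leq_trans h' le2M.
have aF7' x : fsize (nth FBot F7 x) <= M.
  apply: small2; have [lt|le] := ltnP x (size F7); last by rewrite nth_default.
  by move/(all_nthP FBot): aF7; apply.
have aF5' : fsize (nth FBot F5 r5.2) <= M.
  by have := aF7' r5.2; rewrite (sle_nth sle57) ?sF5.
have hlast : derivable T7 (3 * rc) (fun T' => holds T' F8 i8 lastg).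
  apply: (@deriv_loop _ _ _ _ (fun t => FImp H (fsubst (nth FBot F8)
    (gate_def (i8 + t) (nth GFalse lastg t)))) 3 rc) => //.
  case=> [|[|[|//]]] T' _ lT' sub' _; rewrite /gate_def /=.
  - rewrite n8 n5 n6 /=; have {}k5r' := sub' _ k5r'.
    rule [:: H; FVar h; nth FBot F5 r5.2] [:: FImp (FVar 0) (FIff (FVar 2) (FNot FBot))]
      (FImp (FVar 0) (FIff (FVar 1) (FAnd (FVar 2) (FVar 1)))); first by taut.
    + by rewrite /= H_le M_gt0 aF5'.
    + by prems.
  - rewrite n8 -[i8]addn0 n8 /=.
    rule [:: H; FVar h] (@nil pform)
      (FImp (FVar 0) (FIff (FNot (FVar 1)) (FNot (FVar 1)))); first by taut.
    by rewrite /= H_le M_gt0.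
  - rewrite !n8 n7 /=; have {}k7r := sub' _ k7r.
    rule [:: H; FVar h; nth FBot F7 r7.2] [:: FImp (FVar 0) (FIff (FVar 2) FBot)]
      (FImp (FVar 0) (FIff (FNot (FVar 1)) (FOr (FNot (FVar 1)) (FVar 2)))); first by taut.
    + by rewrite /= H_le M_gt0 aF7'.
    + by prems.
rewrite -eX; apply: deriv_bind hlast (leq_addr _ _) _.
rewrite addKn => T8 lT8 sub8 hl8.
have hall : holds T8 F8 (size w0) (mm (size w0)).1.
  rewrite eg !catA; apply: holds_cat; last by rewrite -swg sw7.
  by apply: holds_ext hh7 => //; rewrite sF7 swg.
have s8' x : fsize (nth FBot F8 x) <= 2.
  have aF8 : all (fun A => fsize A <= 2) F8 by rewrite all_cat aF7.
  have [lt|le] := ltnP x (size F8); last by rewrite nth_default.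
  by move/(all_nthP FBot): aF8; apply.
apply: deriv_cons (deriv_instance hc M_gt sL lT8 hall (hAx _) _) (leq_addr _ _) _.
  apply: leq_trans (fsize_subst _ (isT : 0 < 2) s8') _.
  exact: finM (fsize_gate_defs _ _).
by move=> T9 _; rewrite eo -addnA n8.
Qed.
End Abstract.

Lemma deriv_self T j2 j6 : base T ->
  (forall t, t < size cs -> FImp (conj (gate_defs n GS))
     (FIff (FVar (nth 0 code t)) (cst (nth false cs t))) \in T) ->
  let D2s := mapb (fun x => let* xs := bconsts x in bD2 n q g s code b xs) images j2 in
  located j2 D2s.1 ->
  (forall d, d \in D2s.2 -> FImp H (FIff (FVar d) FBot) \in T) ->
  located j6 (bin_group n q b j6).1 ->
  (forall sigma, Ax (fsubst sigma (circuit_form N m))) ->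
  24 * size (m N).1 + 10 <= M ->
  derivable T ((15 * size (m N).1 + N + 7) * rc)
    (fun T' => FImp H (FNot (FVar (bin_group n q b j6).2)) \in T').
Proof.
move=> bT hcode D2s lj2 hD2 lj6 hAx sM.
have [sF0 sw0] := size_start; have [vP0 vb0 vc0] := vals_start.
have nb0 : num w0 b0 n 0.
  by have := vals_num vb0; rewrite size_nseq bits_val_nseq0.
have -> : (15 * size (m N).1 + N + 7) * rc = N * rc + (15 * size (m N).1 + 7) * rc.
  by rewrite -mulnDl; congr (_ * _); lia.
apply: deriv_bind (deriv_start bT hcode) (leq_addr _ _) _.
rewrite addKn => T1 lT1 sub1 [inv1 kn1].
rewrite -sw0 in inv1 hAx sM *.
apply: (@deriv_self_abs
  (mapb (fun x => let* xs := bconsts x in bD1 n q g s code0 xs) images)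
  (mapb (fun x => let* xs := bconsts x in bD2 n q g s code0 b0 xs) images)
  (mapb (fun x => let* xs := bconsts x in bD2 n q g s code b xs) images) bcount
  (fun c1 => bprob_ge n l c1 P0) (fun c2 => bprob_ge_half n l c2 P0)
  (bin_group n q b0) (bin_group n q b) (map (accepted n q g s cs) images) (size images)
  _ _ _ _ _ _ _ _ _ _ _ _ _ _ T1 j2 j6 inv1 kn1 lj2 _ lj6 hAx sM).
- by eexists; apply: hoare_D1s.
- move=> R hR; apply: (relb_mapb (RA := eq)) => [|x _ <-]; first exact: Forall2_refl.
  apply: relb_bind (relb_consts _ _) _ => ? ? hx.
  by apply: relb_D1 => //; rewrite size_iota.
- move=> w we; exists ((2 * n + cost_D2 n s) * size images).
  apply: hoare_cons (hoare_D2s q_gt1 q_le g_lt (vals_ext we vc0) cs_size im_size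
    (num_ext we nb0)) (leqnn _) _.
  by move=> w' ts _ [].
- move=> i x; apply: mapb_ge => a j; apply: bind_ge => ? ?; exact: bD2_ge.
- by move=> i; rewrite size_mapb.
- move=> R hR hR'; apply: (relb_mapb (RA := eq)) => [|x _ <-]; first exact: Forall2_refl.
  apply: relb_bind (relb_consts _ _) _ => ? ? hx.
  by apply: relb_D2 => //; rewrite size_iota.
- move=> w xs bs hx; exists (size bs * (11 * size bs + 25)).
  by apply: hoare_cons (hoare_count hx) (leqnn _) _ => w' ys _ [k [hk _]]; exists k.
- by move=> R xs hx; apply: relb_count.
- move=> w xs k; rewrite count_map => hx hP; eexists.
  apply: hoare_cons (hoare_prob_ge n l hx hP) (leqnn _) _ => w' x _.
  by have -> : 2 ^ l * vP <= 2 ^ n * count (preim (accepted n q g s cs) id) images.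
- by move=> R xs hx hP; apply: relb_prob_ge.
- move=> w we; exists (cost_group n).
  by apply: hoare_cons (hoare_in_group q_le (num_ext we nb0)) (leqnn _) _ =>
    w' x _ /andP[].
- by move=> R hR; apply: relb_in_group.
- move=> w xs k hx hP; eexists.
  apply: hoare_cons (hoare_prob_ge_half l hx hP) (leqnn _) _ => w' x _.
  by rewrite !muln0 add0n (negbTE concl_false).
- by move=> R xs hx hP; apply: relb_prob_ge_half.
- by move=> d hd; apply: sub1; apply: hD2.
Qed.

End SelfProof.

Definition cost_self (n s l Z : nat) : nat :=
  (2 * n + cost_D1 n s) * Z + ((2 * n + cost_D2 n s) * Z +
  (Z * (11 * Z + 25) + (Z * (11 * Z + 25) + (12 * (n + Z.+1 + l + n) + 6 +
  (cost_group n + (200 * (n + Z.+1 + l + 2) * (n + Z.+1 + l + 2) + 3)))))).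

Lemma size_self n q g s l images : 1 < q -> q <= 2 ^ n -> g < q ->
  all (fun x => size x == n) images ->
  size (bself n q g s l images (iota 0 n) (iota n n)
    (iota (n + n) (code_len n n s)) (n + n + code_len n n s)).1 <=
  cost_self n s l (size images).
Proof.
move=> q_gt1 q_le g_lt im_size; set N := n + n + _; set m := bself _ _ _ _ _ _ _ _ _.
(* The gates depend only on the number of wires, so running the specifications on an all-false input
   counts them. *)
pose w0 := nseq N false; have sw0 : size w0 = N by rewrite size_nseq.
have vw0 a k : a + k <= N -> vals w0 (iota a k) (nseq k false).
  move=> le; have := @vals_iota w0 a (nseq k false); rewrite size_nseq sw0.
  by apply=> // t lt; rewrite !nth_nseq !if_same.
have num0 a : a + n <= N -> num w0 (iota a n) n 0.
  by move=> /vw0/vals_num; rewrite size_nseq bits_val_nseq0.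
have nP0 : num w0 (iota 0 n) n 0 by apply: num0; rewrite /N; lia.
have nb0 : num w0 (iota n n) n 0 by apply: num0; rewrite /N; lia.
have vc0 := vw0 (n + n) (code_len n n s) (leqnn _).
have cs_size := size_nseq (code_len n n s) false.
move eZ : (size images) => Z.
have valsI w xs : (forall x, x \in xs -> x < size w) ->
    vals w xs [seq nth false w x | x <- xs].
  elim: xs => //= x xs IH h; rewrite /vals /= /wval h ?mem_head // eqxx /=.
  by apply: IH => y hy; apply: h; rewrite inE hy orbT.
suff [] : hoare w0 m (cost_self n s l Z) (fun _ _ => True) by rewrite sw0.
apply: hoare_bind (hoare_D1s q_gt1 q_le g_lt vc0 cs_size im_size) _ _.
  by rewrite eZ leq_addr.
rewrite eZ addKn => w1 d1 e1 h1.
apply: hoare_bind (hoare_D2s q_gt1 q_le g_lt (vals_ext e1 vc0) cs_size im_size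
  (num_ext e1 nb0)) _ _.
  by rewrite eZ leq_addr.
rewrite eZ addKn => w2 d2 e2 [sd2 /valsI h2].
have {}h1 := vals_ext e2 h1.
apply: hoare_bind (hoare_count h1) _ _; rewrite size_map eZ ?leq_addr // addKn.
move=> w3 c1 e3 [k3 [h3 le3]]; have {}h2 := vals_ext e3 h2.
apply: hoare_bind (hoare_count h2) _ _; rewrite size_map sd2 ?leq_addr // addKn.
move=> w4 c2 e4 [k4 [h4 le4]]; have {}h3 := num_ext e4 h3.
have e04 : wext w0 w4 by do ![apply: wext_trans; first by eassumption]; apply: wext_refl.
have b5 : 12 * (n + k3 + l + n) + 6 <= 12 * (n + Z.+1 + l + n) + 6.
  by rewrite leq_add2r leq_mul2l /= !leq_add2r leq_add2l.
apply: hoare_bind (hoare_cons (hoare_prob_ge n l h3 (num_ext e04 nP0)) b5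
  (fun _ _ _ => id)) (leq_addr _ _) _.
rewrite addKn => w5 prem e5 h5.
have e05 := wext_trans e04 e5.
apply: hoare_bind (hoare_in_group q_le (num_ext e05 nb0)) (leq_addr _ _) _.
rewrite addKn => w6 inG e6 h6.
have b7 : 200 * (n + k4 + l + 2) * (n + k4 + l + 2) <=
    200 * (n + Z.+1 + l + 2) * (n + Z.+1 + l + 2).
  have le : n + k4 + l + 2 <= n + Z.+1 + l + 2 by rewrite !leq_add2r leq_add2l.
  by apply: leq_mul => //; rewrite leq_mul2l.
apply: hoare_bind (hoare_cons (hoare_prob_ge_half l (num_ext (wext_trans e5 e6) h4)
  (num_ext (wext_trans e05 e6) nP0)) b7 (fun _ _ _ => id)) (leq_addr _ _) _.
rewrite addKn => w7 concl e7 h7.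
have e57 := wext_trans e6 e7.
apply: hoare_bind (hoare_and (wval_ext e57 h5) (wval_ext e7 h6)) _ _ => // w8 hyp e8 h8.
exact: hoare_cons (hoare_imp h8 (wval_ext e8 h7)) _ _.
Qed.

(** * The generator hits the group *)

Lemma size_all_bits l : size (all_bits l) = 2 ^ l.
Proof. by elim: l => //= l IH; rewrite size_cat !size_map IH expnS; lia. Qed.

Lemma mem_all_bits l x : x \in all_bits l -> size x = l.
Proof.
elim: l x => [|l IH] x /=; first by rewrite inE => /eqP ->.
by rewrite mem_cat => /orP[] /mapP[y /IH <- ->].
Qed.

Lemma count_sum (T : Type) (P : pred T) s : count P s = \sum_(x <- s) (P x : nat).
Proof. by elim: s => [|x s IH] /=; rewrite ?big_nil // big_cons IH. Qed.

Lemma sum_all_bitsS l (F : seq bool -> nat) :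
  \sum_(x <- all_bits l.+1) F x =
  \sum_(x <- all_bits l) (F (false :: x) + F (true :: x)).
Proof. by rewrite /= big_cat !big_map big_split. Qed.

Lemma sum_set_bit l j (F : seq bool -> nat) : j < l ->
  \sum_(z <- all_bits l) (F (set_nth false z j false) + F (set_nth false z j true)) =
  2 * \sum_(z <- all_bits l) F z.
Proof.
elim: l j F => // l IH [|j] F lt; rewrite !sum_all_bitsS /=.
  by rewrite big_distrr; apply: eq_bigr => z _ /=; lia.
rewrite [in RHS]big_split /= mulnDr -(IH j (fun x => F (false :: x))) //.
by rewrite -(IH j (fun x => F (true :: x))) // !big_split /=; lia.
Qed.

Fixpoint overwrite (z : seq bool) (S : seq nat) (x : seq bool) : seq bool :=
  match S, x with
  | j :: S', b :: x' => set_nth false (overwrite z S' x') j b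
  | _, _ => z
  end.

Lemma nth_overwrite z S x i : size x = size S ->
  nth false (overwrite z S x) i =
  if i \in S then nth false x (index i S) else nth false z i.
Proof.
elim: S x => [|j S IH] [|b x] //= [sz]; rewrite nth_set_nth /= inE IH // (eq_sym j).
by case: eqP.
Qed.

(** Resampling the coordinates in S of a uniform seed leaves it uniform. *)
Lemma sum_overwrite l S (F : seq bool -> nat) : all (fun j => j < l) S ->
  \sum_(z <- all_bits l) \sum_(x <- all_bits (size S)) F (overwrite z S x) =
  2 ^ size S * \sum_(z <- all_bits l) F z.
Proof.
elim: S F => [|j S IH] F /=.
  by move=> _; rewrite mul1n; apply: eq_bigr => z _; rewrite big_seq1.
case/andP=> lt hS; rewrite expnS -mulnA mulnCA -(sum_set_bit F lt) -IH //.
apply: eq_bigr => z _; exact: sum_all_bitsS.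
Qed.

(** Averaging: a bound valid for every fixing of the coordinates outside S holds for uniform
    seeds. *)
Lemma sum_le_overwrite l S (F : seq bool -> nat) : all (fun j => j < l) S ->
  (forall z, 16 * \sum_(x <- all_bits (size S)) F (overwrite z S x) <= 9 * 2 ^ size S) ->
  16 * \sum_(z <- all_bits l) F z <= 9 * 2 ^ l.
Proof.
move=> hS h; rewrite -(leq_pmul2l (expn_gt0 2 (size S))) mulnCA -sum_overwrite //.
rewrite big_distrr /=; apply: leq_trans (leq_sum _ (fun z _ => h z)) _.
by rewrite big_const_seq count_predT size_all_bits iter_addn_0; lia.
Qed.

(** A decision tree for an arbitrary function of the wires T: at most two gates per leaf and four
    per branching, which gives the bound 6 * 2 ^ size T - 4. *)
Fixpoint btree (T : seq nat) (h : seq bool -> bool) : build nat :=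
  if T is j :: T' then
    let* a := btree T' (fun y => h (true :: y)) in
    let* b := btree T' (fun y => h (false :: y)) in
    bmux j a b
  else bconst (h [::]).

Lemma hoare_tree w T h ys : vals w T ys ->
  hoare w (btree T h) (6 * 2 ^ size T - 4) (fun w' x => wval w' x (h ys)).
Proof.
elim: T ys h w => [|j T IH] [|y ys] h w //=.
  by move=> _; apply: hoare_const.
case/andP=> hj hT; have := expn_gt0 2 (size T); rewrite expnS /= => p.
apply: hoare_bind (IH _ _ _ hT) _ _ => [|w1 a e1 h1]; first by lia.
apply: hoare_bind (IH _ _ _ (vals_ext e1 hT)) _ _ => [|w2 b e2 h2]; first by lia.
have e12 := wext_trans e1 e2.
apply: hoare_cons (hoare_mux (wval_ext e12 hj) (wval_ext e2 h1) h2) _ _; first by lia.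
by move=> w3 x _; case: (y).
Qed.

Lemma tree_circuit m T h : all (fun j => j < m) T ->
  exists C, [/\ is_circuit m 1 C, csize C <= 6 * 2 ^ size T &
    forall x, size x = m -> ceval C x = [:: h [seq nth false x j | j <- T]]].
Proof.
move=> hT; have hv x : size x = m -> vals x T [seq nth false x j | j <- T].
  move=> sx; elim: T hT => //= j T IH /andP[lt /IH].
  by rewrite /vals /= /wval sx lt eqxx.
pose r := btree T h m; exists (Circuit r.1 [:: r.2]).
have hs x : size x = m -> hoare x (btree T h) (6 * 2 ^ size T - 4)
    (fun w' y => wval w' y (h [seq nth false x j | j <- T])).
  by move=> sx; apply: hoare_tree; apply: hv.
have := hs (nseq m false) (size_nseq _ _).
rewrite /hoare size_nseq -/r => -[wf sz /andP[lt _]]; split.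
- apply/is_circuitP; split=> //=; rewrite andbT.
  by move: lt; rewrite size_gates_eval size_nseq.
- by apply: leq_trans sz _; rewrite leq_subr.
- move=> x sx; have := hs x sx; rewrite /hoare sx -/r => -[_ _ /andP[_ /eqP <-]].
  by [].
Qed.

(** * Predicting one output bit of the generator from another *)

Section Hardness.
Variables (f : seq bool -> bool) (m : nat) (a : nat).
Hypothesis hard : forall C, is_circuit m 1 C -> csize C <= 6 * 2 ^ a ->
  16 * count (fun x => ceval C x == [:: f x]) (all_bits m) <= 9 * 2 ^ m.

(** A predictor that sees at most a coordinates of its input is a decision tree small enough for the
    hardness of f. *)
Lemma hard_local T h : all (fun j => j < m) T -> size T <= a ->
  16 * \sum_(x <- all_bits m) (h [seq nth false x j | j <- T] == f x : nat) <= 9 * 2 ^ m.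
Proof.
move=> hT le; have [C [h1 h2 h3]] := tree_circuit h hT.
have leC : csize C <= 6 * 2 ^ a.
  by apply: leq_trans h2 _; rewrite leq_mul2l leq_exp2l // le.
apply: leq_trans (hard h1 leC); rewrite leq_mul2l /= count_sum.
rewrite big_seq [leqRHS]big_seq; apply: leq_sum => x hx.
by rewrite h3 ?(mem_all_bits hx) // eqseq_cons andbT.
Qed.

Lemma restrict_overwrite z S x : size x = size S -> uniq S ->
  [seq nth false (overwrite z S x) j | j <- S] = x.
Proof.
move=> sx uS; apply: (@eq_from_nth _ false); rewrite size_map // => i lt.
by rewrite (nth_map 0) // nth_overwrite // mem_nth // index_uniq.
Qed.

(* By hardness each of the events ~~ b0, b1 and b0 = b1 holds for at most 9/16 of
   the seeds, and exactly two of them hold unless b0 && ~~ b1. *)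
Lemma spread_bits l S0 S1 :
  [/\ size S0 = m, uniq S0 & all (fun j => j < l) S0] ->
  [/\ size S1 = m, uniq S1 & all (fun j => j < l) S1] ->
  count (fun x => x \in S1) S0 <= a ->
  2 ^ l <= 8 * count (fun z => f [seq nth false z j | j <- S0] &&
                    ~~ f [seq nth false z j | j <- S1]) (all_bits l).
Proof.
move=> [s0 u0 l0] [s1 u1 l1] lea.
pose b0 z := f [seq nth false z j | j <- S0].
pose b1 z := f [seq nth false z j | j <- S1].
have B0 : 16 * \sum_(z <- all_bits l) (~~ b0 z : nat) <= 9 * 2 ^ l.
  apply: (sum_le_overwrite l0) => z; rewrite s0.
  (* A constant is a predictor that sees no coordinates, so f takes each value on at most 9/16 of
     its inputs. *)
  apply: leq_trans (@hard_local [::] (fun=> false) isT isT).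
  rewrite leq_mul2l /= leq_eqVlt; apply/orP; left; apply/eqP.
  apply: eq_big_seq => x hx.
  by rewrite /b0 restrict_overwrite ?(mem_all_bits hx) ?s0 //; case: (f x).
have B1 : 16 * \sum_(z <- all_bits l) (b1 z : nat) <= 9 * 2 ^ l.
  apply: (sum_le_overwrite l1) => z; rewrite s1.
  apply: leq_trans (@hard_local [::] (fun=> true) isT isT).
  rewrite leq_mul2l /= leq_eqVlt; apply/orP; left; apply/eqP.
  apply: eq_big_seq => x hx.
  by rewrite /b1 restrict_overwrite ?(mem_all_bits hx) ?s1 //; case: (f x).
have B2 : 16 * \sum_(z <- all_bits l) (b0 z == b1 z : nat) <= 9 * 2 ^ l.
  apply: (sum_le_overwrite l1) => z; rewrite s1.
  (* With the seed fixed outside [S1], the bit b0 depends on the input x of the other copy only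
     through the common coordinates, of which there are at most a. T lists their positions in x, and
     h computes b0 from them. *)
  pose S' := [seq j <- S0 | j \in S1].
  pose T := [seq index j S1 | j <- S'].
  pose h ys := f [seq (if j \in S1 then nth false ys (index j S') else nth false z j)
                   | j <- S0].
  have hT : all (fun j => j < m) T.
    by rewrite all_map; apply/allP => j /=; rewrite mem_filter -s1 index_mem => /andP[].
  have sT : size T <= a by rewrite size_map size_filter.
  apply: leq_trans (hard_local h hT sT).
  rewrite leq_mul2l /= leq_eqVlt; apply/orP; left; apply/eqP.
  apply: eq_big_seq => x hx.
  have sx : size x = size S1 by rewrite (mem_all_bits hx).
  rewrite /b1 restrict_overwrite //; congr (nat_of_bool (_ == _)).
  rewrite /h /b0; congr f; apply/eq_in_map => j hj.
  rewrite nth_overwrite //; case: ifP => // j1.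
  have hj' : j \in S' by rewrite mem_filter j1.
  rewrite (nth_map 0); last by rewrite size_map index_mem.
  by rewrite (nth_map 0) ?index_mem // nth_index.
have := count_sum (fun z => b0 z && ~~ b1 z) (all_bits l); rewrite -/b0 -/b1 => ->.
(* Each seed contributes 2, while the last three terms average at most 27/16. So b0 && ~~ b1 holds
   for at least 5/32 of the seeds, which is more than 1/8. *)
have : \sum_(z <- all_bits l) ((b0 z && ~~ b1 z) + (b0 z && ~~ b1 z) +
      (~~ b0 z) + b1 z + (b0 z == b1 z)) =
    2 * 2 ^ l.
  rewrite (eq_bigr (fun=> 2)); last by move=> z _; case: (b0 z); case: (b1 z).
  by rewrite big_const_seq count_predT size_all_bits iter_addn_0.
by rewrite !big_split /=; lia.
Qed.

End Hardness.

Lemma clog_ge n : n <= 2 ^ clog n.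
Proof. exact: up_logP. Qed.

Section RealHardness.
Import Order.TTheory GRing.Theory Num.Theory.

(** As c0 exceeds 2 / eps, on m = c'' a inputs with a = clog n the bound 2^(eps m) is at least
    (2^a)^2. This dominates the size 6 * 2^a of the decision trees and makes the advantage at most
    1/16, whence 9/16. *)
Lemma hard_on_average_nat (R : realType) (eps : R) : (0 < eps)%R ->
  exists c0, forall f, hard_on_average eps f -> forall c'', c0 <= c'' ->
  exists N, forall n, N <= n ->
  forall C, is_circuit (c'' * clog n) 1 C -> csize C <= 6 * 2 ^ clog n ->
  16 * count (fun x => ceval C x == [:: f x]) (all_bits (c'' * clog n)) <=
  9 * 2 ^ (c'' * clog n).
Proof.
move=> eps0; pose c0 := (Num.truncn (2 / eps)%R).+1.
have c0P : (2 <= eps * c0%:R)%R.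
  by rewrite mulrC -ler_pdivrMr // ltW // truncnS_gt.
(* The 16 gives 2 ^ a >= 16, enough for the size and for the advantage; 2 ^ n1 makes the input
   length at least n1. *)
exists c0 => f [n1 hard] c'' le; exists (maxn 16 (2 ^ n1)) => n len C hC sC.
set a := clog n in hC sC *; set m := c'' * a in hC *.
have an : n <= 2 ^ a := clog_ge n.
have a4 : 2 ^ 4 <= 2 ^ a by apply: leq_trans an; lia.
have len1 : n1 <= m.
  have : 2 ^ n1 <= 2 ^ a by apply: leq_trans an; lia.
  by rewrite leq_exp2l // /m => h; apply: leq_trans h _; rewrite leq_pmull //; lia.
have big : ((2 ^ a * 2 ^ a)%:R <= 2 `^ (eps * m%:R) :> R)%R.
  rewrite -expnD addnn -mul2n natrX -powR_mulrn ?ler0n //.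
  apply: ler_powR; first by rewrite ler1n.
  rewrite /m !natrM mulrA ler_wpM2r ?ler0n //.
  by apply: le_trans c0P _; rewrite ler_wpM2l ?ler_nat // ltW.
have := hard m len1 C hC.
set e := (2 `^ _)%R in big *.
have e0 : (0 < e)%R by rewrite powR_gt0.
have -> : ((csize C)%:R <= e)%R.
  apply: le_trans big; rewrite ler_nat; apply: leq_trans sC _.
  by rewrite leq_mul2r; apply/orP; right; lia.
move=> /(_ isT) h.
have inv16 : (1 / e <= 1 / 16 :> R)%R.
  rewrite !div1r lef_pV2 ?posrE ?ltr0n //; apply: le_trans big.
  by rewrite ler_nat; apply: leq_trans (leq_mul a4 a4).
rewrite -(ler_nat R) !natrM; apply/ltW.
have -> : (9%:R * (2 ^ m)%:R = 16%:R * ((1 / 2 + 1 / 16) * 2 ^+ m) :> R)%R.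
  by rewrite natrX mulrA; congr (_ * _)%R; field.
rewrite ltr_pM2l ?ltr0n //; apply: lt_le_trans h _.
by rewrite ler_wpM2r ?exprn_ge0 // lerD2l.
Qed.

End RealHardness.

(** Bits are listed from the least significant one: bit 0 equal to 1 makes the number positive, and
    bit n - 1 equal to 0 keeps it below 2^(n-1) and hence below q. *)
Lemma NW_in_group f c' c'' S n q : let l := c' * clog n in 1 < n ->
  is_design n l (c'' * clog n) (clog n) (S n) ->
  (forall C, is_circuit (c'' * clog n) 1 C -> csize C <= 6 * 2 ^ clog n ->
     16 * count (fun x => ceval C x == [:: f x]) (all_bits (c'' * clog n)) <=
     9 * 2 ^ (c'' * clog n)) ->
  2 ^ n.-1 < q ->
  2 ^ l <= 8 * count (fun x => 0 < bits_val x < q) [seq NW f S n z | z <- all_bits l].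
Proof.
move=> l n1 [dS dI] hard ltq.
have lt0 : 0 < n by lia.
have ltn' : n.-1 < n by lia.
have ne : 0 != n.-1 by lia.
have := spread_bits hard (dS 0 lt0) (dS n.-1 ltn') (dI 0 n.-1 lt0 ltn' ne).
move=> h; apply: leq_trans h _; rewrite leq_mul2l /= count_map.
apply: sub_count => z /= /andP[h0 h1].
have sN : size (NW f S n z) = n by rewrite size_mkseq.
have n0 : nth false (NW f S n z) 0 by rewrite nth_mkseq.
have nl : ~~ nth false (NW f S n z) n.-1 by rewrite nth_mkseq.
move: (NW f S n z) sN n0 nl => x sx n0 nl; apply/andP; split.
  by case: x n0 {sx nl} => // b x /= ->.
apply: leq_ltn_trans ltq.
have -> : x = take n.-1 x ++ [:: false].
  have ex : n.-1 < size x by rewrite sx.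
  rewrite -{1}(cat_take_drop n.-1 x) (drop_nth false ex) (negbTE nl).
  by rewrite drop_oversize // sx prednK.
rewrite bits_val_cat /= muln0 addn0; apply: ltnW.
by apply: leq_trans (bits_val_lt _) _; rewrite size_takel // sx leq_pred.
Qed.

(** * Polynomial bounds and assembly *)

(** A bound that holds eventually lets constants and factors be absorbed into the exponent, so the
    closure rules carry no coefficients. *)
Definition poly_bounded (F : nat -> nat) : Prop :=
  exists K N, forall n, N <= n -> F n <= n ^ K.

Lemma poly_le F F' : (forall n, F n <= F' n) -> poly_bounded F' -> poly_bounded F.
Proof.
by move=> le [K [N h]]; exists K, N => n ln; apply: leq_trans (le n) (h n ln).
Qed.

Lemma poly_const c : poly_bounded (fun=> c).
Proof. by exists 1, c => n; rewrite expn1. Qed.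

Lemma poly_id : poly_bounded id.
Proof. by exists 1, 0 => n _; rewrite expn1. Qed.

Lemma poly_add F F' : poly_bounded F -> poly_bounded F' ->
  poly_bounded (fun n => F n + F' n).
Proof.
move=> [K [N h]] [K' [N' h']]; exists (maxn K K').+1, (maxn 2 (maxn N N')) => n le.
have n0 : 0 < n by lia.
have l1 : n ^ K <= n ^ maxn K K' by rewrite leq_pexp2l ?leq_maxl.
have l2 : n ^ K' <= n ^ maxn K K' by rewrite leq_pexp2l ?leq_maxr.
have l3 : F n <= n ^ K by apply: h; lia.
have l4 : F' n <= n ^ K' by apply: h'; lia.
apply: leq_trans (leq_add (leq_trans l3 l1) (leq_trans l4 l2)) _.
by rewrite addnn -mul2n expnS leq_mul2r; apply/orP; right; lia.
Qed.

Lemma poly_mul F F' : poly_bounded F -> poly_bounded F' ->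
  poly_bounded (fun n => F n * F' n).
Proof.
move=> [K [N h]] [K' [N' h']]; exists (K + K'), (maxn N N') => n le.
by rewrite expnD; apply: leq_mul; [apply: h | apply: h']; lia.
Qed.

Lemma poly_exp F k : poly_bounded F -> poly_bounded (fun n => F n ^ k).
Proof.
move=> pF; elim: k => [|k IH]; first exact: poly_const.
by apply: poly_le (poly_mul pF IH) => n; rewrite expnS.
Qed.

Lemma clog_le n : clog n <= n.
Proof. by apply: up_log_min => //; apply: ltnW; apply: ltn_expl. Qed.

Lemma poly_clog : poly_bounded clog.
Proof. exact: poly_le clog_le poly_id. Qed.

Lemma exp_clog_le n : 2 ^ clog n <= 2 * n + 1.
Proof.
have [le|lt] := leqP n 1; first by case: n le => [|[|]].
have := @up_log_gtn 2 n isT lt; rewrite -/(clog n).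
have : 0 < clog n by rewrite up_log_gt0.
by case: (clog n) => // k _; rewrite expnS /=; lia.
Qed.

(** Seeds have logarithmic length; this is what makes it affordable for D to try them all. *)
Lemma poly_seeds c' : poly_bounded (fun n => 2 ^ (c' * clog n)).
Proof.
apply: poly_le (poly_exp c' (poly_add (poly_mul (poly_const 2) poly_id) (poly_const 1))).
by move=> n; rewrite mulnC expnM; case: c' => // c'; rewrite leq_exp2r // exp_clog_le.
Qed.

Lemma addr_len_le n s : addr_len n s <= n + s.
Proof. by apply: up_log_min => //; apply: ltnW; apply: ltn_expl. Qed.

(** By induction on the wires, a valuation satisfying all gate definitions agrees with the
    evaluation of the circuit on its first n values. *)
Lemma circuit_form_tautology n (m : build nat) :
  gwf n (m n).1 -> (m n).2 < n + size (m n).1 ->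
  (forall w, size w = n -> nth false (gates_eval w (m n).1) (m n).2) ->
  tautology (circuit_form n m).
Proof.
move=> wf lt h v; rewrite circuit_formE /=; apply/implyP => hd.
set gs := (m n).1 in wf lt h hd.
pose w := mkseq v n; have sw : size w = n by rewrite size_mkseq.
have hdef t : t < size gs -> v (n + t) = feval v (gate_form (nth GFalse gs t)).
  move=> ltt; have : feval v (nth FBot (gate_defs n gs) t).
    move: ltt hd; rewrite -(size_gate_defs n); elim: (gate_defs n gs) t => //= A Fs IH.
    by case=> [_ /andP[]|t ltt /andP[_ /IH]] //; apply.
  rewrite nth_gate_defs // /gate_def /=.
  by case: (v (n + t)); case: (feval v _).
suff e x : x < n + size gs -> v x = nth false (gates_eval w gs) x.
  by rewrite e //; apply: h.
elim/ltn_ind: x => x IH ltx.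
have [ltn|len] := ltnP x n; first by rewrite nth_gates_eval ?sw // nth_mkseq.
have ltt : x - n < size gs by lia.
have ex : x = n + (x - n) by lia.
have := @nth_gates_evalE w gs (x - n); rewrite sw -ex => -> //.
have -> : v x = feval v (gate_form (nth GFalse gs (x - n))) by rewrite -hdef // -ex.
have := wf _ ltt; rewrite -ex.
case: (nth GFalse gs (x - n)) => [|a|a b|a b] //= => [la|/andP[la lb]|/andP[la lb]];
  by rewrite !IH //; lia.
Qed.

Lemma deriv_proof Ax goal c M k :
  deriv Ax goal c M [::] k (fun T => goal \in T) ->
  exists pi, EF_proof Ax goal pi /\ proof_size pi <= k * line_size c M.
Proof.
move=> [T [l1 s1 a1 h]]; rewrite cats0 in l1 h.
case/splitPr: h l1 s1 a1 => a b l1 s1 a1.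
(* The lines derived after the goal are cut off; as the last line comes first, what remains is a
   suffix and still a proof. *)
exists (goal :: b); split; first by split=> //; apply: EF_lines_suffix l1.
rewrite all_cat in a1; case/andP: a1 => _ a1.
apply: leq_trans (_ : size (goal :: b) * line_size c M <= _); last first.
  rewrite leq_mul2r; apply/orP; right; apply: leq_trans s1.
  by rewrite size_cat leq_addl.
rewrite /proof_size; elim: (goal :: b) a1 => //= A l IH /andP[hA /IH].
by rewrite mulSn; lia.
Qed.

(** D is built at wire n above the inputs 0, ..., n - 1, so its wires keep their numbers in the
    formula to be proved. *)
Lemma inline_id n D : binline n D (iota 0 n) n = (gates D, outs D).
Proof.
have r w : (if w < n then nth 0 (iota 0 n) w else n + (w - n)) = w.
  by case: ltnP => h; [rewrite nth_iota | rewrite subnKC].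
congr (_, _); last by rewrite -[RHS]map_id; apply: eq_map => w; apply: r.
rewrite -[RHS]map_id; apply: eq_map => -[|a|a b|a b] //=; by rewrite !r.
Qed.

Lemma mapb_image A B B' (h : A -> build B) (h' : A -> build B') (p : B -> B') s i :
  (forall x i, h' x i = ((h x i).1, p (h x i).2)) ->
  mapb h' s i = ((mapb h s i).1, map p (mapb h s i).2).
Proof. by move=> e; elim: s i => //= x s IH i; rewrite /bind /= e /= IH. Qed.

Lemma bind_image A B B' (m : build A) (k : A -> build B) (k' : A -> build B')
    (p : B -> B') i :
  (forall x i, k' x i = ((k x i).1, p (k x i).2)) ->
  bind m k' i = ((bind m k i).1, p (bind m k i).2).
Proof. by move=> e; rewrite /bind e. Qed.

Lemma circuit_form_ext n (m m' : build nat) : m n = m' n ->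
  circuit_form n m = circuit_form n m'.
Proof. by rewrite /circuit_form => ->. Qed.

Lemma bind_ext A B (m : build A) A' (m' : build A') (p : A' -> A) (k : A -> build B) i :
  m i = ((m' i).1, p (m' i).2) -> bind m k i = bind m' (fun r => k (p r)) i.
Proof. by rewrite /bind => ->. Qed.

Lemma bind_result A B (m : build A) (k : A -> build B) i :
  (bind m k i).2 = (k (m i).2 (i + size (m i).1)).2.
Proof. by []. Qed.

Lemma bind_checked n GS q g b (m : build (seq nat)) (k : build nat) i :
  let w := let* c := m in let* e := bis_log n q g c b in let* h := k in
    let* d := band h e in ret (c, d) in
  located n GS i (w i).1 -> checked n GS q g b (w i).2.
Proof.
move=> w /located_bind[_] /located_bind[l3] /located_bind[_] /located_bind[l7 _].
by do 3 eexists; split; [exact: l7 | | exact: l3].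
Qed.

Lemma witness_checked n GS q g s code b x i :
  let w := let* xs := bconsts x in bD2_witness n q g s code b xs in
  located n GS i (w i).1 -> checked n GS q g b (w i).2.
Proof.
move=> w /located_bind[_ l]; rewrite bind_result.
exact: (bind_checked l).
Qed.

#[local] Opaque bis_log bin_group bD2 bD2_witness bchoose bcands.

Definition bdlog (n q g : nat) (d : seq nat) : build nat :=
  let* h := bin_group n q (iota 0 n) in
  let* e := bis_log n q g d (iota 0 n) in
  bimp h e.

Definition cost_proof (n G N S Z cl : nat) : nat :=
  2 * G + 1 + (cl + (1 + (2 * Z + (15 * S + N + 7 +
  (Z.+1 * (2 * n + 2 * n + 2 * G + 2) + (n + (n + G + 1))))))).

Lemma cost_proofE n G N S Z cl r : cost_proof n G N S Z cl * r =
  (2 * G + 1) * r + (cl * r + (r + (Z * (2 * r) + ((15 * S + N + 7) * r +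
  (Z.+1 * ((2 * n + 2 * n + 2 * G + 2) * r) + (n * r + ((n + G) * r + r))))))).
Proof. by rewrite /cost_proof; lia. Qed.

(** * The derivation of the correctness of D *)

Section Derivation.
Variables (n : nat) (GS : seq gate) (Ax : pform -> Prop) (goal : pform) (c M : nat).
Hypotheses (wf : gwf n GS) (hc : is_scheme_bound c)
  (M_gt : fsize (conj (gate_defs n GS)) + 20 <= M).
Variables (q g s l vP : nat) (images : seq (seq bool)) (cs : seq bool).
Hypotheses (q_gt1 : 1 < q) (q_le : q <= 2 ^ n) (g_lt : g < q) (vP_lt : vP < 2 ^ n).
Hypotheses (im_size : all (fun x => size x == n) images).
Hypothesis (cs_size : size cs = code_len n n s).
Let b := iota 0 n.
Variables (base0 : seq nat) (j1 j2 j5 j6 j7 j8 : nat).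
Let code := (bconsts cs j1).2.
Let cands := (bcands n q g s images code b j2).2.
Let r := (bchoose n q g base0 b cands j5).2.
Let h := (bin_group n q b j6).2.
Let e := (bis_log n q g r.1.1 b j7).2.
Hypotheses (base_size : size base0 = n)
  (cand_size : forall cd, cd \in cands -> size cd.1 = n)
  (l1 : located n GS j1 (bconsts cs j1).1)
  (l2 : located n GS j2 (bcands n q g s images code b j2).1)
  (l5 : located n GS j5 (bchoose n q g base0 b cands j5).1)
  (l6 : located n GS j6 (bin_group n q b j6).1)
  (l7 : located n GS j7 (bis_log n q g r.1.1 b j7).1)
  (l8 : located n GS j8 [:: GNot h; GOr j8 e])
  (goalE : goal = FImp (conj (gate_defs n GS)) (FVar (j8 + 1))).
Let N := n + n + code_len n n s.
Let m := bself n q g s l images (iota 0 n) (iota n n) (iota (n + n) (code_len n n s)).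
Hypotheses (prem_true : 2 ^ l * vP <= 2 ^ n * count (accepted n q g s cs) images)
  (concl_false : ~~ (2 ^ l * (n * vP) <= 2 ^ (l + n) * 3))
  (hAx : forall sigma, Ax (fsubst sigma (circuit_form N m)))
  (M_gt' : 24 * size (m N).1 + 10 <= M).

Notation G := (conj (gate_defs n GS)).
Notation rc := (rule_cost c).
Notation derivable := (deriv Ax goal c M).

Let M_gt0 : 0 < M. Proof. by lia. Qed.
Let G_le : fsize G <= M. Proof. by lia. Qed.

Ltac rule l ps F :=
  apply: (@deriv_rule Ax goal c M hc M_gt0 (l : seq pform) (ps : seq pform) F) => //.

Lemma bcands_D2 : mapb (fun x => let* xs := bconsts x in bD2 n q g s code b xs) images j2 =
  ((bcands n q g s images code b j2).1, map snd cands).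
Proof.
apply: mapb_image => x i; apply: bind_image => xs j; exact: bD2_witnessE.
Qed.

Lemma cands_checked cd : cd \in cands -> checked n GS q g b cd.
Proof.
move=> /(nthP ([::], 0))[t lt <-]; rewrite size_mapb in lt.
have [i' [l' ->]] := located_mapb [::] ([::], 0) l2 lt.
exact: witness_checked l'.
Qed.

Lemma deriv_correct : derivable [::]
  (cost_proof n (size GS) N (size (m N).1) (size images) (code_len n n s) * rc)
  (fun T => goal \in T).
Proof.
have sc : size cands = size images by rewrite size_mapb.
set S := size (m N).1; set Z := size images in sc *.
rewrite cost_proofE.
apply: deriv_bind (deriv_base Ax goal hc M_gt) (leq_addr _ _) _.
rewrite addKn => T0 lT0 _ bT0.
apply: deriv_bind (deriv_consts hc M_gt bT0 l1) _ _; rewrite cs_size ?leq_addr //.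
rewrite addKn => T1 lT1 sub1 hcode; have bT1 := base_sub bT0 lT1 sub1.
rewrite -cs_size in hcode.
(* The assumption that no candidate passes; it is in force until b is shown to be outside the
   group. *)
pose L := FNot (FVar r.1.2).
apply: (@deriv_bind _ _ _ _ _ rc _
  (fun T' => FImp (under n GS L) (FNot (FVar r.1.2)) \in T')).
- rule [:: G; FVar r.1.2] (@nil pform)
    (FImp (FAnd (FVar 0) (FNot (FVar 1))) (FNot (FVar 1))); first by taut.
  by rewrite /= G_le M_gt0.
- by rewrite leq_addr.
rewrite addKn => T2 lT2 sub2 hany; have bT2 := base_sub bT1 lT2 sub2.
apply: deriv_bind (deriv_choose_none hc M_gt bT2 (isT : fsize L <= 10) l5 hany) _ _;
  rewrite sc ?leq_addr //.
rewrite addKn => T3 lT3 sub3 hnone; have bT3 := base_sub bT2 lT3 sub3.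
have sub13 : {subset T1 <= T3} by move=> A /sub2/sub3.
have szcode : size code = size cs by rewrite size_mapb.
have lD2 : located n GS j2 (mapb (fun x => let* xs := bconsts x in
    bD2 n q g s code b xs) images j2).1 by rewrite bcands_D2.
have hD2 d : d \in (mapb (fun x => let* xs := bconsts x in
    bD2 n q g s code b xs) images j2).2 ->
    FImp (under n GS L) (FIff (FVar d) FBot) \in T3.
  by rewrite bcands_D2 => /mapP[cd hcd ->]; apply: hnone.
apply: deriv_bind (deriv_self hc M_gt (isT : fsize L <= 10) q_gt1 q_le g_lt vP_lt
  im_size cs_size szcode prem_true concl_false bT3 _ lD2 hD2 l6 hAx M_gt') (leq_addr _ _) _.
  by move=> t lt; apply: sub13; apply: hcode.
rewrite addKn => T4 lT4 sub4 hh; have bT4 := base_sub bT3 lT4 sub4.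
have hchk cd : cd \in cands -> size cd.1 = size base0 /\ checked n GS q g b cd.
  by move=> hcd; split; [rewrite base_size; apply: cand_size | apply: cands_checked].
apply: deriv_bind (deriv_choose wf hc M_gt bT4 hchk l5) _ _;
  rewrite base_size size_iota sc ?leq_addr //.
rewrite addKn -/r => T5 lT5 sub5 hE; have bT5 := base_sub bT4 lT5 sub5.
have sr : size r.1.1 = n.
  by rewrite size_choose // => cd hcd; rewrite base_size; apply: cand_size.
have [jr [ljr ejr]] := choose_log l5; rewrite -/r in ljr ejr.
apply: deriv_bind (deriv_loop (A := fun t => eqv n GS (FNot FBot) (nth 0 r.1.1 t)
  (nth 0 r.1.1 t)) (N := n) (d := rc) lT5 _) (leq_addr _ _) _.
- move=> t T' lt lT' _ _.
  rule [:: G; FVar (nth 0 r.1.1 t)] (@nil pform)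
    (FImp (FAnd (FVar 0) (FNot FBot)) (FIff (FVar 1) (FVar 1))); first by taut.
  by rewrite /= G_le M_gt0.
rewrite addKn => T6 lT6 sub6 hrefl; have bT6 := base_sub bT5 lT6 sub6.
rewrite -{1}sr in hrefl.
(* The test in the goal and the last test inside D read the same wires, so they are copies of each
   other; the extra assumption is trivial here. *)
apply: deriv_bind (deriv_log_copy wf hc M_gt (L := FNot FBot) bT6 isT l7 ljr erefl hrefl) _ _;
  rewrite size_iota ?leq_addr //.
rewrite addKn -ejr => T7 lT7 sub7 heq; have bT7 := base_sub bT6 lT7 sub7.
have := base_def bT7 l8 (isT : 0 < 2); have := base_def bT7 l8 (isT : 1 < 2).
rewrite addn0 [nth _ _ _]/= [nth _ _ 0]/= => h1 h0.
have {}hh := sub7 _ (sub6 _ (sub5 _ hh)).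
have {}hE := sub7 _ (sub6 _ hE).
rewrite {2}goalE.
(* Cases on the flag: if it is false, b is not in the group; if it is true, the last test inside D
   holds and is equivalent to the test in the goal. *)
rule [:: G; FVar r.1.2; FVar h; FVar r.2; FVar e; FVar j8; FVar (j8 + 1)]
  [:: FImp (FAnd (FVar 0) (FNot (FVar 1))) (FNot (FVar 2));
      FImp (FVar 0) (FImp (FVar 1) (FVar 3));
      FImp (FAnd (FVar 0) (FNot FBot)) (FIff (FVar 4) (FVar 3));
      FImp (FVar 0) (FIff (FVar 5) (FNot (FVar 2)));
      FImp (FVar 0) (FIff (FVar 6) (FOr (FVar 5) (FVar 4)))]
  (FImp (FVar 0) (FVar 6)); first by taut.
- by rewrite /= G_le M_gt0.
- by prems.
Qed.
End Derivation.

Lemma bdlog_located n GS q g d i (b := iota 0 n) :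
  located n GS i (bdlog n q g d i).1 ->
  let h := bin_group n q b i in
  let j := i + size h.1 in let e := bis_log n q g d b j in
  let j' := j + size e.1 in
  [/\ located n GS i h.1, located n GS j e.1,
      located n GS j' [:: GNot h.2; GOr j' e.2] & (bdlog n q g d i).2 = j' + 1].
Proof. by move=> /located_bind[l6 /located_bind[l7 l8]]. Qed.

Lemma candidates_size T n q g v w (xs : seq T) cds :
  Forall2 (fun _ => is_candidate n q g v w) xs cds ->
  forall cd, cd \in cds -> size cd.1 = n.
Proof.
elim=> // x cd {}xs {}cds [vc [d [hv _ _]]] _ IH cd'.
by rewrite inE => /orP[/eqP ->|/IH //]; apply: num_size hv.
Qed.

(** * The circuit D and its formula for a fixed n *)

Section Assembly.
Variables (n q g s l vP : nat) (images : seq (seq bool)) (C : circuit).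
Hypotheses (q_gt1 : 1 < q) (q_le : q <= 2 ^ n) (g_lt : g < q) (vP_lt : vP < 2 ^ n).
Hypotheses (im_size : all (fun x => size x == n) images).
Hypotheses (hC : is_circuit n n C) (sC : csize C <= s).

Variable cs : seq bool.
Hypothesis cs_size : size cs = code_len n n s.

Let b := iota 0 n.
Let bm := bcorrected n q g s cs images C b.
Let D := Circuit (bm n).1 (bm n).2.1.1.
Let bfull : build nat := let* r := bm in bdlog n q g r.1.1.
Let GS := (bfull n).1.
Let goal := dlog_form n q g D.

Definition cost_full (Z : nat) : nat :=
  cost_corrected n s Z + (cost_group n + cost_log n + 2).

Let vals_b (w : seq bool) : size w = n -> vals w b w.
Proof.
move=> sw; have := @vals_iota w 0 w; rewrite sw; apply=> // t _.
Qed.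

Lemma goalE : goal = circuit_form n bfull.
Proof.
apply: circuit_form_ext.
exact: (bind_ext (p := fun r => r.1.1) (bdlog n q g) (inline_id n D)).
Qed.

Lemma hoare_full w : size w = n ->
  (0 < bits_val w < q -> g ^ bits_val (ceval C w) %% q = bits_val w) ->
  hoare w bfull (cost_full (size images)) (fun w' x => wval w' x true).
Proof.
move=> sw hdl; have hb := vals_b sw; have hbn := vals_num hb; rewrite sw in hbn.
apply: hoare_bind (hoare_corrected (s := s) q_gt1 q_le g_lt cs_size im_size hC sC hb sw) _ _.
  by rewrite leq_addr.
move=> w1 r e1 [u [a [e [h1 _ _ h4]]]]; rewrite addKn.
apply: hoare_dlog (num_ext e1 hbn) _ => //.
by exists u; split=> // /hdl.
Qed.

Hypothesis solves : solves_dlog n q g C.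

Lemma full_spec w : size w = n ->
  hoare w bfull (cost_full (size images)) (fun w' x => wval w' x true).
Proof. by move=> sw; apply: hoare_full => // hw; apply: solves. Qed.

Lemma GS_spec : [/\ gwf n GS, size GS <= cost_full (size images) &
  (bfull n).2 < n + size GS].
Proof.
have := full_spec (size_nseq n false); rewrite /hoare size_nseq => -[wf sz /andP[lt _]].
by split=> //; move: lt; rewrite size_gates_eval size_nseq.
Qed.

Lemma goal_tautology : tautology goal.
Proof.
have [wf _ lt] := GS_spec; rewrite goalE; apply: circuit_form_tautology => // w sw.
have := full_spec sw; rewrite /hoare sw => -[_ _ /andP[_ /eqP h]]; exact: h.
Qed.

Lemma D_circuit : is_circuit n n D /\ csize D <= cost_corrected n s (size images).
Proof.
have hb := vals_b (size_nseq n false).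
have := hoare_corrected (s := s) q_gt1 q_le g_lt cs_size im_size hC sC hb (size_nseq _ _).
rewrite /hoare size_nseq -/bm => -[wf sz [u [a [e [h1 _ _ _]]]]]; split=> //.
apply/is_circuitP; split=> //; last exact: num_size h1.
apply/allP => x hx; have := num_range h1 hx.
by rewrite size_gates_eval size_nseq.
Qed.

Variables (Ax : pform -> Prop) (c M : nat).
Hypothesis hc : is_scheme_bound c.

Let N := n + n + code_len n n s.
Let m := bself n q g s l images (iota 0 n) (iota n n) (iota (n + n) (code_len n n s)).
Hypotheses (prem_true : 2 ^ l * vP <= 2 ^ n * count (accepted n q g s cs) images)
  (concl_false : ~~ (2 ^ l * (n * vP) <= 2 ^ (l + n) * 3)).
Hypothesis hAx : forall sigma, Ax (fsubst sigma (circuit_form N m)).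
Hypotheses (M_gt : 12 * size GS + 22 <= M) (M_gt' : 24 * size (m N).1 + 10 <= M).

Lemma corrected_derivation :
  deriv Ax goal c M [::] (cost_proof n (size GS) N (size (m N).1) (size images)
    (code_len n n s) * rule_cost c) (fun T => goal \in T).
Proof.
have [wf _ _] := GS_spec.
have M_gt2 : fsize (conj (gate_defs n GS)) + 20 <= M.
  by have := fsize_gate_defs n GS; lia.
(* The gate list is cut along the binds of the construction to find the positions of the code, the
   candidates, the selections and the final test. *)
have lGS : located n GS n (bind bm (fun r => bdlog n q g r.1.1) n).1 := located_refl n GS.
have [lb lr] := located_bind lGS.
have ebm : bm = bcorrected n q g s cs images C b by [].
rewrite {1}ebm /bcorrected in lb.
have [l1 lb2] := located_bind lb.
have [l2 lb3] := located_bind lb2.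
have [_ l5] := located_bind lb3.
set j1 := n in l1 l2 l5; set code := (bconsts cs j1).2 in l2 l5.
set j2 := n + size (bconsts cs j1).1 in l2 l5.
set cands := (bcands n q g s images code b j2).2 in l5.
set j4 := j2 + _ in l5; set base0 := (binline n C b j4).2 in l5.
set j5 := j4 + _ in l5.
have er : (bm n).2 = (bchoose n q g base0 b cands j5).2.
  by rewrite ebm /bcorrected !bind_result.
have eg : (bfull n).2 = (bdlog n q g (bm n).2.1.1 (n + size (bm n).1)).2 :=
  bind_result bm (fun r => bdlog n q g r.1.1) n.
rewrite er in lr eg; set j6 := n + size (bm n).1 in lr eg.
have := bdlog_located lr; cbv zeta.
set h := (bin_group _ _ _ _).2; set j7 := j6 + _.
set e := (bis_log _ _ _ _ _ _).2; set j8 := j7 + _ => -[l6 l7 l8 eo].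
have {}eg := etrans eg eo.
have goalE' : goal = FImp (conj (gate_defs n GS)) (FVar (j8 + 1)).
  by rewrite goalE circuit_formE eg.
apply: (@deriv_correct n GS Ax goal c M wf hc M_gt2 q g s l vP images cs q_gt1 q_le
  g_lt vP_lt im_size cs_size base0 j1 j2 j5 j6 j7 j8) => //.
- by have [_ _ so] := (is_circuitP n n C).1 hC; rewrite size_map.
- have hb := vals_num (vals_b (size_nseq n false)); rewrite size_nseq in hb.
  have [_ _ h1] := hoare_consts (nseq n false) cs.
  rewrite size_nseq -/j1 -/code in h1; set w1 := gates_eval _ _ in h1.
  have sw1 : size w1 = j2 by rewrite size_gates_eval size_nseq.
  have e1 : wext (nseq n false) w1 by apply: wext_gates_eval.
  have [_ _ h2] := hoare_cands q_gt1 q_le g_lt cs_size im_size h1 (num_ext e1 hb).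
  rewrite sw1 -/cands in h2; exact: candidates_size h2.
Qed.

End Assembly.

Lemma poly_succ F : poly_bounded F -> poly_bounded (fun n => (F n).+1).
Proof.
by move=> pF; apply: poly_le (poly_add pF (poly_const 1)) => n; rewrite addn1.
Qed.

Lemma poly_addr_len k : poly_bounded (fun n => addr_len n (n ^ k)).
Proof.
exact: poly_le (fun n => addr_len_le n (n ^ k)) (poly_add poly_id (poly_exp k poly_id)).
Qed.

Ltac poly := repeat match goal with
  | |- poly_bounded (fun n => n) => exact: poly_id
  | |- poly_bounded (fun _ => ?c) => exact: (poly_const c)
  | |- poly_bounded (fun n => addr_len n (n ^ ?k)) => exact: (poly_addr_len k)
  | |- poly_bounded (fun n => clog n) => exact: poly_clog
  | |- poly_bounded (fun n => 2 ^ (?c * clog n)) => exact: (poly_seeds c)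
  | |- poly_bounded (fun n => @?a n ^ ?k) => apply: (@poly_exp a k)
  | |- poly_bounded (fun n => @?a n + @?b n) => apply: (@poly_add a b)
  | |- poly_bounded (fun n => @?a n * @?b n) => apply: (@poly_mul a b)
  | |- poly_bounded (fun n => (@?a n).+1) => apply: (@poly_succ a)
  end.

(** * Collecting the costs as functions of n *)

Section Bounds.
Variables (k c' c : nat).

Definition gates_bound (n : nat) : nat := cost_full n (n ^ k) (2 ^ (c' * clog n)).
Definition self_bound (n : nat) : nat :=
  cost_self n (n ^ k) (c' * clog n) (2 ^ (c' * clog n)).
Definition formula_bound (n : nat) : nat :=
  12 * gates_bound n + 22 + (24 * self_bound n + 10).
Definition size_bound (n : nat) : nat :=
  gates_bound n + cost_proof n (gates_bound n) (n + n + code_len n n (n ^ k))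
    (self_bound n) (2 ^ (c' * clog n)) (code_len n n (n ^ k)) * rule_cost c *
    line_size c (formula_bound n).

Lemma poly_size_bound : poly_bounded size_bound.
Proof.
have pg : poly_bounded gates_bound.
  rewrite /gates_bound /cost_full /cost_corrected /cost_D2 /cost_eval /cost_group.
  by rewrite /cost_log /code_len; poly.
have ps : poly_bounded self_bound.
  rewrite /self_bound /cost_self /cost_D1 /cost_D2 /cost_eval /cost_group.
  by rewrite /cost_log; poly.
rewrite /size_bound /cost_proof /line_size /formula_bound /code_len.
repeat first [exact: pg | exact: ps | progress poly
  | match goal with
    | |- poly_bounded (fun n => @?a n + @?b n) => apply: (@poly_add a b)
    end].
Qed.

End Bounds.

Lemma cost_proof_le n G G' N S S' Z cl : G <= G' -> S <= S' ->
  cost_proof n G N S Z cl <= cost_proof n G' N S' Z cl.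
Proof.
move=> hG hS; rewrite /cost_proof.
have h : Z.+1 * (2 * n + 2 * n + 2 * G + 2) <= Z.+1 * (2 * n + 2 * n + 2 * G' + 2).
  by rewrite leq_mul2l; apply/orP; right; lia.
by move: (Z.+1 * _) (Z.+1 * _) h => x y h; lia.
Qed.

Theorem theorem6p1 (R : realType) (k : nat) (eps : R)
    (eps_gt0 : (0 < eps)%R) (eps_lt1 : (eps < 1)%R) :
  exists c0 : nat,
  forall f : seq bool -> bool, in_E f -> hard_on_average eps f ->
  forall (c' c'' : nat) (S : nat -> nat -> seq nat),
    c0 <= c'' -> NW_designs c' c'' S -> NW_polytime f c' S ->
  forall q g : nat -> nat,
    (forall n, 0 < n ->
       [/\ prime (q n), 2 ^ n.-1 < q n <= 2 ^ n & is_generator (q n) (g n)]) ->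
  forall n0 : nat,
  exists K N : nat, forall n : nat, N <= n ->
    (exists C : circuit,
       [/\ is_circuit n n C, csize C <= n ^ k & solves_dlog n (q n) (g n) C]) ->
    exists D : circuit,
      [/\ is_circuit n n D, csize D <= n ^ K,
          tautology (dlog_form n (q n) (g n) D) &
          exists pi : seq pform,
            P_eps_proof eps k c' f S q g n0 (dlog_form n (q n) (g n) D) pi /\
            proof_size pi <= n ^ K].
Proof.
have [c0 hard_nat] := hard_on_average_nat eps_gt0; exists c0.
move=> f _ /hard_nat hard c' c'' S le [n1 designs] _ q g hqg n0.
have {hard hard_nat} [n2 hard] := hard c'' le.
have [c hc] : exists c, is_scheme_bound c by apply: scheme_bound.
have [K [n3 bound]] := poly_size_bound k c' c.
(* 25 is the least n with 1/16 > 3/(2n), which makes the conclusion of self_n false when no seed is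
   accepted. The other bounds belong to the axioms, the designs, the hardness of f and the
   polynomial estimate. *)
exists K, (maxn 25 (maxn n0 (maxn n1 (maxn n2 n3)))) => n len [C [hC sC solves]].
have [qn_prime /andP[q_gt q_le] [/andP[_ g_lt] _]] : [/\ prime (q n),
    2 ^ n.-1 < q n <= 2 ^ n & is_generator (q n) (g n)] by apply: hqg; lia.
have q_gt1 := prime_gt1 qn_prime.
have {}bound : size_bound k c' c n <= n ^ K by apply: bound; lia.
set l := c' * clog n; set s := n ^ k.
set images := [seq NW f S n z | z <- all_bits l].
have sZ : size images = 2 ^ l by rewrite size_map size_all_bits.
have im_size : all (fun x => size x == n) images.
  by apply/allP => x /mapP[z _ ->]; rewrite size_mkseq.
pose cs := circuit_code n s C.
have cs_size : size cs = code_len n n s := size_circuit_code hC sC.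
have [hD sD] := D_circuit q_gt1 q_le g_lt im_size hC sC cs_size.
have taut := goal_tautology q_gt1 q_le g_lt im_size hC sC cs_size solves.
have [_ sGS _] := GS_spec q_gt1 q_le g_lt im_size hC sC cs_size solves.
rewrite sZ in sD sGS.
have hG : gates_bound k c' n <= n ^ K.
  by apply: leq_trans bound; rewrite leq_addr.
set D := Circuit _ _ in hD sD taut; exists D; split=> //.
  by apply: leq_trans sD (leq_trans _ hG); rewrite leq_addr.
(* The numerator of p = 1/8 over the denominator 2^n. *)
pose vP := 2 ^ (n - 3).
have e8 : 2 ^ n = 8 * vP by rewrite -[8]/(2 ^ 3) -expnD subnKC //; lia.
have vP0 : 0 < vP by rewrite expn_gt0.
have vP_lt : vP < 2 ^ n by rewrite e8; lia.
(* As C is correct, D1 accepts every element of the group, so the premise of self_n measures how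
   often the generator hits the group. *)
have cnt : count (accepted n (q n) (g n) s cs) images =
    count (fun x => 0 < bits_val x < q n) images.
  apply: eq_in_count => x hx; have /eqP sx := allP im_size x hx.
  rewrite /accepted circuit_codeE //; case: (boolP (0 < bits_val x < q n)) => // hb.
  by rewrite solves // eqxx.
have hNW : 2 ^ l <= 8 * count (fun x => 0 < bits_val x < q n) images.
  by apply: (@NW_in_group f c' c''); [lia | apply: designs; lia | apply: hard; lia |].
have prem : 2 ^ l * vP <= 2 ^ n * count (accepted n (q n) (g n) s cs) images.
  by rewrite cnt e8 mulnAC leq_mul2r hNW orbT.
have concl : ~~ (2 ^ l * (n * vP) <= 2 ^ (l + n) * 3).
  rewrite -ltnNge expnD -mulnA ltn_pmul2l ?expn_gt0 // e8 mulnAC ltn_pmul2r //.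
  by lia.
pose M := formula_bound k c' n.
pose Ax := P_eps_axiom eps k c' f S q g n0.
have hAx sigma : Ax (fsubst sigma (self_form k c' f S n (q n) (g n))).
  by exists n, sigma; split; [lia | left].
have sS := size_self s l q_gt1 q_le g_lt im_size; rewrite sZ in sS.
have sM : 12 * gates_bound k c' n + 22 <= M /\ 24 * self_bound k c' n + 10 <= M.
  by rewrite /M /formula_bound leq_addr leq_addl.
have dv := corrected_derivation (M := M) q_gt1 q_le g_lt vP_lt im_size hC sC cs_size
  solves hc prem concl hAx.
have [||pi [pi_proof pi_size]] := deriv_proof (dv _ _).
- by apply: leq_trans sM.1; rewrite leq_add2r leq_mul2l sGS.
- by apply: leq_trans sM.2; rewrite leq_add2r leq_mul2l sS.
exists pi; split; first exact: pi_proof.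
apply: leq_trans pi_size (leq_trans _ bound).
apply: leq_trans (leq_addl _ _); rewrite leq_mul2r leq_mul2r sZ.
by rewrite cost_proof_le ?orbT.
Qed.
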